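(* There is an absolute constant $\kappa>0$ such that for every Tadmor--Ritt operator $T$ on a complex Banach space $X$ and every $f\in B_{\infty,1}(\mathbb{D})$, $$\|f(T)\|\le\kappa\; C(T)\,\log(C(T)+1)\;\|f\|_{\ast},$$ where $f(T)$ is defined by $f(T)=\sum_{n=0}^\infty(W_n\ast f)(T)$.
   Context: $X$ is a (nonzero) complex Banach space; operators are bounded and linear; $R(z,T)=(zI-T)^{-1}$; $\mathbb{D}$ is the open unit disc, $\|g\|_{\infty,\mathbb{D}}=\sup_{z\in\mathbb{D}}|g(z)|$. $T$ is a Tadmor--Ritt operator if $\sigma(T)\subset\overline{\mathbb{D}}$ and $C(T):=\sup_{|z|>1}\|(z-1)R(z,T)\|<\infty$. The Besov space $B_{\infty,1}(\mathbb{D})$ consists of the holomorphic functions $f$ on $\mathbb{D}$ with $\|f\|_{\infty,\mathbb{D}}+\int_0^1\max_{\alpha}|f'(re^{i\alpha})|\,dr<\infty$. For holomorphic $g,f$ on $\mathbb D$ with Taylor coefficients $\hat g(k),\hat f(k)$, $(g\ast f)(z)=\sum_{k=0}^\infty\hat g(k)\hat f(k)z^k$. Let $W_0(z)=1+z$ and, for $n\ge1$, let $W_n$ be the polynomial whose coefficients $\widehat{W}_n(k)$ are the values at the integers $k$ of the triangular-shaped (piecewise linear) function supported in $[2^{n-1},2^{n+1}]$ with peak value $1$ at $2^n$ (linear on $[2^{n-1},2^n]$ and on $[2^n,2^{n+1}]$, zero at the endpoints). Then $f=\sum_{n=0}^\infty W_n\ast f$, and it is known that a holomorphic $f$ on $\mathbb{D}$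 belongs to $B_{\infty,1}(\mathbb{D})$ if and only if $\|f\|_\ast:=\sum_{n=0}^\infty\|W_n\ast f\|_{\infty,\mathbb{D}}<\infty$. Each $W_n\ast f$ is a polynomial, so $(W_n\ast f)(T)$ is defined. *)

(* Defs.v *)
From HB Require Import structures.
From mathcomp Require Import all_boot all_order all_algebra.
From mathcomp Require Import all_classical all_reals all_analysis.
From mathcomp Require Import complex.

Set Implicit Arguments.
Unset Strict Implicit.
Unset Printing Implicit Defensive.

Import Order.TTheory GRing.Theory Num.Theory.
Import numFieldNormedType.Exports.

Local Open Scope classical_set_scope.
Local Open Scope ring_scope.

(** Bounded linear operators on a complex Banach space *)

Section Operators.
Context {R : realType} {X : completeNormedModType R[i]}.
Implicit Types (A S T : X -> X) (z : R[i]) (x : X).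

(* `|x| is a nonnegative real element of R[i]; realnorm x is the same number
   in R. *)
Definition realnorm (V : normedModType R[i]) (x : V) : R := complex.Re `|x|.

Definition opnorm A : \bar R :=
  ereal_sup [set (realnorm (A x))%:E | x in [set x : X | `|x| <= 1]].

Definition bounded_op A : Prop := linear A /\ (opnorm A < +oo)%E.

Definition is_resolvent T z S : Prop :=
  [/\ bounded_op S,
      forall x, S (z *: x - T x) = x
    & forall x, z *: S x - T (S x) = x].

Definition spectrum T : set R[i] :=
  [set z | ~ exists S, is_resolvent T z S].

(* R(z, T); zero by convention when z lies in the spectrum. *)
Definition resolvent z T : X -> X :=
  xget (fun=> 0) [set S | is_resolvent T z S].

(* C(T), in [0, +oo]. *)
Definition ritt_const T : \bar R :=
  ereal_sup [set opnorm (fun x => (z - 1) *: resolvent z T x)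
            | z in [set z : R[i] | 1 < `|z|]].

Definition tadmor_ritt T : Prop :=
  [/\ bounded_op T,
      spectrum T `<=` [set z | `|z| <= 1]
    & (ritt_const T < +oo)%E].

Definition poly_op (p : {poly R[i]}) T : X -> X :=
  fun x => \sum_(k < size p) p`_k *: iter k T x.

End Operators.

(** Holomorphic functions on the open unit disc, represented by total
    functions whose values outside the disc are irrelevant *)

Section Besov.
Context {R : realType}.
Implicit Types (f g : R[i] -> R[i]) (n k : nat).

Definition unit_disc : set R[i] := [set z | `|z| < 1].

Definition holomorphic_disc f : Prop :=
  forall z, unit_disc z -> derivable (f : R[i]^o -> R[i]^o) z 1.

Definition cderive f : R[i] -> R[i] := derive1 (f : R[i] -> R[i]^o).

Definition taylor_coef f k : R[i] := iter k cderive f 0 / (k`!)%:R.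

Definition sup_disc g : \bar R :=
  ereal_sup [set (complex.Re `|g z|)%:E | z in unit_disc].

(* The maximum of |g(r e^(i a))| over real a. *)
Definition max_circle g (r : R) : \bar R :=
  ereal_sup [set (complex.Re `|g (r * cos a +i* (r * sin a))%C|)%:E
            | a in [set: R]].

Definition besov_norm f : \bar R :=
  (sup_disc f
   + \int[@lebesgue_measure R]_(r in `[0%R, 1%R[) max_circle (cderive f) r)%E.

Definition besov f : Prop := holomorphic_disc f /\ (besov_norm f < +oo)%E.

(* The piecewise linear function supported in [2^(n-1), 2^(n+1)] with peak
   value 1 at 2^n; only used for n >= 1. *)
Definition triangle n (x : R) : R :=
  if 2 ^+ n.-1 <= x <= 2 ^+ n then (x - 2 ^+ n.-1) / 2 ^+ n.-1
  else if 2 ^+ n <= x <= 2 ^+ n.+1 then (2 ^+ n.+1 - x) / 2 ^+ n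
  else 0.

Definition W n : {poly R[i]} :=
  if n is 0%N then 1 + 'X
  else \poly_(k < (2 ^ n.+1).+1) (triangle n k%:R)%:C%C.

(* Hadamard product p * f; it is a polynomial because p is. *)
Definition hadamard (p : {poly R[i]}) f : {poly R[i]} :=
  \poly_(k < size p) (p`_k * taylor_coef f k).

Definition star_norm f : \bar R :=
  (\sum_(0 <= n <oo) sup_disc (fun z => (hadamard (W n) f).[z]))%E.

End Besov.

Section Calculus.
Context {R : realType} {X : completeNormedModType R[i]}.

Definition besov_partial (f : R[i] -> R[i]) (T : X -> X) (N : nat) : X -> X :=
  fun x => \sum_(0 <= n < N) poly_op (hadamard (W n) f) T x.

(* f(T), the sum over n of the operators (W_n * f)(T).  The limit is taken
   pointwise, which agrees with the operator-norm sum when the latter exists. *)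
Definition besov_calc (f : R[i] -> R[i]) (T : X -> X) : X -> X :=
  fun x => lim (besov_partial f T N x @[N --> \oo]).

End Calculus.

(* Main.v *)
Require Import Defs.
From mathcomp Require Import all_boot all_order all_algebra.
From mathcomp Require Import all_classical all_reals all_analysis.
From mathcomp Require Import complex.
From mathcomp Require Import ring lra zify.

(** The estimate is proved block by block. For a polynomial [p] with frequencies between
    [m] and [4 m], the operator [p(T)] is the Riesz--Dunford integral of [p(z) R(z, T)] over
    a circle whose distance from the unit circle is of order [1 / m]. Where [|z - 1|] is
    at most of order [C / m], the bound [|R(z, T)| <= C / |z - 1|] and the triangle
    inequality give [C log (C + 1)], since [|z - 1|] ranges over scales from [1 / m] to
    [C / m]. On the rest of the circle one integrates by parts: a primitive of [p] is smaller
    than [p] by a factor [m], and the derivative of [z R(z, T)] is of size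
    [C ^ 2 / |z - 1| ^ 2], so this part contributes only [C]. Altogether [p(T)] is bounded by
    [C log (C + 1)] times the supremum of [p] on the disc, uniformly in [m]
    ([dyadic_poly_le]). Summing over the blocks [W_n * f] proves the theorem
    ([operator_series]).

    The integrals are replaced by means over the [M]-th roots of unity, which obey exact
    identities by orthogonality. Such a mean represents [p(T)] up to the factor
    [1 - r ^- M T ^ M] ([quadE]), and [r ^- M T ^ M] tends to 0 for every [r > 1] by a
    continuity argument of Rickart ([power_growth_gt1]). The comparison of [p] and of its
    discrete primitive on the circle of integration with [p] in the disc rests on one
    multiplier theorem for circles ([multiplier_circle]): slowly varying multipliers supported
    in an interval of length [L] are bounded uniformly in [L].

    It remains to see that the dyadic norm of a function in the Besov space is finite
    ([besov_star_norm]); this makes the partial sums converge in operator norm. By the same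
    multiplier theorem, [W_n * f] is bounded by [2 ^- n] times the maximum of [|f'|] on any
    circle whose distance from the unit circle is of order [2 ^- n], and these radii form
    disjoint intervals of length of order [2 ^- n], so the bounds add up to the integral of
    the maximum of [|f'|]. The argument needs [f] to be the sum of its Taylor series.
    Complex differentiability yields this through a version of Goursat's theorem for
    trapezoid sums ([goursat]), which gives Cauchy's formula as a limit of means over roots of
    unity ([cauchy_series], [holomorphic_taylor]). *)
Set Implicit Arguments.
Unset Strict Implicit.
Unset Printing Implicit Defensive.
Import Order.TTheory GRing.Theory Num.Theory.
Import numFieldNormedType.Exports.
Local Open Scope classical_set_scope.
Local Open Scope ring_scope.

(** * The real-valued norm *)
Section RealNorm.
Context {R : realType}.

(** Stated on [normedZmodType] so that it serves for the complex numbers and for vectors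
    alike. *)
Definition nrm (V : normedZmodType R[i]) (x : V) : R := complex.Re `|x|.

Section Zmodule.
Context {V : normedZmodType R[i]}.
Implicit Types x y z : V.

Lemma nrmE x : `|x| = (nrm x)%:C%C.
Proof. by rewrite /nrm RRe_real // ger0_real. Qed.

Lemma nrm_ge0 x : 0 <= nrm x.
Proof. by rewrite -ler0c -nrmE. Qed.

Lemma nrm0 : nrm (0 : V) = 0.
Proof. by rewrite /nrm normr0. Qed.

Lemma nrmN x : nrm (- x) = nrm x.
Proof. by rewrite /nrm normrN. Qed.

Lemma nrm_distC x y : nrm (x - y) = nrm (y - x).
Proof. by rewrite /nrm distrC. Qed.

Lemma nrm_eq0 x : (nrm x == 0) = (x == 0).
Proof.
rewrite -(normr_eq0 x) nrmE; apply/eqP/eqP => [->//|].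
by move=> h; apply: complexI; rewrite h.
Qed.

Lemma nrm_gt0 x : (0 < nrm x) = (x != 0).
Proof. by rewrite lt_neqAle nrm_ge0 andbT eq_sym nrm_eq0. Qed.

Lemma nrmD x y : nrm (x + y) <= nrm x + nrm y.
Proof. by rewrite -lecR rmorphD /= -!nrmE ler_normD. Qed.

Lemma nrmB x y : nrm (x - y) <= nrm x + nrm y.
Proof. by rewrite (le_trans (nrmD _ _)) // nrmN. Qed.

Lemma nrm_le_dist x y : nrm x <= nrm y + nrm (x - y).
Proof. by have := nrmD y (x - y); rewrite addrC subrK. Qed.

Lemma nrm_sum (I : Type) (s : seq I) (P : pred I) (F : I -> V) :
  nrm (\sum_(i <- s | P i) F i) <= \sum_(i <- s | P i) nrm (F i).
Proof.
elim/big_rec2: _ => [|i a x _ h]; first by rewrite nrm0.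
by rewrite (le_trans (nrmD _ _)) // lerD2l.
Qed.

End Zmodule.

Implicit Types z w : R[i].

Lemma nrmM z w : nrm (z * w) = nrm z * nrm w.
Proof. by apply: complexI; rewrite rmorphM /= -!nrmE normrM. Qed.

Lemma nrm1 : nrm (1 : R[i]) = 1.
Proof. by rewrite /nrm normr1. Qed.

Lemma nrmX z n : nrm (z ^+ n) = nrm z ^+ n.
Proof. by elim: n => [|n IH]; rewrite ?expr0 ?nrm1 // !exprS nrmM IH. Qed.

Lemma nrmV z : nrm z^-1 = (nrm z)^-1.
Proof.
have [->|z0] := eqVneq z 0; first by rewrite invr0 nrm0 invr0.
have z0' : nrm z != 0 by rewrite nrm_eq0.
by apply: (mulfI z0'); rewrite -nrmM !divff // nrm1.
Qed.

Lemma nrm_sqr (a b : R) : nrm (a +i* b)%C ^+ 2 = a ^+ 2 + b ^+ 2.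
Proof. by rewrite /nrm normc_def /= sqr_sqrtr // addr_ge0 // sqr_ge0. Qed.

Lemma nrm_real (a : R) : nrm a%:C%C = `|a|.
Proof.
apply/eqP; rewrite -(eqrXn2 (n := 2)) ?nrm_ge0 //.
by rewrite nrm_sqr real_normK ?num_real // expr0n addr0.
Qed.

Lemma nrm_nat n : nrm (n%:R : R[i]) = n%:R.
Proof. by rewrite -(rmorph_nat (real_complex R)) nrm_real ger0_norm. Qed.

Lemma nrmZ (V : normedModType R[i]) (a : R[i]) (x : V) :
  nrm (a *: x) = nrm a * nrm x.
Proof. by apply: complexI; rewrite rmorphM /= -!nrmE normrZ. Qed.

Lemma exists_expr_le (q e : R) : 0 <= q < 1 -> 0 < e ->
  exists M0 : nat, forall M, (M0 <= M)%N -> q ^+ M <= e.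
Proof.
move=> /andP[q0 q1] e0.
have /cvg_expr/cvgrPdist_le/(_ e e0) [M0 _ h] : `|q| < 1 by rewrite ger0_norm.
exists M0 => M hM; have := h M hM.
by rewrite sub0r normrN ger0_norm // exprn_ge0.
Qed.

End RealNorm.

(** * Roots of unity *)
Section Circle.
Context {R : realType}.
Implicit Types (s t : R).

Definition cis (t : R) : R[i] := (cos (pi *+ 2 * t) +i* sin (pi *+ 2 * t))%C.

Lemma cis0 : cis 0 = 1.
Proof. by rewrite /cis mulr0 cos0 sin0. Qed.

Lemma cis1 : cis 1 = 1.
Proof. by rewrite /cis mulr1 cos2pi sin2pi. Qed.

Lemma cisD s t : cis (s + t) = cis s * cis t.
Proof.
by rewrite /cis mulrDr cosD sinD; apply/eqP; rewrite eq_complex /=;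
  apply/andP; split; apply/eqP; ring.
Qed.

Lemma nrm_cis t : nrm (cis t) = 1.
Proof.
apply/eqP; rewrite -(eqrXn2 (n := 2)) ?nrm_ge0 //.
by rewrite nrm_sqr cos2Dsin2 expr1n.
Qed.

Lemma cis_neq0 t : cis t != 0.
Proof. by rewrite -nrm_eq0 nrm_cis oner_eq0. Qed.

Lemma cisN t : cis (- t) = (cis t)^-1.
Proof.
by apply: (mulfI (cis_neq0 t)); rewrite -cisD subrr cis0 divff ?cis_neq0.
Qed.

Lemma cisX t n : cis t ^+ n = cis (t * n%:R).
Proof.
elim: n => [|n IH]; first by rewrite mulr0 cis0.
by rewrite exprS IH -cisD -[n.+1%:R]/((1 + n)%:R) natrD mulrDr mulr1.
Qed.

Lemma cis_sub1_sqr t : nrm (cis t - 1) ^+ 2 = 4 * sin (pi * t) ^+ 2.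
Proof.
have -> : cis t - 1 = ((cos (pi *+ 2 * t) - 1) +i* sin (pi *+ 2 * t))%C.
  by apply/eqP; rewrite eq_complex /= subr0 !eqxx.
have -> : pi *+ 2 * t = (pi * t) *+ 2 by rewrite mulrnAl.
rewrite nrm_sqr cos_mulr2n sin_mulr2n.
have := sin2cos2 (pi * t); move: (sin (pi * t)) (cos (pi * t)) => a b h.
have -> : (b ^+ 2 *+ 2 - 1 - 1) ^+ 2 + ((b * a) *+ 2) ^+ 2
  = 4 * (b ^+ 2 - 1) ^+ 2 + 4 * (b ^+ 2 * a ^+ 2) by ring.
by rewrite h; ring.
Qed.

Lemma sin_le_id (x : R) : 0 <= x -> sin x <= x /\ exists2 c, 0 <= c <= x & sin x = cos c * x.
Proof.
rewrite le_eqVlt => /orP[/eqP <-|x0].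
  by rewrite sin0; split => //; exists 0; rewrite ?lexx // mulr0.
have [|c] := @MVT R (@sin R) (@cos R) 0 x x0.
  by apply: continuous_subspaceT => y; exact: continuous_sin.
rewrite sin0 !subr0 in_itv /= => /andP[c0 cx] ->; split.
  by rewrite -[leRHS]mul1r ler_pM2r // cos_le1.
by exists c => //; rewrite !ltW.
Qed.

(** By the mean value theorem and the monotonicity of the cosine, [sin x] is at least [2
    cos (x / 2) ^ 2 * (x / 2)], and [2 cos (x / 2) ^ 2 = 1 + cos x] is at least 1. *)
Lemma half_le_sin (x : R) : 0 <= x <= pi / 2 -> x / 2 <= sin x.
Proof.
move=> /andP[x0 xpi].
have p0 := @pi_gt0 R.
have [_ [c /andP[c0 cx] sE]] := @sin_le_id (x / 2) ltac:(lra).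
have xE : x = (x / 2) *+ 2 by rewrite -mulr_natr; field.
have sx : sin x = 2 * (cos (x / 2) * sin (x / 2)).
  by rewrite {1}xE sin_mulr2n mulr_natl.
have cosx : cos x = 2 * cos (x / 2) ^+ 2 - 1.
  by rewrite {1}xE cos_mulr2n mulr_natl.
have cx0 : 0 <= cos x by apply: cos_ge0_pihalf; apply/andP; split; lra.
have cc : cos (x / 2) <= cos c.
  rewrite le_eqVlt; have [->|ne] := eqVneq c (x / 2); first by rewrite eqxx.
  rewrite ltr_cos ?in_itv /=; last 2 first.
  - by apply/andP; split; lra.
  - by apply/andP; split; lra.
  by apply/orP; right; rewrite lt_neqAle ne cx.
have ch0 : 0 <= cos (x / 2) by apply: cos_ge0_pihalf; apply/andP; split; lra.
rewrite sx sE.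
have : cos (x/2) * cos (x/2) <= cos (x/2) * cos c by rewrite ler_wpM2l.
have : 1 <= 2 * (cos (x/2) * cos (x/2)) by rewrite -expr2; lra.
move=> h1 h2; have : 1 <= 2 * (cos (x/2) * cos c) by lra.
nra.
Qed.

Lemma cis_sub1_ge t : 0 <= t <= 2^-1 -> 2 * t <= nrm (cis t - 1).
Proof.
move=> /andP[t0 t1]; have p2 := @pi_ge2 R.
have h : pi * t / 2 <= sin (pi * t) by apply: half_le_sin; nra.
rewrite -ler_sqr ?nnegrE ?nrm_ge0 ?mulr_ge0 // cis_sub1_sqr.
have h2 : t <= sin (pi * t) by nra.
nra.
Qed.

Lemma cis_sub1_sym t : nrm (cis (1 - t) - 1) = nrm (cis t - 1).
Proof.
rewrite cisD cis1 mul1r cisN.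
have -> : (cis t)^-1 - 1 = - (cis t)^-1 * (cis t - 1).
  by rewrite mulrBr mulr1 mulNr mulVf ?cis_neq0 // opprK addrC.
by rewrite nrmM nrmN nrmV nrm_cis invr1 mul1r.
Qed.

Lemma cis_sub1_ge_min t : 0 <= t <= 1 ->
  2 * Num.min t (1 - t) <= nrm (cis t - 1).
Proof.
move=> /andP[t0 t1]; have [h|h] := leP t 2^-1.
  rewrite (le_trans _ (cis_sub1_ge _)) ?t0 // ler_pM2l // ge_min lexx.
  by [].
rewrite -cis_sub1_sym (le_trans _ (cis_sub1_ge _)) //; last by apply/andP; split; lra.
by rewrite ler_pM2l // ge_min lexx orbT.
Qed.

Lemma cis_sub1_le t : nrm (cis t - 1) <= 8 * `|t|.
Proof.
wlog t0 : t / 0 <= t.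
  move=> h; have [/h //|/ltW t0] := leP 0 t.
  rewrite -normrN -[nrm _]mul1r -invr1 -(nrm_cis (- t)).
  rewrite -cis_sub1_sym cisD cis1 mul1r nrm_cis invr1 mul1r.
  by apply: h; rewrite oppr_ge0.
have p4 : pi <= 4 :> R by have := @pihalf_lt2 R; lra.
have p0 := @pi_gt0 R.
rewrite ger0_norm // -ler_sqr ?nnegrE ?nrm_ge0 ?mulr_ge0 // cis_sub1_sqr.
have [h1|h1] := leP (pi * t) pi.
  have s0 : 0 <= sin (pi * t) by apply: sin_ge0_pi; rewrite h1 mulr_ge0 // ltW.
  have [h _] := @sin_le_id (pi * t) (mulr_ge0 (ltW p0) t0).
  have : sin (pi * t) <= 4 * t by nra.
  nra.
have t1 : 1 < t by nra.
have := sin_max (pi * t); rewrite -(@ler_sqr _ `|_|) ?nnegrE // real_normK ?num_real //.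
by rewrite expr1n; nra.
Qed.

Lemma cis_lip s t : nrm (cis s - cis t) <= 8 * `|s - t|.
Proof.
have -> : cis s - cis t = cis t * (cis (s - t) - 1).
  by rewrite mulrBr mulr1 -cisD [t + _]addrC subrK.
by rewrite nrmM nrm_cis mul1r cis_sub1_le.
Qed.

(** Its powers are the nodes of all the quadrature rules below, which stand for contour
    integrals over circles. *)
Definition om (M : nat) : R[i] := cis M%:R^-1.

Lemma nrm_om M : nrm (om M) = 1. Proof. exact: nrm_cis. Qed.

Lemma omX M j : om M ^+ j = cis (j%:R / M%:R).
Proof. by rewrite cisX mulrC. Qed.

Lemma nrm_omX M j : nrm (om M ^+ j) = 1. Proof. by rewrite omX nrm_cis. Qed.

Lemma om_neq0 M : om M != 0. Proof. exact: cis_neq0. Qed.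

Lemma om_expM M : (0 < M)%N -> om M ^+ M = 1.
Proof. by move=> M0; rewrite omX divff ?cis1 // pnatr_eq0 -lt0n. Qed.

Lemma omX_sub1_ge M j : (j <= M)%N ->
  2 * (minn j (M - j))%:R / M%:R <= nrm (om M ^+ j - 1).
Proof.
move=> jM; have [->|M0] := posnP M; first by rewrite invr0 mulr0 nrm_ge0.
have M0' : 0 < M%:R :> R by rewrite ltr0n.
rewrite omX (le_trans _ (cis_sub1_ge_min _)) //; last first.
  by rewrite divr_ge0 // ler_pdivrMr // mul1r ler_nat.
rewrite -mulrA ler_pM2l // le_min; apply/andP; split.
  by rewrite ler_pM2r ?invr_gt0 // ler_nat geq_minl.
rewrite ler_pdivrMr // mulrBl mul1r divfK ?gt_eqF // -natrB // ler_nat.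
exact: geq_minr.
Qed.

Lemma omX_neq1 M j : (0 < j < M)%N -> om M ^+ j != 1.
Proof.
move=> /andP[j0 jM]; rewrite -subr_eq0 -nrm_gt0.
rewrite (lt_le_trans _ (omX_sub1_ge (ltnW jM))) //.
rewrite divr_gt0 // ?ltr0n ?(leq_trans _ jM) // mulr_gt0 // ltr0n.
by rewrite leq_min j0 subn_gt0.
Qed.

Lemma om_sub1_le M : (0 < M)%N -> nrm (om M - 1) <= 8 / M%:R.
Proof.
move=> M0; rewrite (le_trans (cis_sub1_le _)) // ger0_norm //.
Qed.

Lemma sum_root_unity M (w : R[i]) : w ^+ M = 1 -> w != 1 ->
  \sum_(j < M) w ^+ j = 0.
Proof.
move=> wM w1; have /eqP := subrX1 w M; rewrite wM subrr eq_sym mulf_eq0 subr_eq0.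
by rewrite (negbTE w1) => /eqP.
Qed.

(** Orthogonality of the characters of the group of [M]-th roots of unity; in the
    quadrature rules it plays the part of the residue theorem. *)
Lemma om_orth M (a b : nat) : (a < M)%N -> (b < M)%N ->
  \sum_(j < M) (om M ^+ j) ^+ a / (om M ^+ j) ^+ b = (a == b)%:R * M%:R.
Proof.
move=> aM bM.
rewrite (eq_bigr (fun j : 'I_M => (om M ^+ a / om M ^+ b) ^+ j)); last first.
  by move=> j _; rewrite expr_div_n (exprAC _ a) (exprAC _ b).
have [->|ab] := eqVneq a b.
  rewrite divff ?expf_neq0 ?om_neq0 //.
  by under eq_bigr do rewrite expr1n; rewrite sumr_const card_ord mul1r.
rewrite mul0r; apply: sum_root_unity.
  by rewrite expr_div_n (exprAC _ a) (exprAC _ b) om_expM ?expr1n ?divr1 // (leq_trans _ aM).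
wlog lab : a b aM bM ab / (b < a)%N => [h|].
  have [/h->//|] := boolP (b < a)%N; rewrite -leqNgt leq_eqVlt (negbTE ab) /= => lab.
  rewrite -invr_eq1 invf_div h // eq_sym //.
rewrite -{1}(subnK (ltnW lab)) exprD mulfK ?expf_neq0 ?om_neq0 //.
by rewrite omX_neq1 // subn_gt0 lab (leq_ltn_trans (leq_subr _ _)).
Qed.

End Circle.

(** * A multiplier theorem on circles *)
Section Multiplier.
Context {R : realType}.
Implicit Types (mu a c : nat -> R[i]).

Lemma nrm_sqrC (z : R[i]) : (nrm z ^+ 2)%:C%C = z * conjc z.
Proof. by rewrite rmorphXn /= -nrmE sqr_normc. Qed.

Lemma conjc_om M j : conjc (om M ^+ j : R[i]) = (om M ^+ j)^-1.
Proof.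
rewrite rmorphXn -exprVn; congr (_ ^+ _).
by rewrite /om -cisN /cis mulrN cosN sinN.
Qed.

Lemma parseval M c :
  \sum_(j < M) nrm (\sum_(l < M) c l / (om M ^+ j) ^+ l) ^+ 2
  = M%:R * \sum_(l < M) nrm (c l) ^+ 2.
Proof.
apply: complexI; rewrite rmorphM /= !raddf_sum /= rmorph_nat.
rewrite (eq_bigr (fun j : 'I_M => \sum_(l < M) \sum_(k < M)
    c l * conjc (c k) * ((om M ^+ j) ^+ k / (om M ^+ j) ^+ l))); last first.
  move=> j _; rewrite nrm_sqrC rmorph_sum big_distrlr /=.
  apply: eq_bigr => l _; apply: eq_bigr => k _.
  rewrite rmorphM fmorphV rmorphXn /= conjc_om exprVn invrK.
  by rewrite mulrACA [X in _ * X]mulrC.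
rewrite exchange_big /= mulr_sumr; apply: eq_bigr => l _.
rewrite exchange_big /= (bigD1 l) //= [X in _ + X]big1 ?addr0 => [|l' ll'].
  by rewrite -mulr_sumr om_orth // eqxx mul1r nrm_sqrC mulrC.
rewrite -mulr_sumr om_orth //.
by move: ll'; rewrite -val_eqE /= => /negbTE ->; rewrite mul0r mulr0.
Qed.

(** Each circular distance is attained by at most two indices. *)
Lemma sum_min_le (g : nat -> R) M : (forall j, 0 <= g j) ->
  \sum_(j < M) g (minn j (M - j)) <= \sum_(j < M) g j + \sum_(j < M) g j.+1.
Proof.
move=> g0; rewrite [X in _ <= _ + X](reindex_inj rev_ord_inj) -big_split /=.
apply: ler_sum => j _; rewrite -subSn // subSS.
by have [_|_] := leqP j (M - j); rewrite ?lerDl ?lerDr.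
Qed.

(** Compare [(a + 1) ^- 2] with the telescoping term [a^-1 - (a + 1)^-1]. *)
Lemma sum_invsqr_le (A : R) N : 0 < A ->
  \sum_(j < N) (A + j.+1%:R) ^- 2 <= A^-1 - (A + N%:R)^-1.
Proof.
move=> A0; elim: N => [|N IH]; first by rewrite big_ord0 addr0 subrr.
rewrite big_ord_recr /=.
have a0 : 0 < A + N%:R by rewrite ltr_wpDr.
have aE : A + N.+1%:R = (A + N%:R) + 1 by rewrite -addn1 natrD addrA.
rewrite aE; move: (A + N%:R) a0 IH => a a0 IH.
rewrite (le_trans (lerD IH (lexx _))) // -subr_ge0.
have -> : A^-1 - (a + 1)^-1 - (A^-1 - a^-1 + (a + 1) ^- 2) =
  a^-1 * (a + 1) ^- 2 by field; rewrite !gt_eqF // ltr_wpDr.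
by rewrite mulr_ge0 // ?invr_ge0 ?exprn_ge0 ?addr_ge0 // ltW.
Qed.

(** The chord from 1 to [om M ^+ j] is at least [2 d / M] for [d] the circular distance of
    [j], so the terms are small as soon as [d] exceeds [M / L]. *)
Lemma sum_weight_le M (L : R) : (0 < M)%N -> 0 < L -> L <= M%:R ->
  \sum_(j < M) (1 + L ^+ 2 * nrm (om M ^+ j - 1 : R[i]) ^+ 2)^-1 <= 4 * M%:R / L.
Proof.
move=> M0 L0 LM; pose A := M%:R / (2 * L).
have m0 : 0 < M%:R :> R by rewrite ltr0n.
have A0 : 0 < A by rewrite divr_gt0 // mulr_gt0.
pose g j : R := 2 * A ^+ 2 * (A + j%:R) ^- 2.
have g0 j : 0 <= g j.
  by rewrite /g divr_ge0 ?sqr_ge0 // mulr_ge0 ?sqr_ge0.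
apply: (@le_trans _ _ (\sum_(j < M) g (minn j (M - j)))).
  apply: ler_sum => j _.
  have := @omX_sub1_ge R M j (ltnW (ltn_ord j)).
  move: (nrm _) (nrm_ge0 (om M ^+ j - 1 : R[i])) (minn _ _) => y y0 d hy.
  have d0 : 0 <= d%:R :> R by [].
  rewrite /g -[X in _ <= X]invrK lef_pV2 ?posrE; last 2 first.
  - by rewrite ltr_pwDl // mulr_ge0 ?sqr_ge0.
  - have Ad : 0 < A + d%:R by rewrite ltr_wpDr.
    by rewrite invr_gt0 divr_gt0 ?exprn_gt0 // mulr_gt0 ?exprn_gt0.
  have hd : d%:R / A <= L * y.
    have -> : d%:R / A = L * (2 * d%:R / M%:R).
      by rewrite /A; field; rewrite !gt_eqF.
    by rewrite ler_pM2l.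
  have hd0 : 0 <= d%:R / A by rewrite divr_ge0 // ltW.
  have -> : (2 * A ^+ 2 * (A + d%:R) ^- 2)^-1 = (1 + d%:R / A) ^+ 2 / 2.
    by field; rewrite !gt_eqF // ltr_wpDr.
  rewrite -exprMn; move: (d%:R / A) (L * y) hd hd0 => u v uv u0.
  have h1 : u ^+ 2 <= v ^+ 2 by rewrite ler_sqr ?nnegrE // (le_trans u0).
  have h2 : (1 + u) ^+ 2 / 2 = 1 + u ^+ 2 - (u - 1) ^+ 2 / 2 by field.
  have := sqr_ge0 (u - 1); lra.
apply: (le_trans (sum_min_le _ g0)).
have s1 : \sum_(j < M) g j.+1 <= 2 * A.
  rewrite -mulr_sumr (le_trans (ler_wpM2l _ (sum_invsqr_le M A0))) //.
    by rewrite mulr_ge0 // sqr_ge0.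
  rewrite mulrBr -[leRHS]subr0 lerB //.
    by rewrite expr2 mulrA mulfK ?gt_eqF.
  by rewrite divr_ge0 ?addr_ge0 ?(ltW A0) // mulr_ge0 ?sqr_ge0.
have s0 : \sum_(j < M) g j <= 2 + 2 * A.
  rewrite -(prednK M0) big_ord_recl lerD //.
    by rewrite /g addr0 mulfK ?expf_neq0 ?gt_eqF.
  have sp : \sum_(i < M.-1) g i.+1 <= \sum_(j < M.-1.+1) g j.+1.
    by rewrite big_ord_recr /= lerDl.
  by apply: (le_trans sp); rewrite prednK.
apply: (le_trans (lerD s0 s1)).
have -> : 2 + 2 * A + 2 * A = 2 + 2 * (M%:R / L) by rewrite /A; field; rewrite gt_eqF.
have : 1 <= M%:R / L by rewrite ler_pdivlMr ?mul1r.
rewrite -mulrA; lra.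
Qed.

(** A multiplier acts on circles by convolution with the kernel [K] whose coefficients are
    [mu], so its norm is at most the mean of [|K|]. Weigh [K] with [1 + L ^ 2 |om - 1| ^
    2]: multiplying [K] by [om - 1] amounts to taking differences of [mu], so Parseval
    bounds the weighted square mean by the sizes of [mu] and of its differences, and the
    inverse weight has mean at most [4 / L]. *)
Lemma multiplier_circle (L N : nat) (mu a : nat -> R[i]) (V B rho : R) :
  (0 < L)%N -> 0 < V -> mu 0%N = 0 -> (forall k, (L <= k)%N -> mu k = 0) ->
  (forall k, nrm (mu k) <= V) ->
  (forall k, nrm (mu k.+1 - mu k) <= V / L%:R) ->
  (forall z, nrm z = rho -> nrm (\sum_(k < N) a k * z ^+ k) <= B) ->
  forall z, nrm z = rho ->
    nrm (\sum_(k < N) mu k * a k * z ^+ k) <= 3 * V * B.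
Proof.
move=> L0 V0 mu0 muL muV dmu aB z zr.
pose M := (N + L).+1.
have M0 : M%:R != 0 :> R[i] by rewrite pnatr_eq0.
have M0' : 0 < M%:R :> R by rewrite ltr0n.
have L0' : 0 < L%:R :> R by rewrite ltr0n.
pose K j := \sum_(l < M) mu l / (om M ^+ j) ^+ l.
have E : \sum_(k < N) mu k * a k * z ^+ k =
    M%:R^-1 * \sum_(j < M) K j * \sum_(k < N) a k * (z * om M ^+ j) ^+ k.
  apply: (mulfI M0); rewrite mulrA divff // mul1r.
  rewrite [RHS](eq_bigr (fun j : 'I_M => \sum_(l < M) \sum_(k < N)
    mu l * a k * z ^+ k * (om M ^+ j ^+ k / om M ^+ j ^+ l))); last first.
    move=> j _; rewrite big_distrlr /=.
    apply: eq_bigr => l _; apply: eq_bigr => k _.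
    by rewrite exprMn; ring.
  rewrite [RHS]exchange_big /=.
  under [RHS]eq_bigr do rewrite exchange_big /=.
  rewrite exchange_big /= mulr_sumr; apply: eq_bigr => k _.
  have kM : (k < M)%N by rewrite /M ltnS (leq_trans (ltnW (ltn_ord k))) ?leq_addr.
  rewrite (bigD1 (Ordinal kM)) //= [X in _ + X]big1 ?addr0 => [|l ll'].
    by rewrite -mulr_sumr om_orth // eqxx mul1r mulrC.
  rewrite -mulr_sumr om_orth //.
  move: ll'; rewrite -val_eqE /= eq_sym => /negbTE ->; rewrite mul0r mulr0.
  by [].
have LM : (L <= M)%N by rewrite /M ltnW // ltnS leq_addl.
have B0 : 0 <= B by rewrite (le_trans (nrm_ge0 _) (aB z zr)).
rewrite E nrmM nrmV nrm_nat mulrC ler_pdivrMr //.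
apply: (le_trans (nrm_sum _ _ _)).
have K2 : \sum_(j < M) nrm (K j) ^+ 2 <= M%:R * (L%:R * V ^+ 2).
  rewrite parseval ler_pM2l // -(subnKC LM).
  rewrite big_split_ord /= [X in _ + X]big1 ?addr0 => [|l _]; last first.
    by rewrite muL ?leq_addr // nrm0 expr0n.
  apply: (@le_trans _ _ (\sum_(l < L) V ^+ 2)).
    by apply: ler_sum => l _; rewrite ler_sqr ?nnegrE ?nrm_ge0 // ltW.
  by rewrite sumr_const card_ord mulr_natl.
have dK j : (om M ^+ j - 1) * K j =
    \sum_(l < M) (mu l.+1 - mu l) / (om M ^+ j) ^+ l.
  rewrite mulrBl mul1r.
  under [RHS]eq_bigr do rewrite mulrBl.
  rewrite sumrB; congr (_ - _).
  rewrite /K big_ord_recl mu0 mul0r add0r big_ord_recr /=.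
  rewrite [mu M]muL ?mul0r ?addr0 //.
  rewrite mulr_sumr; apply: eq_bigr => l _.
  have := expf_neq0 j (om_neq0 M : om M != 0 :> R[i]).
  rewrite /bump /= add1n; move: (om M ^+ j) => w w0.
  by rewrite exprS; field; rewrite w0 expf_neq0.
have dK2 : \sum_(j < M) nrm ((om M ^+ j - 1) * K j) ^+ 2 <= M%:R * (V ^+ 2 / L%:R).
  under eq_bigr do rewrite dK.
  rewrite (parseval M (fun l => mu l.+1 - mu l)) ler_pM2l //.
  rewrite -(subnKC LM).
  rewrite big_split_ord /= [X in _ + X]big1 ?addr0 => [|l _]; last first.
    by rewrite !muL ?subrr ?nrm0 ?expr0n // ?leq_addr // -addnS leq_addr.
  apply: (@le_trans _ _ (\sum_(l < L) (V / L%:R) ^+ 2)).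
    by apply: ler_sum => l _; rewrite ler_sqr ?nnegrE ?nrm_ge0 // divr_ge0 // ltW.
  rewrite sumr_const card_ord -[_ *+ L]mulr_natl le_eqVlt; apply/orP; left.
  by apply/eqP; field; rewrite gt_eqF.
have KS : \sum_(j < M) nrm (K j) <= 3 * V * M%:R.
  (* Cauchy--Schwarz in the form [x <= la / (2 u) + u x ^ 2 / (2 la)], where [u] is the
      weight and [la] makes both sums of the same order. *)
  pose h j := 1 + L%:R ^+ 2 * nrm (om M ^+ j - 1 : R[i]) ^+ 2.
  have h0 j : 0 < h j by rewrite /h ltr_pwDl // mulr_ge0 ?sqr_ge0.
  pose la := V * L%:R.
  have la0 : 0 < la by rewrite mulr_gt0.
  apply: (@le_trans _ _ (\sum_(j < M) (la / 2 * (h j)^-1 +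
    (2 * la)^-1 * (nrm (K j) ^+ 2 + L%:R ^+ 2 * nrm ((om M ^+ j - 1) * K j) ^+ 2)))).
    apply: ler_sum => j _.
    have -> : nrm (K j) ^+ 2 + L%:R ^+ 2 * nrm ((om M ^+ j - 1) * K j) ^+ 2 =
      h j * nrm (K j) ^+ 2 by rewrite nrmM /h; ring.
    have := h0 j; move: (h j) (nrm (K j)) => u x u0.
    rewrite -subr_ge0.
    have -> : la / 2 / u + (2 * la)^-1 * (u * x ^+ 2) - x =
      (la - u * x) ^+ 2 / (2 * la * u) by field; rewrite !gt_eqF.
    by rewrite divr_ge0 ?sqr_ge0 // !mulr_ge0 // ltW.
  rewrite big_split /= -!mulr_sumr big_split /= -mulr_sumr.
  have LMR : L%:R <= M%:R :> R by rewrite ler_nat.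
  have := @sum_weight_le M L%:R isT L0' LMR.
  rewrite -/h; move: (\sum_(j < M) (h j)^-1) => s1 hs1.
  have h1 : la / 2 * s1 <= 2 * V * M%:R.
    rewrite (le_trans (ler_wpM2l _ hs1)) ?divr_ge0 ?(ltW la0) //.
    by rewrite /la le_eqVlt; apply/orP; left; apply/eqP; field; rewrite gt_eqF.
  have h2 : (2 * la)^-1 * (\sum_(j < M) nrm (K j) ^+ 2 +
     L%:R ^+ 2 * \sum_(j < M) nrm ((om M ^+ j - 1) * K j) ^+ 2) <= V * M%:R.
    rewrite mulrC ler_pdivrMr ?mulr_gt0 //.
    rewrite (le_trans (lerD K2 (ler_wpM2l (sqr_ge0 _) dK2))) // /la.
    by rewrite le_eqVlt; apply/orP; left; apply/eqP; field; rewrite gt_eqF.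
  lra.
apply: (@le_trans _ _ (\sum_(j < M) nrm (K j) * B)).
  apply: ler_sum => j _; rewrite nrmM ler_wpM2l ?nrm_ge0 // aB //.
  by rewrite nrmM nrm_omX mulr1.
by rewrite -mulr_suml [3 * V * B * _]mulrAC ler_wpM2r.
Qed.

End Multiplier.

(** * Linear operators and their norm *)
Section OperatorNorm.
Context {R : realType} {X : completeNormedModType R[i]}.
Implicit Types (A : X -> X) (x : X).

Lemma linear_fun0 A : linear A -> A 0 = 0.
Proof. by move=> /(_ (-1) 0 0); rewrite scaler0 add0r scaleN1r addNr. Qed.

Lemma linear_funD A : linear A -> {morph A : x y / x + y}.
Proof. by move=> h x y; have := h 1 x y; rewrite !scale1r. Qed.

Lemma linear_funZ A : linear A -> forall (a : R[i]) x, A (a *: x) = a *: A x.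
Proof. by move=> h a x; have := h a x 0; rewrite (linear_fun0 h) !addr0. Qed.

Lemma linear_funB A : linear A -> {morph A : x y / x - y}.
Proof.
by move=> h x y; rewrite (linear_funD h) -scaleN1r (linear_funZ h) scaleN1r.
Qed.

Lemma linear_fun_sum A : linear A ->
  forall (I : Type) (s : seq I) (P : pred I) (F : I -> X),
  A (\sum_(i <- s | P i) F i) = \sum_(i <- s | P i) A (F i).
Proof.
move=> h I s P F; elim/big_rec2: _ => [|i u v _ <-]; first exact: linear_fun0.
by rewrite (linear_funD h).
Qed.

Lemma linear_iter A k : linear A -> linear (iter k A).
Proof. by move=> h; elim: k => [//|k IH] a u v /=; rewrite IH h. Qed.

Lemma opnormP A (c : R) : linear A -> 0 <= c ->
  (opnorm A <= c%:E)%E <-> forall x, nrm (A x) <= c * nrm x.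
Proof.
move=> linA c0; split => [h x|h].
  have [->|x0] := eqVneq x 0; first by rewrite (linear_fun0 linA) !nrm0 mulr0.
  have n0 : 0 < nrm x by rewrite nrm_gt0.
  have nC0 : (nrm x)%:C%C != 0 by rewrite -nrmE normr_eq0.
  pose y := (nrm x)%:C%C^-1 *: x.
  have y1 : `|y| <= 1.
    by rewrite nrmE nrmZ nrmV nrm_real ger0_norm ?nrm_ge0 // mulVf ?gt_eqF.
  have : ((nrm (A y))%:E <= c%:E)%E.
    by apply: le_trans h; apply: ereal_sup_ubound; exists y.
  rewrite lee_fin /y (linear_funZ linA) nrmZ nrmV nrm_real ger0_norm ?nrm_ge0 //.
  by rewrite mulrC ler_pdivrMr.
apply: ge_ereal_sup => _ [x /= x1 <-]; rewrite lee_fin.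
apply: (le_trans (h x)); rewrite -[leRHS]mulr1 ler_wpM2l //.
by rewrite -lecR -nrmE.
Qed.

Lemma opnorm_ge0 A : linear A -> (0 <= opnorm A)%E.
Proof.
move=> linA; apply: ereal_sup_ubound; exists 0 => /=; first by rewrite normr0 ler01.
by rewrite (linear_fun0 linA) /realnorm normr0.
Qed.

End OperatorNorm.

(** * Cut-off multipliers *)
Section Cutoff.
Context {R : realType}.

(** The quadratic start keeps the quotient by [om M ^+ k - 1], which is of size [k / M], a
    multiplier with small differences. *)
Definition plateau (x : R) : R :=
  if x <= 1 then x ^+ 2 else if x <= 4 then 1 else if x <= 5 then 5 - x else 0.

Lemma plateau_ge0 x : 0 <= plateau x.
Proof.
rewrite /plateau; case: ifP => _; first exact: sqr_ge0.
by case: ifP => // _; case: ifP => // h; rewrite subr_ge0.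
Qed.

Lemma plateau_le1 x : 0 <= x -> plateau x <= 1.
Proof.
rewrite /plateau => x0; case: (leP x 1) => h1; first by nra.
case: (leP x 4) => h4 //; case: (leP x 5) => h5 //; lra.
Qed.

Lemma plateau_le_sqr x : 0 <= x -> plateau x <= x ^+ 2.
Proof.
rewrite /plateau => x0; case: (leP x 1) => h1 //.
by case: (leP x 4) => h4; [|case: (leP x 5) => h5]; nra.
Qed.

(** The second bound expresses the quadratic start: near 0 the variation is small in
    proportion to the point. *)
Lemma plateau_step (x h : R) : 0 <= x -> 0 <= h <= 1 ->
  `|plateau (x + h) - plateau x| <= 2 * h /\ `|plateau (x + h) - plateau x| <= 2 * h * (x + h).
Proof.
move=> x0 /andP[h0 h1]; rewrite !ler_norml /plateau.
case: (leP x 1) => h2; case: (leP (x + h) 1) => h3; try lra.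
- by split; apply/andP; split; nra.
- by case: (leP (x + h) 4) => h4; [|lra]; split; apply/andP; split; nra.
have hx : h <= h * (x + h) by nra.
case: (leP x 4) => h4; case: (leP (x + h) 4) => h5; try lra.
  by case: (leP (x + h) 5) => h6; [|lra]; split; apply/andP; split; lra.
by case: (leP x 5) => h6; case: (leP (x + h) 5) => h7; try lra;
  split; apply/andP; split; lra.
Qed.

(** The product of [(1 + x) ^+ n] and [(1 - x) ^+ n] is at most 1, and Bernoulli's
    inequality bounds the second factor from below. *)
Lemma expr1D_le (x : R) n : 0 <= x -> n%:R * x <= 2^-1 -> (1 + x) ^+ n <= 2.
Proof.
move=> x0 nx; have [->|n0] := posnP n; first by rewrite expr0; lra.
have n1 : 1 <= n%:R :> R by rewrite ler1n.
have x1 : x <= 2^-1 by nra.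
have bern k : 1 - k%:R * x <= (1 - x) ^+ k.
  elim: k => [|k IH]; first by rewrite mul0r subr0 expr0.
  rewrite exprS -addn1 natrD; have := ler0n R k; nra.
have h1 : 2^-1 <= (1 - x) ^+ n by apply: le_trans (bern n); lra.
have h2 : (1 + x) ^+ n * (1 - x) ^+ n <= 1.
  by rewrite -exprMn exprn_ile1 //; nra.
have h3 : 0 <= (1 + x) ^+ n by rewrite exprn_ge0 //; lra.
nra.
Qed.

Variable m : nat.
Hypothesis m0 : (0 < m)%N.

(** Radius of the circle of integration for a polynomial with frequencies between [m] and
    [4 * m]: it stays at distance of order [1 / m] from the unit circle, and powers of
    order [m] remain bounded on it. *)
Definition outer : R := 1 + (20 * m%:R)^-1.

Let mR : 0 < m%:R :> R. Proof. by rewrite ltr0n. Qed.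
Let m1 : 1 <= m%:R :> R. Proof. by rewrite ler1n. Qed.

Lemma outer_gt1 : 1 < outer.
Proof. by rewrite /outer ltrDl invr_gt0 mulr_gt0. Qed.

Lemma outer_le2 : outer <= 2.
Proof.
rewrite /outer (_ : 2 = 1 + 1) // lerD2l invf_le1 ?mulr_gt0 //.
by rewrite (le_trans m1) // ler_peMl // ler1n.
Qed.

(** On the frequencies from [m] to [4 * m] this is [outer ^+ (2 * k)], the factor between
    the circles of radius [outer^-1] and [outer]. *)
Definition cut k : R := plateau (k%:R / m%:R) * outer ^+ k.*2.

Let x0 k : 0 <= k%:R / m%:R :> R. Proof. by rewrite divr_ge0. Qed.

Lemma cut0 : cut 0 = 0.
Proof. by rewrite /cut mul0r /plateau ler01 expr0n mul0r. Qed.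

Lemma cut_big k : (5 * m <= k)%N -> cut k = 0.
Proof.
move=> mk; have h5 : 5 <= k%:R / m%:R :> R by rewrite ler_pdivlMr // -natrM ler_nat.
rewrite /cut /plateau; move: (k%:R / m%:R) h5 => x h5.
by do 3 (case: ifP => ? ; first by lra || (rewrite (_ : x = 5) ?subrr ?mul0r //; lra));
  rewrite mul0r.
Qed.

Lemma cut_mid k : (m <= k <= 4 * m)%N -> cut k = outer ^+ k.*2.
Proof.
move=> /andP[mk km].
have h1 : 1 <= k%:R / m%:R :> R by rewrite ler_pdivlMr // mul1r ler_nat.
have h4 : k%:R / m%:R <= 4 :> R by rewrite ler_pdivrMr // -natrM ler_nat.
rewrite /cut /plateau; move: (k%:R / m%:R) h1 h4 => x h1 h4.
have [h|_] := leP x 1; last by rewrite h4 mul1r.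
by rewrite (_ : x = 1) ?expr1n ?mul1r //; apply/eqP; rewrite eq_le h h1.
Qed.

Lemma outerX_le2 k : (k <= 10 * m)%N -> outer ^+ k <= 2.
Proof.
move=> km; apply: expr1D_le; first by rewrite invr_ge0 mulr_ge0.
rewrite ler_pdivrMr ?mulr_gt0 //.
have : k%:R <= (10 * m)%:R :> R by rewrite ler_nat.
rewrite natrM; lra.
Qed.

Lemma cut_ge0 k : 0 <= cut k.
Proof. by rewrite mulr_ge0 ?plateau_ge0 // exprn_ge0 // (le_trans ler01) // ltW // outer_gt1. Qed.

Lemma cut_le k : cut k <= 2 /\ cut k <= 2 * (k%:R / m%:R) ^+ 2.
Proof.
have [h|h] := leqP (5 * m) k.
  by rewrite cut_big // !mulr_ge0 ?sqr_ge0.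
have h2 : outer ^+ k.*2 <= 2 by apply: outerX_le2; rewrite -mul2n; lia.
have h0 : 0 <= outer ^+ k.*2 by rewrite exprn_ge0 // (le_trans ler01) // ltW // outer_gt1.
have b0 := plateau_ge0 (k%:R / m%:R); rewrite /cut; split.
  by have := plateau_le1 (x0 k); nra.
by have := plateau_le_sqr (x0 k); nra.
Qed.

Lemma cut_step k : `|cut k.+1 - cut k| <= 5 / m%:R /\
  `|cut k.+1 - cut k| <= 5 * k.+1%:R / m%:R ^+ 2.
Proof.
have [h|h] := leqP (5 * m) k.
  by rewrite !cut_big ?(leq_trans h) // subrr normr0 !divr_ge0 ?mulr_ge0 ?sqr_ge0.
have h2 : outer ^+ k.+1.*2 <= 2 by apply: outerX_le2; rewrite -mul2n; lia.
have k2 : outer ^+ k.*2 <= 2 by apply: outerX_le2; rewrite -mul2n; lia.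
have g1 := outer_gt1.
have h0 n : 1 <= outer ^+ n by rewrite exprn_ege1 // ltW.
have hE : outer ^+ k.+1.*2 = outer ^+ k.*2 * outer ^+ 2.
  by rewrite -exprD doubleS addn2.
have kE : k.+1%:R / m%:R = k%:R / m%:R + m%:R^-1 :> R.
  by rewrite -addn1 natrD mulrDl mul1r.
have mi1 : (0 <= (m%:R^-1 : R) <= 1) by rewrite invr_ge0 ler0n invf_le1.
have o2 : outer ^+ 2 - 1 <= m%:R^-1 / 5.
  have -> : outer ^+ 2 - 1 = m%:R^-1 / 10 + (m%:R^-1) ^+ 2 / 400.
    by rewrite /outer; field; rewrite gt_eqF.
  move: (m%:R^-1) mi1 => u /andP[]; nra.
have [b1 b2] := plateau_step (x0 k) mi1.
have bl1 := plateau_le1 (x0 k); have bl2 := plateau_le_sqr (x0 k).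
have b0 := plateau_ge0 (k%:R / m%:R).
have -> : 5 * k.+1%:R / m%:R ^+ 2 = 5 * m%:R^-1 * (k%:R / m%:R + m%:R^-1) :> R.
  by rewrite -kE; field; rewrite gt_eqF.
have cE : cut k.+1 - cut k = outer ^+ k.+1.*2 *
  (plateau (k%:R / m%:R + m%:R^-1) - plateau (k%:R / m%:R)) +
  plateau (k%:R / m%:R) * outer ^+ k.*2 * (outer ^+ 2 - 1).
  by rewrite /cut kE hE; ring.
have xk := x0 k.
have : `|cut k.+1 - cut k| <= 2 * `|plateau (k%:R / m%:R + m%:R^-1) - plateau (k%:R / m%:R)|
     + plateau (k%:R / m%:R) * 2 * (m%:R^-1 / 5).
  rewrite cE (le_trans (ler_normD _ _)) // lerD //.
    by rewrite normrM ler_wpM2r // ger0_norm // (le_trans ler01).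
  have o0 : 0 <= outer ^+ 2 - 1 by rewrite subr_ge0.
  rewrite ger0_norm; last by rewrite !mulr_ge0 // (le_trans ler01).
  rewrite ler_pM // ?mulr_ge0 // ?(le_trans ler01) //.
  by rewrite ler_wpM2l.
have bx : plateau (k%:R / m%:R) <= k%:R / m%:R + m%:R^-1.
  have H (b u v : R) : 0 <= u -> 0 <= v -> b <= 1 -> b <= u ^+ 2 -> b <= u + v.
    by move=> *; have [u1|u1] := leP u 1; nra.
  by case/andP: mi1 => v0 _; exact: H.
have F (u v w x y : R) : 0 <= y -> 0 <= x -> 0 <= u ->
    v <= 2 * y -> v <= 2 * y * (x + y) -> u <= 1 -> u <= x + y ->
    w <= 2 * v + u * 2 * (y / 5) -> w <= 5 * y /\ w <= 5 * y * (x + y).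
  by move=> *; split; nra.
by case/andP: mi1 => v0 _; exact: F.
Qed.

Section Bounds.
Variables (a : nat -> R[i]) (N : nat) (B : R).
Hypothesis supp : forall k, ~~ (m <= k <= 4 * m)%N -> a k = 0.
Hypothesis aB : forall z : R[i], nrm z = outer^-1 -> nrm (\sum_(k < N) a k * z ^+ k) <= B.

Let oC0 : outer%:C%C != 0 :> R[i].
Proof. by rewrite -nrm_eq0 nrm_real normr_eq0 gt_eqF // (lt_trans ltr01) // outer_gt1. Qed.

Let o0 : 0 < outer. Proof. by rewrite (lt_trans ltr01) // outer_gt1. Qed.

(** If [z] has modulus [outer], then [z / outer ^+ 2] has modulus [outer^-1] and lies in
    the disc. *)
Lemma apply_cut (z : R[i]) (c : nat -> R[i]) :
  \sum_(k < N) (cut k)%:C%C * c k * a k * (z / outer%:C%C ^+ 2) ^+ k =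
  \sum_(k < N) a k * c k * z ^+ k.
Proof.
apply: eq_bigr => k _; have [h|h] := boolP (m <= k <= 4 * m)%N; last first.
  by rewrite supp // mulr0 !mul0r.
rewrite cut_mid // rmorphXn /= expr_div_n -exprM mul2n.
have := expf_neq0 k.*2 oC0; move: (outer%:C%C ^+ _) => u u0; by field.
Qed.

Let nrm_shrunk (z : R[i]) : nrm z = outer -> nrm (z / outer%:C%C ^+ 2) = outer^-1.
Proof.
move=> zo; rewrite nrmM nrmV nrmX nrm_real ger0_norm ?(ltW o0) // zo.
by field; rewrite gt_eqF.
Qed.

(** The multiplier [cut] vanishes from [5 * m] on and has differences at most [5 / m = 25
    / (5 * m)]. *)
Lemma poly_outer_le (z : R[i]) : nrm z = outer ->
  nrm (\sum_(k < N) a k * z ^+ k) <= 75 * B.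
Proof.
move=> zo.
have -> : \sum_(k < N) a k * z ^+ k = \sum_(k < N) (cut k)%:C%C * a k * (z / outer%:C%C ^+ 2) ^+ k.
  have := apply_cut z (fun=> 1); under eq_bigr do rewrite mulr1.
  by under [RHS]eq_bigr do rewrite mulr1.
have -> : 75 * B = 3 * 25 * B by ring.
apply: (@multiplier_circle R (5 * m) N (fun k => (cut k)%:C%C) a 25 B outer^-1) => //.
- by rewrite muln_gt0.
- by rewrite cut0.
- by move=> k mk; rewrite cut_big.
- move=> k; rewrite nrm_real ger0_norm ?cut_ge0 //; have [h _] := cut_le k.
  by rewrite (le_trans h) // ler_nat.
- move=> k; rewrite -rmorphB nrm_real; have [h _] := cut_step k.
  rewrite (le_trans h) // natrM le_eqVlt; apply/orP; left; apply/eqP.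
  by field; rewrite gt_eqF.
- exact: nrm_shrunk.
Qed.

(** Dividing the coefficients by [om M ^+ k - 1] inverts the difference between
    neighbouring nodes. As the frequencies are at least [m], this discrete primitive
    exceeds the polynomial by a factor [M / m] only, instead of [M]. *)
Lemma primitive_outer_le M (z : R[i]) : (20 * m <= M)%N -> nrm z = outer ->
  nrm (\sum_(k < N) a k / (om M ^+ k - 1) * z ^+ k) <= 99 * (M%:R / m%:R) * B.
Proof.
move=> mM zo.
have M0 : (0 < M)%N by lia.
have MR : 0 < M%:R :> R by rewrite ltr0n.
rewrite -(apply_cut z (fun k => (om M ^+ k - 1)^-1)).
have -> : 99 * (M%:R / m%:R) * B = 3 * (33 * (M%:R / m%:R)) * B by ring.
have low k : (0 < k <= 5 * m)%N -> 2 * k%:R / M%:R <= nrm (om M ^+ k - 1 : R[i]).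
  move=> /andP[k0 km]; apply: le_trans (omX_sub1_ge _); last by lia.
  by rewrite (_ : minn _ _ = k) //; apply/minn_idPl; lia.
have low0 k : (0 < k <= 5 * m)%N -> 0 < 2 * k%:R / M%:R :> R.
  by move=> /andP[k0 _]; rewrite divr_gt0 // mulr_gt0 // ltr0n.
have gk k : (0 < k <= 5 * m)%N -> nrm ((om M ^+ k - 1)^-1 : R[i]) <= M%:R / (2 * k%:R).
  move=> hk; rewrite nrmV -[leRHS]invf_div lef_pV2 ?posrE ?low ?low0 //.
  by rewrite (lt_le_trans (low0 _ hk)) // low.
pose mu k : R[i] := (cut k)%:C%C / (om M ^+ k - 1).
have V0 : 0 < 33 * (M%:R / m%:R) :> R by rewrite mulr_gt0 // divr_gt0.
apply: (@multiplier_circle R (5 * m) N mu a (33 * (M%:R / m%:R)) B outer^-1) => //.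
- by rewrite muln_gt0.
- by rewrite /mu cut0 mul0r.
- by move=> k mk; rewrite /mu cut_big // mul0r.
- move=> k; have [h|h] := leqP (5 * m) k; first by rewrite /mu cut_big // mul0r nrm0 ltW.
  have [->|k0] := posnP k; first by rewrite /mu cut0 mul0r nrm0 ltW.
  have kR : 0 < k%:R :> R by rewrite ltr0n.
  have hk : (0 < k <= 5 * m)%N by rewrite k0 ltnW.
  rewrite /mu nrmM nrm_real ger0_norm ?cut_ge0 //.
  have [c1 c2] := cut_le k; have c0 := cut_ge0 k.
  have c3 : cut k <= 2 * (k%:R / m%:R).
    have := x0 k; move: (k%:R / m%:R) c2 => x c2 x00.
    by have [?|?] := leP x 1; nra.
  apply: (@le_trans _ _ (2 * (k%:R / m%:R) * (M%:R / (2 * k%:R)))).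
    by rewrite ler_pM ?nrm_ge0 ?gk.
  have -> : 2 * (k%:R / m%:R) * (M%:R / (2 * k%:R)) = M%:R / m%:R :> R.
    by field; rewrite !gt_eqF.
  by rewrite ler_peMl ?divr_ge0 // ler1n.
- move=> k; have [h|h] := leqP (5 * m) k.
    rewrite /mu !cut_big ?(leq_trans h) // !mul0r subrr nrm0.
    by rewrite divr_ge0 // ltW.
  have kR : 0 < k.+1%:R :> R by rewrite ltr0n.
  have muE : mu k.+1 - mu k = (cut k.+1 - cut k)%:C%C / (om M ^+ k.+1 - 1) +
     (cut k)%:C%C * ((om M ^+ k.+1 - 1)^-1 - (om M ^+ k - 1)^-1).
    by rewrite /mu rmorphB; ring.
  have h1 : nrm ((cut k.+1 - cut k)%:C%C / (om M ^+ k.+1 - 1)) <= 5 / 2 * (M%:R / m%:R ^+ 2).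
    rewrite nrmM nrm_real; have [_ c2] := cut_step k.
    apply: (@le_trans _ _ (5 * k.+1%:R / m%:R ^+ 2 * (M%:R / (2 * k.+1%:R)))).
      by rewrite ler_pM ?nrm_ge0 ?gk.
    rewrite le_eqVlt; apply/orP; left; apply/eqP.
    by field; rewrite !gt_eqF.
  have h2 : nrm ((cut k)%:C%C * ((om M ^+ k.+1 - 1)^-1 - (om M ^+ k - 1)^-1)) <=
      4 * (M%:R / m%:R ^+ 2).
    have [->|k0] := posnP k.
      by rewrite cut0 mul0r nrm0 mulr_ge0 // divr_ge0 // sqr_ge0.
    have kR0 : 0 < k%:R :> R by rewrite ltr0n.
    have hk : (0 < k <= 5 * m)%N by rewrite k0 ltnW.
    have u1 : om M ^+ k - 1 != 0 :> R[i] by rewrite -nrm_gt0 (lt_le_trans (low0 _ hk)) ?low.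
    have u2 : om M ^+ k.+1 - 1 != 0 :> R[i] by rewrite -nrm_gt0 (lt_le_trans (low0 k.+1 h)) ?low.
    have -> : (om M ^+ k.+1 - 1)^-1 - (om M ^+ k - 1)^-1 =
      - (om M - 1) * om M ^+ k * ((om M ^+ k.+1 - 1)^-1 * (om M ^+ k - 1)^-1) :> R[i].
      by move: u2; rewrite exprS => u2; field; rewrite u1 u2.
    rewrite !nrmM nrmN nrm_omX mulr1 nrm_real ger0_norm ?cut_ge0 //.
    have [_ c2] := cut_le k.
    apply: (@le_trans _ _ (2 * (k%:R / m%:R) ^+ 2 *
      (8 / M%:R * (M%:R / (2 * k.+1%:R) * (M%:R / (2 * k%:R)))))).
      by rewrite ler_pM ?cut_ge0 ?mulr_ge0 ?nrm_ge0 // ler_pM ?mulr_ge0 ?nrm_ge0 ?om_sub1_le // ler_pM ?nrm_ge0 ?gk.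
    have -> : 2 * (k%:R / m%:R) ^+ 2 *
      (8 / M%:R * (M%:R / (2 * k.+1%:R) * (M%:R / (2 * k%:R)))) =
      4 * (M%:R / m%:R ^+ 2) * (k%:R / k.+1%:R) :> R.
      by field; rewrite !gt_eqF //= -natr1 ltr_wpDl.
    rewrite ger_pMr ?mulr_gt0 // ?invr_gt0 ?exprn_gt0 //.
    by rewrite ler_pdivrMr // mul1r ler_nat.
  rewrite muE (le_trans (nrmD _ _)) // (le_trans (lerD h1 h2)) //.
  rewrite -mulrDl natrM.
  have -> : 33 * (M%:R / m%:R) / (5 * m%:R) = 33 / 5 * (M%:R / m%:R ^+ 2) :> R.
    by field; rewrite gt_eqF.
  by rewrite ler_wpM2r ?divr_ge0 ?sqr_ge0 //; lra.
- exact: nrm_shrunk.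
Qed.

End Bounds.

End Cutoff.

(** * The functional calculus by quadrature *)
(** The number of nodes is even, [2 * K], so that the index [K] of the point opposite to 1
    separates the two halves of the circle. *)
Section CircularDistance.
Implicit Types j J K M i : nat.

Lemma cdist_lo K j : (j <= K)%N -> minn j (2 * K - j) = j. Proof. lia. Qed.

Lemma cdist_hi K j : (K <= j)%N -> minn j (2 * K - j) = (2 * K - j)%N.
Proof. lia. Qed.

Lemma cdist_sub K j : (j <= K)%N -> minn (2 * K - j) (2 * K - (2 * K - j)) = j.
Proof. lia. Qed.

Lemma cdist_rev_index J M i : (i < J)%N -> (J <= M)%N ->
  (J - i.+1 + (M - J))%N = (M - i.+1)%N.
Proof. lia. Qed.

Lemma leq_double_sub J K : (J <= K)%N -> (J <= 2 * K - J)%N. Proof. lia. Qed.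

Lemma leq_2mul J K : (J <= K)%N -> (J <= 2 * K)%N. Proof. lia. Qed.

Lemma ltn_2mul_sub J K : (0 < J)%N -> (J <= K)%N -> (2 * K - J < 2 * K)%N.
Proof. lia. Qed.

Lemma far_index J K j : (0 < J)%N -> (J <= j < 2 * K - J)%N ->
  (0 < j)%N /\ (j.+1 < 2 * K)%N.
Proof. lia. Qed.

End CircularDistance.
(** Goes through the factors one by one and never evaluates a numeral. *)
Ltac prod_ge0 := lazymatch goal with
  | |- is_true (0 <= _ * _) => apply: mulr_ge0; prod_ge0
  | |- is_true (0 <= _%:R) => exact: ler0n
  | |- is_true (0 <= _ ^+ 2) => exact: sqr_ge0
  | |- is_true (0 <= nrm _) => exact: nrm_ge0
  | |- is_true (0 <= _^-1) => rewrite invr_ge0; prod_ge0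
  | |- _ => first [assumption | apply: ltW; assumption]
  end.

Section Resolvent.
Context {R : realType} {X : completeNormedModType R[i]}.
Variables (T : X -> X) (Rs : R[i] -> X -> X) (C t : R).
Hypothesis linT : linear T.
Hypothesis bndT : forall x, nrm (T x) <= t * nrm x.
Hypothesis linR : forall z, 1 < nrm z -> linear (Rs z).
Hypothesis RsK : forall z x, 1 < nrm z -> Rs z (z *: x - T x) = x.
Hypothesis RsKr : forall z x, 1 < nrm z -> z *: Rs z x - T (Rs z x) = x.
Hypothesis C1 : 1 <= C.
Hypothesis bndR : forall z x, 1 < nrm z -> nrm (z - 1) * nrm (Rs z x) <= C * nrm x.
Implicit Types (z w : R[i]) (x y : X) (a : nat -> R[i]) (r : R).

Lemma bndR_away z x d : 1 < nrm z -> 0 < d -> d <= nrm (z - 1) ->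
  nrm (Rs z x) <= C / d * nrm x.
Proof.
move=> z1 d0 dz; have := bndR x z1; rewrite mulrAC ler_pdivlMr // mulrC.
by apply: le_trans; exact: (ler_wpM2l (nrm_ge0 _) dz).
Qed.

Lemma nrm_sub1_ge z : nrm z - 1 <= nrm (z - 1).
Proof. by have := nrm_le_dist z 1; rewrite nrm1; lra. Qed.

(** Resolvent identity for [z R(z)]. The factor [1 - w R(w)], which is [- T R(w)], carries
    the second resolvent. *)
Lemma zR_sub z w x : 1 < nrm z -> 1 < nrm w ->
  z *: Rs z x - w *: Rs w x = (z - w) *: Rs z (x - w *: Rs w x).
Proof.
move=> z1 w1; have := RsKr x w1; set y := Rs w x => xE.
have linz := linR z1.
have -> : x - w *: y = - T y by rewrite -{1}xE addrAC subrr sub0r.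
have -> : z *: Rs z x = z *: y - (z * (z - w)) *: Rs z y.
  rewrite -{1}xE.
  have -> : w *: y - T y = (z *: y - T y) - (z - w) *: y.
    by rewrite scalerBl opprB [RHS]addrC addrA subrK.
  by rewrite (linear_funB linz) RsK // (linear_funZ linz) scalerBr scalerA.
have -> : - T y = (z *: y - T y) - z *: y by rewrite addrAC subrr sub0r.
rewrite (linear_funB linz) RsK // (linear_funZ linz) scalerBr !scalerA.
by rewrite addrAC -scalerBl [(z - w) * z]mulrC.
Qed.

(** Applying [z - T] to the finite geometric sum telescopes. *)
Lemma R_pow z x M : 1 < nrm z ->
  z *: Rs z (x - z ^- M *: iter M T x) = \sum_(k < M) z ^- k *: iter k T x.
Proof.
move=> z1; have z0 : z != 0 by rewrite -nrm_gt0 (lt_trans ltr01).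
have linz := linR z1.
suff E : z *: (\sum_(k < M) z ^- k.+1 *: iter k T x) -
    T (\sum_(k < M) z ^- k.+1 *: iter k T x) = x - z ^- M *: iter M T x.
  rewrite -E RsK // scaler_sumr; apply: eq_bigr => k _.
  by rewrite scalerA exprS invfM mulrA divff // mul1r.
rewrite (linear_fun_sum linT) scaler_sumr -sumrB.
rewrite (eq_bigr (fun k : 'I_M => - (z ^- k.+1 *: iter k.+1 T x - z ^- k *: iter k T x))).
  rewrite sumrN -(big_mkord predT (fun k => z ^- k.+1 *: iter k.+1 T x - z ^- k *: iter k T x)).
  by rewrite telescope_sumr //= expr0 invr1 scale1r opprB.
move=> k _; rewrite (linear_funZ linT) scalerA exprS invfM mulrA divff // mul1r.
by rewrite opprB.
Qed.

(** Mean of [p(z) z R(z) x] over [M] equidistant points of the circle of radius [r]: the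
    Riesz--Dunford integral of [p] as a Riemann sum. *)
Definition quad M r N a x : X :=
  M%:R^-1 *: \sum_(j < M) (\sum_(k < N) a k * (r%:C%C * om M ^+ j) ^+ k) *:
    ((r%:C%C * om M ^+ j) *: Rs (r%:C%C * om M ^+ j) x).

Lemma nrm_node r M j : 0 <= r -> nrm (r%:C%C * om M ^+ j) = r.
Proof. by move=> r0; rewrite nrmM nrm_omX mulr1 nrm_real ger0_norm. Qed.

(** At the nodes [z ^+ M = r ^+ M], so by [R_pow] the summands are Laurent polynomials in
    [z], and orthogonality keeps the diagonal terms: the rule is exact up to the factor [1
    - r ^- M T ^ M]. *)
Lemma quadE M r N a x : 1 < r -> (0 < M)%N -> (N <= M)%N ->
  quad M r N a (x - (r ^- M)%:C%C *: iter M T x) = \sum_(k < N) a k *: iter k T x.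
Proof.
move=> r1 M0 NM; rewrite /quad.
have rC0 : r%:C%C != 0 by rewrite -nrm_eq0 nrm_real gt_eqF // normr_gt0 gt_eqF // (lt_trans ltr01).
have M0' : M%:R != 0 :> R[i] by rewrite pnatr_eq0 -lt0n.
rewrite (eq_bigr (fun j : 'I_M => \sum_(k < N) \sum_(l < M)
   (a k * (r%:C%C ^+ k / r%:C%C ^+ l) *
     (om M ^+ j ^+ k / om M ^+ j ^+ l)) *: iter l T x)); last first.
  move=> j _.
  have -> : (r ^- M)%:C%C = (r%:C%C * om M ^+ j) ^- M :> R[i].
    rewrite exprMn exprAC om_expM // expr1n mulr1.
    by rewrite fmorphV rmorphXn.
  rewrite R_pow ?nrm_node ?(le_trans ler01) ?ltW // scaler_suml.
  apply: eq_bigr => k _; rewrite scaler_sumr; apply: eq_bigr => l _.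
  rewrite scalerA !exprMn invfM; congr (_ *: _).
  by rewrite mulrACA -!mulrA; congr (_ * _); rewrite mulrCA.
rewrite exchange_big scaler_sumr /=; apply: eq_bigr => k _.
have kM : (k < M)%N := leq_trans (ltn_ord k) NM.
rewrite exchange_big (bigD1 (Ordinal kM)) //= [X in _ + X]big1 ?addr0 => [|l kl].
  rewrite -scaler_suml -mulr_sumr om_orth // eqxx mul1r scalerA divff ?expf_neq0 //.
  by rewrite mulr1 mulrCA mulVf // mulr1.
rewrite -scaler_suml -mulr_sumr om_orth //.
move: kl; rewrite -val_eqE /= eq_sym => /negbTE ->.
by rewrite mul0r mulr0 scale0r.
Qed.

Lemma linear_quad M r N a : 1 < r -> linear (quad M r N a).
Proof.
move=> r1 c u v; rewrite /quad.
have E (k : R[i]) (x y : X) : c *: (k *: x) + k *: y = k *: (c *: x + y).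
  by rewrite scalerDr !scalerA mulrC.
rewrite E; congr (_ *: _); rewrite scaler_sumr -big_split; apply: eq_bigr => j _ /=.
rewrite (linR (z := r%:C%C * om M ^+ j)) ?nrm_node ?(le_trans ler01) ?ltW //.
by rewrite !scalerDr !scalerA; congr (_ *: _ + _); ring.
Qed.

(** A quantitative way to say that the spectral radius is at most [r]. *)
Definition power_growth r := exists M0 : nat, forall M, (M0 <= M)%N ->
  forall x, nrm (iter M T x) <= r ^+ M * nrm x.

(** Coefficients of the constant polynomial 1. *)
Let coef1 : nat -> R[i] := fun k => (k == 0%N)%:R.

Lemma quad0E M r x : quad M r 1 coef1 x =
  M%:R^-1 *: \sum_(j < M) (r%:C%C * om M ^+ j) *: Rs (r%:C%C * om M ^+ j) x.
Proof.
rewrite /quad; congr (_ *: _); apply: eq_bigr => j _.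
by rewrite big_ord1 expr0 mulr1 scale1r.
Qed.

Lemma nrm_mean_le M (F : nat -> X) K : 0 <= K -> (forall j, nrm (F j) <= K) ->
  nrm (M%:R^-1 *: \sum_(j < M) F j) <= K.
Proof.
move=> K0 FK; rewrite nrmZ nrmV nrm_nat.
have [->|M0] := posnP M; first by rewrite invr0 mul0r.
rewrite mulrC ler_pdivrMr ?ltr0n // (le_trans (nrm_sum _ _ _)) //.
apply: (@le_trans _ _ (\sum_(j < M) K)); first exact: ler_sum.
by rewrite sumr_const card_ord mulr_natr.
Qed.

(** Rickart's argument for the spectral radius formula. For [p = 1] the rule [quad]
    inverts [1 - r ^- M T ^ M], and it depends on [r] in a Lipschitz way that is uniform
    in [M]. Growth at [r + d] makes the mean at radius [r + 2 * d] nearly the identity; by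
    the Lipschitz bound the mean at radius [r] is then within one half of the identity,
    and this forces [r ^- M T ^ M] to be a contraction. *)
Lemma power_growth_step rho : 1 < rho -> exists2 d, 0 < d &
  forall r, rho <= r -> power_growth (r + d) -> power_growth r.
Proof.
move=> rho1; pose k0 := C / (rho - 1); pose Kb := C + k0; pose Lc := k0 * (1 + Kb).
have C0 : 0 <= C by rewrite (le_trans ler01).
have k00 : 0 <= k0 by rewrite divr_ge0 // subr_ge0 ltW.
have Kb0 : 0 <= Kb by rewrite addr_ge0.
have Lc0 : 0 <= Lc by rewrite mulr_ge0 // addr_ge0.
have Rle z x : rho <= nrm z -> nrm (Rs z x) <= k0 * nrm x.
  move=> hz; apply: bndR_away; rewrite ?subr_gt0 ?(lt_le_trans rho1) //.
  by rewrite (le_trans _ (nrm_sub1_ge z)) // lerB.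
have zRle z x : rho <= nrm z -> nrm (z *: Rs z x) <= Kb * nrm x.
  move=> hz; have -> : z *: Rs z x = (z - 1) *: Rs z x + Rs z x.
    by rewrite scalerBl scale1r subrK.
  rewrite (le_trans (nrmD _ _)) // mulrDl lerD ?Rle // nrmZ bndR //.
  exact: lt_le_trans hz.
have Lip z w x : rho <= nrm z -> rho <= nrm w ->
    nrm (z *: Rs z x - w *: Rs w x) <= nrm (z - w) * Lc * nrm x.
  move=> hz hw; rewrite zR_sub ?(lt_le_trans rho1) // nrmZ -mulrA.
  rewrite ler_wpM2l ?nrm_ge0 // (le_trans (Rle _ _ hz)) // /Lc -mulrA ler_wpM2l //.
  by rewrite (le_trans (nrmB _ _)) // mulrDl mul1r lerD2l zRle.
pose d := (8 * (Lc + 1))^-1.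
have Lc1 : 0 < Lc + 1 by rewrite ltr_wpDl.
have d0 : 0 < d by rewrite invr_gt0 mulr_gt0.
have dL : 2 * d * Lc <= 4^-1.
  have -> : 2 * d * Lc = 4^-1 * (Lc / (Lc + 1)) by rewrite /d; field; rewrite gt_eqF.
  by rewrite ger_pMr // ler_pdivrMr // mul1r lerDl.
exists d => // r rr [M0 hM0].
have r0 : 0 < r by rewrite (lt_le_trans ltr01) // (le_trans (ltW rho1)).
pose r' := r + 2 * d.
have r'0 : 0 < r' by rewrite addr_gt0 // mulr_gt0.
have rr' : rho <= r' by rewrite (le_trans rr) // lerDl mulr_ge0 // ltW.
have Kb1 : 0 < 4 * (Kb + 1) by rewrite mulr_gt0 // ltr_wpDl.
have [||M1 hM1] := @exists_expr_le R ((r + d) / r') (4 * (Kb + 1))^-1.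
- rewrite divr_ge0 ?(ltW r'0) ?addr_ge0 ?(ltW r0) ?(ltW d0) //=.
  by rewrite ltr_pdivrMr // mul1r /r' ltrD2l mulr_natl mulr2n ltrDl.
- by rewrite invr_gt0.
exists (maxn M0 M1).+1 => M hM x.
have M00 : (0 < M)%N by rewrite (leq_trans _ hM).
have MM0 : (M0 <= M)%N by rewrite (leq_trans _ hM) // ltnW // ltnS leq_maxl.
have MM1 : (M1 <= M)%N by rewrite (leq_trans _ hM) // ltnW // ltnS leq_maxr.
have E y q : 1 < q -> quad M q 1 coef1 (y - (q ^- M)%:C%C *: iter M T y) = y.
  by move=> q1; rewrite quadE // big_ord1 scale1r.
have Sle y : nrm (quad M r' 1 coef1 y) <= Kb * nrm y.
  rewrite quad0E.
  apply: (@nrm_mean_le M (fun j => (r'%:C%C * om M ^+ j) *: Rs (r'%:C%C * om M ^+ j) y)).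
    by rewrite mulr_ge0 ?nrm_ge0.
  move=> j.
  by apply: zRle; rewrite nrm_node // ltW.
have s'le y : nrm ((r' ^- M)%:C%C *: iter M T y) <= (4 * (Kb + 1))^-1 * nrm y.
  rewrite nrmZ nrm_real ger0_norm ?invr_ge0 ?exprn_ge0 ?(ltW r'0) //.
  apply: (@le_trans _ _ (r' ^- M * ((r + d) ^+ M * nrm y))).
    by rewrite ler_wpM2l ?hM0 // invr_ge0 exprn_ge0 // ltW.
  rewrite mulrA ler_wpM2r ?nrm_ge0 // mulrC -exprVn -exprMn.
  exact: hM1.
have S'1 y : nrm (quad M r' 1 coef1 y - y) <= 4^-1 * nrm y.
  have linS : linear (quad M r' 1 coef1).
    by apply: linear_quad; rewrite (lt_le_trans rho1).
  have -> : quad M r' 1 coef1 y - y = quad M r' 1 coef1 ((r' ^- M)%:C%C *: iter M T y).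
    rewrite -{2}(E y r') ?(lt_le_trans rho1) // (linear_funB linS).
    by rewrite opprB addrC subrK.
  rewrite (le_trans (Sle _)) // (le_trans (ler_wpM2l Kb0 (s'le y))) //.
  rewrite mulrA ler_wpM2r ?nrm_ge0 // invfM mulrCA ger_pMr //.
  by rewrite ler_pdivrMr ?mul1r ?lerDl // ltr_wpDl.
have SS' y : nrm (quad M r 1 coef1 y - quad M r' 1 coef1 y) <= 4^-1 * nrm y.
  rewrite !quad0E -scalerBr -sumrB.
  apply: (@nrm_mean_le M (fun j => (r%:C%C * om M ^+ j) *: Rs (r%:C%C * om M ^+ j) y -
    (r'%:C%C * om M ^+ j) *: Rs (r'%:C%C * om M ^+ j) y)).
    by rewrite mulr_ge0 ?nrm_ge0.
  move=> j; rewrite (le_trans (Lip _ _ _ _ _)) ?nrm_node ?(ltW r0) ?(ltW r'0) //.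
  rewrite -mulrBl nrmM nrm_omX mulr1 -rmorphB nrm_real /r' opprD addrA subrr sub0r.
  by rewrite normrN ger0_norm ?mulr_ge0 ?(ltW d0) // ler_wpM2r ?nrm_ge0.
have S1 y : nrm (quad M r 1 coef1 y - y) <= 2^-1 * nrm y.
  have := nrmD (quad M r 1 coef1 y - quad M r' 1 coef1 y) (quad M r' 1 coef1 y - y).
  rewrite addrA subrK; have := S'1 y; have := SS' y; lra.
have := S1 (x - (r ^- M)%:C%C *: iter M T x).
rewrite E ?(lt_le_trans rho1) // opprB addrC subrK.
have := nrmB x ((r ^- M)%:C%C *: iter M T x).
rewrite nrmZ nrm_real ger0_norm ?invr_ge0 ?exprn_ge0 ?(ltW r0) // => h1 h2.
have : r ^- M * nrm (iter M T x) <= nrm x by lra.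
by rewrite mulrC ler_pdivrMr ?exprn_gt0 // mulrC.
Qed.

(** The step of [power_growth_step] does not shrink, so finitely many steps lead down from
    a radius above the norm of [T]. *)
Lemma power_growth_gt1 r : 1 < r -> power_growth r.
Proof.
move=> r1; have [d d0 step] := power_growth_step r1.
have big s : `|t| <= s -> power_growth s.
  move=> ts; exists 0%N => M _ x; elim: M => [|M IH]; first by rewrite mul1r.
  rewrite iterS exprS -mulrA (le_trans (bndT _)) //.
  have s0 : 0 <= s by rewrite (le_trans _ ts).
  apply: (@le_trans _ _ (s * nrm (iter M T x))); last by rewrite ler_wpM2l.
  by rewrite ler_wpM2r ?nrm_ge0 // (le_trans (ler_norm _)).
have down n : power_growth (r + n%:R * d) -> power_growth r.
  elim: n => [|n IH]; first by rewrite mul0r addr0.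
  move=> h; apply: IH; apply: step; first by rewrite lerDl mulr_ge0 // ltW.
  by rewrite -addrA (_ : _ + d = n.+1%:R * d) // -addn1 natrD mulrDl mul1r.
apply: (down (Num.truncn (`|t| / d)).+1); apply: big.
rewrite ler_wpDl ?(le_trans ler01) ?ltW //.
by rewrite -ltr_pdivrMr // truncnS_gt.
Qed.

(** Let [M] tend to infinity in [quadE]; the correction [r ^- M T ^ M x] tends to 0 by
    [power_growth_gt1] at a radius between 1 and [r]. *)
Lemma poly_bound_of_quad r N a K : 1 < r -> 0 <= K ->
  (forall M1, exists2 M, (M1 <= M)%N & forall x, nrm (quad M r N a x) <= K * nrm x) ->
  forall x, nrm (\sum_(k < N) a k *: iter k T x) <= K * nrm x.
Proof.
move=> r1 K0 H x; have r0 : 0 < r by rewrite (lt_trans ltr01).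
apply/ler_addgt0Pr => e e0.
pose s := (1 + r) / 2; have s1 : 1 < s by rewrite /s; lra.
have sr : s < r by rewrite /s; lra.
have s0 : 0 < s by rewrite (lt_trans ltr01).
have Kx1 : 0 < K * nrm x + 1 by rewrite ltr_wpDl // mulr_ge0 // nrm_ge0.
have [M0 hM0] := power_growth_gt1 s1.
have [||M1 hM1] := @exists_expr_le R (s / r) (e / (K * nrm x + 1)).
- by rewrite divr_ge0 ?(ltW s0) ?(ltW r0) //= ltr_pdivrMr // mul1r.
- by rewrite divr_gt0.
have [M hM bd] := H (maxn (maxn M0 M1) N).+1.
have M00 : (0 < M)%N by rewrite (leq_trans _ hM).
have /andP[/andP[MM0 MM1] MN] : ((M0 <= M) && (M1 <= M) && (N <= M))%N.
  by move: hM => /ltnW; rewrite !geq_max.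
rewrite -(@quadE M r) // (le_trans (bd _)) //.
rewrite (le_trans (ler_wpM2l K0 (nrmB _ _))) // mulrDr lerD2l.
rewrite nrmZ nrm_real ger0_norm ?invr_ge0 ?exprn_ge0 ?(ltW r0) //.
apply: (@le_trans _ _ (K * (e / (K * nrm x + 1) * nrm x))).
  rewrite ler_wpM2l // (le_trans (ler_wpM2l _ (hM0 _ MM0 x))) //.
    by rewrite invr_ge0 exprn_ge0 // ltW.
  by rewrite mulrA ler_wpM2r ?nrm_ge0 // mulrC -exprVn -exprMn hM1.
rewrite mulrCA mulrAC -mulrA ger_pMr // ler_pdivrMr // mul1r lerDl //.
Qed.

(** * The estimate for a dyadic block *)
Lemma summation_by_parts (q : nat -> R[i]) (F : nat -> X) s e : (s <= e)%N ->
  \sum_(s <= j < e) (q j.+1 - q j) *: F j =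
  q e *: F e - q s *: F s - \sum_(s <= j < e) q j.+1 *: (F j.+1 - F j).
Proof.
move=> se; apply/eqP; rewrite eq_sym subr_eq -big_split /=; apply/eqP.
rewrite -(telescope_sumr (fun j => q j *: F j) se); apply: eq_bigr => j _.
by rewrite scalerBl scalerBr addrC addrA subrK.
Qed.

Lemma sum_inv_le_ln (b : R) n : 0 < b ->
  \sum_(0 <= i < n) (b + i.+1%:R)^-1 <= ln (b + n%:R) - ln b.
Proof.
move=> b0; elim: n => [|n IH]; first by rewrite big_nil addr0 subrr.
rewrite big_nat_recr //=.
have c0 : 0 < b + n%:R by rewrite ltr_wpDr.
have cE : b + n.+1%:R = (b + n%:R) + 1 by rewrite -natr1 addrA.
rewrite cE; move: (b + n%:R) c0 IH => c c0 IH.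
have c10 : 0 < c + 1 by rewrite addr_gt0.
have : ln (c / (c + 1)) <= - (c + 1)^-1.
  have -> : c / (c + 1) = 1 + - (c + 1)^-1 by field; rewrite gt_eqF.
  by rewrite le_ln1Dx // ltrN2 invf_lt1 // ltrDr.
by rewrite ln_div ?posrE //; lra.
Qed.

Lemma ln_C_ge : 1 <= 2 * ln (C + 1).
Proof.
have h : ln (2 : R) <= ln (C + 1) by rewrite ler_ln ?posrE //; have := C1; lra.
have : ln (2^-1 : R) <= - 2^-1.
  have E : 2^-1 = 1 + - 2^-1 :> R by lra.
  by rewrite {1}E le_ln1Dx //; lra.
rewrite lnV ?posrE //; lra.
Qed.

(** As [C >= 1], a constant inside the logarithm only costs a constant factor. *)
Lemma ln_20C_le : ln (20 * (C + 1)) <= 6 * ln (C + 1).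
Proof.
have C10 : 0 < C + 1 by rewrite ltr_wpDl // (le_trans ler01).
rewrite [leRHS]mulr_natl -lnXn // ler_ln ?posrE ?exprn_gt0 ?mulr_gt0 //.
rewrite exprS mulrC ler_pM2l //.
have : (2 : R) ^+ 5 <= (C + 1) ^+ 5 by apply: lerXn2r; rewrite ?nnegrE //; have := C1; lra.
apply: le_trans; rewrite !exprS expr0; lra.
Qed.

Section DyadicBlock.
Variables (m N : nat) (a : nat -> R[i]) (B : R).
Hypothesis m0 : (0 < m)%N.
Hypothesis supp : forall k, ~~ (m <= k <= 4 * m)%N -> a k = 0.
Hypothesis aB : forall z : R[i], nrm z = (outer m)^-1 ->
  nrm (\sum_(k < N) a k * z ^+ k) <= B.
Variable K : nat.
Hypothesis K0 : (10 * m <= K)%N.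
Variable x : X.

Let M := (2 * K)%N.
Let r : R := outer m.
Let z j : R[i] := r%:C%C * om M ^+ j.
Let p j := \sum_(k < N) a k * z j ^+ k.
Let q j := \sum_(k < N) a k / (om M ^+ k - 1) * z j ^+ k.
Let F j := z j *: Rs (z j) x.
Let dist j := minn j (M - j).
(** The distance from [z j] to 1 is at least [(b + dist j) / (2 * M)]: [dist j] counts the
    angle, and [b] the distance of the circle from the unit circle. *)
Let b : R := M%:R / (20 * m%:R).

Let mR : 0 < m%:R :> R. Proof. by rewrite ltr0n. Qed.
Let M0 : (0 < M)%N. Proof. by rewrite /M; lia. Qed.
Let MR : 0 < M%:R :> R. Proof. by rewrite ltr0n. Qed.
Let mM : (20 * m <= M)%N. Proof. by rewrite /M; lia. Qed.
Let b0 : 0 < b. Proof. by rewrite divr_gt0 // mulr_gt0. Qed.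
Let b1 : 1 <= b.
Proof. by rewrite ler_pdivlMr ?mulr_gt0 // mul1r -natrM ler_nat. Qed.
Let r1 : 1 < r. Proof. exact: outer_gt1. Qed.
Let r0 : 0 <= r. Proof. by rewrite (le_trans ler01) // ltW // outer_gt1. Qed.
Let r2 : r <= 2. Proof. exact: outer_le2. Qed.
Let C0 : 0 < C. Proof. exact: lt_le_trans C1. Qed.
Let zr j : nrm (z j) = r. Proof. by rewrite nrm_node // (le_trans ler01) ?ltW. Qed.
Let z1 j : 1 < nrm (z j). Proof. by rewrite zr. Qed.
Let B0 : 0 <= B.
Proof.
apply: le_trans (nrm_ge0 _) (aB (z := (r^-1)%:C%C) _).
by rewrite nrm_real ger0_norm // invr_ge0 (le_trans ler01) ?ltW.
Qed.

Let pq j : q j.+1 - q j = p j.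
Proof.
rewrite -sumrB; apply: eq_bigr => k _.
have [h|h] := boolP (m <= k <= 4 * m)%N; last by rewrite supp // !mul0r subrr.
have o1 : om M ^+ k - 1 != 0 :> R[i].
  case/andP: h => h1 h2; rewrite subr_eq0 omX_neq1 // (leq_trans m0 h1) /=.
  by rewrite (leq_ltn_trans h2) // (leq_trans _ mM) // ltn_pmul2r.
have -> : z j.+1 = z j * om M by rewrite /z exprSr mulrA.
rewrite exprMn; move: (om M ^+ k) o1 (z j ^+ k) => u u1 v; by field.
Qed.

Let pB j : nrm (p j) <= 75 * B.
Proof. by apply: (@poly_outer_le _ m) => //; rewrite zr. Qed.

Let qB j : nrm (q j) <= 99 * (M%:R / m%:R) * B.
Proof. by apply: primitive_outer_le => //; rewrite zr. Qed.

Let dist_le j : (j <= M)%N -> (b + (dist j)%:R) / (2 * M%:R) <= nrm (z j - 1).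
Proof.
move=> jM.
have h1 : (20 * m%:R)^-1 <= nrm (z j - 1).
  by have := nrm_sub1_ge (z j); rewrite zr /r /outer; lra.
have h2 : nrm (om M ^+ j - 1 : R[i]) <= 2 * nrm (z j - 1).
  have -> : om M ^+ j - 1 = (z j - 1) - (r - 1)%:C%C * om M ^+ j :> R[i].
    by rewrite /z rmorphB /=; ring.
  rewrite (le_trans (nrmB _ _)) // nrmM nrm_omX mulr1 nrm_real ger0_norm; last first.
    by rewrite subr_ge0 ltW.
  by have := nrm_sub1_ge (z j); rewrite zr; lra.
have := @omX_sub1_ge R M j jM; rewrite -/(dist j) => h3.
have -> : (b + (dist j)%:R) / (2 * M%:R) = (20 * m%:R)^-1 / 2 + 2 * (dist j)%:R / M%:R / 4.
  by rewrite /b; field; rewrite !gt_eqF.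
lra.
Qed.

Let bd0 j : 0 < b + (dist j)%:R. Proof. by rewrite ltr_wpDr. Qed.

Let RB j y : (j <= M)%N -> nrm (Rs (z j) y) <= 2 * C * M%:R / (b + (dist j)%:R) * nrm y.
Proof.
move=> jM; have := bndR_away y (z1 j) _ (dist_le jM).
rewrite invf_div mulrA [C * _]mulrA [C * 2]mulrC; apply.
by rewrite divr_gt0 // mulr_gt0.
Qed.

Let FB j : (j <= M)%N -> nrm (F j) <= 4 * C * M%:R / (b + (dist j)%:R) * nrm x.
Proof.
move=> jM; rewrite /F nrmZ zr.
rewrite (le_trans (ler_pM r0 (nrm_ge0 _) r2 (RB x jM))) //.
by rewrite !mulrA -natrM.
Qed.

Let FBd j : (0 < j < M)%N -> nrm (F j) <= 4 * C * M%:R / (dist j)%:R * nrm x.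
Proof.
move=> /andP[j0 jM]; rewrite (le_trans (FB (ltnW jM))) // ler_wpM2r ?nrm_ge0 //.
have d0 : (0 < dist j)%N by rewrite leq_min j0 subn_gt0.
rewrite ler_wpM2l ?mulr_ge0 // ?(ltW C0) //.
by rewrite lef_pV2 ?posrE ?ltr0n // lerDr ltW.
Qed.

(** The resolvent identity produces two resolvents, each of size [C / |z - 1|]. *)
Let dF j : (0 < j)%N -> (j.+1 < M)%N -> nrm (F j.+1 - F j) <=
  160 * C ^+ 2 * M%:R / ((dist j)%:R * (dist j.+1)%:R) * nrm x.
Proof.
move=> j0 jM; rewrite zR_sub // nrmZ.
have d0 : 0 < (dist j)%:R :> R by rewrite ltr0n leq_min j0 subn_gt0 ltnW.
have d1 : 0 < (dist j.+1)%:R :> R by rewrite ltr0n leq_min /= subn_gt0.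
have dM : (dist j)%:R <= M%:R :> R by rewrite ler_nat geq_min ltnW // ltnW.
have h1 : nrm (z j.+1 - z j) <= 16 / M%:R.
  have -> : z j.+1 - z j = r%:C%C * om M ^+ j * (om M - 1) by rewrite /z exprSr; ring.
  rewrite nrmM nrmM nrm_omX mulr1 nrm_real ger0_norm //.
  rewrite (le_trans (ler_pM r0 (nrm_ge0 _) r2 (om_sub1_le M0))) //.
  by rewrite mulrA -natrM.
have h2 : nrm (x - F j) <= 5 * C * M%:R / (dist j)%:R * nrm x.
  have := nrmB x (F j); have := FBd (j := j); rewrite j0 ltnW // => /(_ isT).
  have : 1 <= C * M%:R / (dist j)%:R.
    by rewrite ler_pdivlMr // mul1r (le_trans dM) // ler_peMl // ltW.
  have E c : c * C * M%:R / (dist j)%:R * nrm x = c * (C * M%:R / (dist j)%:R * nrm x).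
    by rewrite !mulrA.
  rewrite !E => u1; have := ler_peMl (nrm_ge0 x) u1; lra.
have h3 : nrm (Rs (z j.+1) (x - F j)) <=
    2 * C * M%:R / (dist j.+1)%:R * (5 * C * M%:R / (dist j)%:R * nrm x).
  rewrite (le_trans (RB _ _)) ?(ltnW jM) // ler_pM ?nrm_ge0 //.
    by rewrite divr_ge0 ?mulr_ge0 // ?(ltW C0) // ltW.
  rewrite ler_wpM2l ?mulr_ge0 // ?(ltW C0) //.
  by rewrite lef_pV2 ?posrE // lerDr ltW.
rewrite (le_trans (ler_pM (nrm_ge0 _) (nrm_ge0 _) h1 h3)) //.
rewrite le_eqVlt; apply/orP; left; apply/eqP.
by field; rewrite !gt_eqF.
Qed.

Section Cut.
Variable J : nat.
Hypothesis JK : (J <= K)%N.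

(** Near the point 1 the triangle inequality is enough: [|z - 1|^-1] sums to a logarithm.
    *)
Lemma near_le : nrm (\sum_(0 <= j < J) p j *: F j + \sum_(M - J <= j < M) p j *: F j) <=
  300 * B * C * M%:R * (1 + 2 * (ln (b + J%:R) - ln b)) * nrm x.
Proof.
pose g j : R := 300 * B * C * M%:R * nrm x * (b + j%:R)^-1.
have g0 : 0 <= 300 * B * C * M%:R * nrm x.
  by prod_ge0.
have term j d : (j < M)%N -> dist j = d -> nrm (p j *: F j) <= g d.
  move=> jM <-; rewrite nrmZ (le_trans (ler_pM _ _ (pB j) (FB (ltnW jM)))) ?nrm_ge0 //.
  by rewrite /g le_eqVlt; apply/orP; left; apply/eqP; field; rewrite gt_eqF.
have s2 : \sum_(0 <= i < J) g i.+1 <= 300 * B * C * M%:R * nrm x * (ln (b + J%:R) - ln b).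
  by rewrite -mulr_sumr ler_wpM2l // sum_inv_le_ln.
have s1 : \sum_(0 <= i < J) g i <= 300 * B * C * M%:R * nrm x * (1 + (ln (b + J%:R) - ln b)).
  rewrite -mulr_sumr ler_wpM2l //.
  have [->|J0] := posnP J; first by rewrite big_geq // addr0 subrr addr0 ler01.
  rewrite -(prednK J0) big_nat_recl // addr0 lerD ?invf_le1 //.
  apply: le_trans (sum_inv_le_ln _ b0) _.
  rewrite lerD2r ler_ln ?posrE ?ltr_wpDr // lerD2l ler_nat //.
have E : \sum_(M - J <= j < M) nrm (p j *: F j) =
    \sum_(0 <= i < J) nrm (p (M - i.+1)%N *: F (M - i.+1)%N).
  have JM : (J <= M)%N := leq_2mul JK.
  rewrite -{1}[(M - J)%N]add0n big_addn subKn // big_nat_rev /= add0n.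
  apply: eq_big_nat => i /andP[_ iJ].
  by rewrite cdist_rev_index.
rewrite (le_trans (nrmD _ _)) // (le_trans (lerD (nrm_sum _ _ _) (nrm_sum _ _ _))) //.
rewrite E.
have h1 : \sum_(0 <= j < J) nrm (p j *: F j) <= \sum_(0 <= i < J) g i.
  rewrite big_nat [leRHS]big_nat; apply: ler_sum => j /andP[_ jJ].
  have jK : (j <= K)%N := leq_trans (ltnW jJ) JK.
  apply: term; last exact: cdist_lo.
  by rewrite (leq_trans jJ) // leq_2mul.
have h2 : \sum_(0 <= i < J) nrm (p (M - i.+1)%N *: F (M - i.+1)%N) <=
    \sum_(0 <= i < J) g i.+1.
  rewrite big_nat [leRHS]big_nat; apply: ler_sum => j /andP[_ jJ].
  have jK : (j.+1 <= K)%N := leq_trans jJ JK.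
  by apply: term; [exact: ltn_2mul_sub | exact: cdist_sub].
rewrite (le_trans (lerD (le_trans h1 s1) (le_trans h2 s2))) //.
by rewrite -mulrDr le_eqVlt; apply/orP; left; apply/eqP; ring.
Qed.

(** On each half of the circle one of the two telescoping terms is the left side. *)
Let inv_dist j : (0 < j)%N -> (j.+1 < M)%N ->
  ((dist j)%:R * (dist j.+1)%:R)^-1 <=
  (j%:R^-1 - j.+1%:R^-1) + ((M - j.+1)%:R^-1 - (M - j)%:R^-1) :> R.
Proof.
move=> j0 jM.
have E n : (0 < n)%N -> n%:R^-1 - n.+1%:R^-1 = (n%:R * n.+1%:R)^-1 :> R.
  move=> n0; have n0' : 0 < n%:R :> R by rewrite ltr0n.
  by rewrite -natr1; field; rewrite !gt_eqF // ltr_wpDl.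
have [h|h] := ltnP j K.
  rewrite /dist !cdist_lo //; last exact: ltnW.
  rewrite E // lerDl -[(M - j)%N](@subnSK j M) ?(ltnW jM) //.
  by rewrite E ?subn_gt0 // invr_ge0 mulr_ge0.
rewrite /dist !cdist_hi //; last exact: leqW.
rewrite -/M -[(M - j)%N](@subnSK j M) ?(ltnW jM) //.
rewrite (E (M - j.+1)%N) ?subn_gt0 // mulrC lerDr E // invr_ge0 mulr_ge0 //.
Qed.

(** Far from the point 1 the triangle inequality would cost a logarithm of [m]. Summation
    by parts replaces [p] by its discrete primitive [q], of size [M / m], and [F] by its
    differences, of size [C ^ 2 / (M |z - 1| ^ 2)]; beyond the distance [C / m] these add
    up to a bound of order [C]. *)
Lemma far_le : (0 < J)%N -> C * M%:R / m%:R <= J%:R ->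
  nrm (\sum_(J <= j < M - J) p j *: F j) <= 99 * 328 * C * B * M%:R * nrm x.
Proof.
move=> J0 CJ.
have JR : 0 < J%:R :> R by rewrite ltr0n.
have JMJ : (J <= M - J)%N := leq_double_sub JK.
have JM : (M - J < M)%N := ltn_2mul_sub J0 JK.
have W0 : 0 <= 99 * (M%:R / m%:R) * B.
  by apply: mulr_ge0 => //; apply: mulr_ge0 => //; exact: divr_ge0.
have bdry j : (0 < j < M)%N -> dist j = J ->
    nrm (q j *: F j) <= 396 * B * M%:R * nrm x.
  move=> jM dj; rewrite nrmZ (le_trans (ler_pM (nrm_ge0 _) (nrm_ge0 _) (qB j) (FBd jM))) //.
  rewrite dj.
  have -> : 99 * (M%:R / m%:R) * B * (4 * C * M%:R / J%:R * nrm x) =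
     396 * B * M%:R * nrm x * (C * M%:R / m%:R / J%:R) by field; rewrite !gt_eqF.
  by apply: ler_piMr; [prod_ge0 | rewrite ler_pdivrMr // mul1r].
have sum_d : \sum_(J <= j < M - J) ((dist j)%:R * (dist j.+1)%:R)^-1 <= 2 / J%:R :> R.
  rewrite big_nat.
  apply: (@le_trans _ _ (\sum_(J <= j < M - J)
     ((j%:R^-1 - j.+1%:R^-1) + ((M - j.+1)%:R^-1 - (M - j)%:R^-1)))).
    rewrite [leRHS]big_nat; apply: ler_sum => j /andP[h1 h2].
    by have [] := @far_index J K j J0; rewrite ?h1 //; exact: inv_dist.
  rewrite big_split /=.
  have -> : \sum_(J <= j < M - J) (j%:R^-1 - j.+1%:R^-1) = J%:R^-1 - (M - J)%:R^-1 :> R.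
    have := telescope_sumr (fun j => - j%:R^-1 : R) JMJ.
    by under eq_bigr do rewrite opprK addrC; rewrite opprK addrC.
  rewrite (telescope_sumr (fun j => (M - j)%:R^-1 : R) JMJ).
  rewrite subKn; last exact: leq_2mul.
  have : 0 <= (M - J)%:R^-1 :> R by rewrite invr_ge0.
  lra.
have sum_q : nrm (\sum_(J <= j < M - J) q j.+1 *: (F j.+1 - F j)) <=
    99 * 320 * C * B * M%:R * nrm x.
  rewrite (le_trans (nrm_sum _ _ _)) //.
  pose W := 99 * (M%:R / m%:R) * B * (160 * C ^+ 2 * M%:R * nrm x).
  have W00 : 0 <= W.
    by rewrite /W; prod_ge0.
  apply: (@le_trans _ _ (\sum_(J <= j < M - J) W * ((dist j)%:R * (dist j.+1)%:R)^-1)).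
    rewrite big_nat [leRHS]big_nat; apply: ler_sum => j /andP[h1 h2].
    have [j0 jM] : (0 < j)%N /\ (j.+1 < M)%N by apply: (@far_index J); rewrite ?h1.
    rewrite nrmZ (le_trans (ler_pM (nrm_ge0 _) (nrm_ge0 _) (qB _) (dF j0 jM))) //.
    by rewrite /W -[X in _ <= X]mulrA; apply: ler_wpM2l => //; rewrite mulrAC.
  rewrite -mulr_sumr (le_trans (ler_wpM2l W00 sum_d)) //.
  have -> : W * (2 / J%:R) =
    99 * 320 * C * B * M%:R * nrm x * (C * M%:R / m%:R / J%:R).
    by rewrite /W; field; rewrite !gt_eqF.
  by apply: ler_piMr; [prod_ge0 | rewrite ler_pdivrMr // mul1r].
have -> : \sum_(J <= j < M - J) p j *: F j = \sum_(J <= j < M - J) (q j.+1 - q j) *: F j.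
  by apply: eq_bigr => j _; rewrite pq.
rewrite summation_by_parts // (le_trans (nrmB _ _)) //.
have h1 : nrm (q (M - J)%N *: F (M - J)%N) <= 396 * B * M%:R * nrm x.
  by apply: bdry; [rewrite JM (leq_trans J0) | exact: cdist_sub].
have h2 : nrm (q J *: F J) <= 396 * B * M%:R * nrm x.
  by apply: bdry; [rewrite J0 (leq_ltn_trans JMJ) | exact: cdist_lo].
have h3 := nrmB (q (M - J)%N *: F (M - J)%N) (q J *: F J).
have h4 : 396 * B * M%:R * nrm x <= 396 * C * B * M%:R * nrm x.
  have -> : 396 * C * B * M%:R * nrm x = C * (396 * B * M%:R * nrm x) by ring.
  by apply: (ler_peMl _ C1); prod_ge0.
have -> : 99 * 328 * C * B * M%:R * nrm x = 99 * 320 * C * B * M%:R * nrm x +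
  (396 * C * B * M%:R * nrm x + 396 * C * B * M%:R * nrm x) by ring.
lra.
Qed.
End Cut.

Lemma quad_dyadic_le : nrm (quad M r N a x) <= 70 * 1000 * C * ln (C + 1) * B * nrm x.
Proof.
pose l := ln (C + 1); have l1 : 1 <= 2 * l := ln_C_ge.
have l0 : 0 <= l by lra.
rewrite /quad nrmZ nrmV nrm_nat mulrC ler_pdivrMr //.
rewrite -(big_mkord predT (fun j => p j *: F j)).
(* The two estimates meet at the distance [C / m] from the point 1. *)
pose J0 := (Num.truncn (C * M%:R / m%:R)).+1.
pose J := minn J0 K.
have JK : (J <= K)%N by rewrite geq_minr.
have JMJ : (J <= M - J)%N := leq_double_sub JK.
rewrite (big_cat_nat (leq0n J) (leq_2mul JK)) (big_cat_nat JMJ (leq_subr _ _)) /=.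
rewrite addrCA addrC.
have CM0 : 0 <= C * M%:R / m%:R by rewrite divr_ge0 // mulr_ge0 // ltW.
have hln : ln (b + J%:R) - ln b <= 6 * l.
  have bJ : 0 < b + J%:R by rewrite ltr_wpDr.
  have bJb : 0 < (b + J%:R) / b := divr_gt0 bJ b0.
  have C10 : 0 < 20 * (C + 1) by rewrite mulr_gt0 // addr_gt0.
  rewrite -ln_div ?posrE // (le_trans _ ln_20C_le) // ler_ln ?posrE //.
  rewrite ler_pdivrMr //.
  have : J%:R <= C * M%:R / m%:R + 1.
    apply: (@le_trans _ _ J0%:R); first by rewrite ler_nat geq_minl.
    by rewrite /J0 -natr1 lerD2r truncn_le.
  have -> : C * M%:R / m%:R = 20 * C * b by rewrite /b; field; rewrite gt_eqF.
  have := b1; lra.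
have hfar : nrm (\sum_(J <= j < M - J) p j *: F j) <= 99 * 328 * C * B * M%:R * nrm x.
  have [h|h] := leqP J0 K; last first.
    have -> : J = K by apply/minn_idPr; exact: ltnW.
    rewrite big_geq; last by rewrite /M mul2n -addnn addnK.
    by rewrite nrm0; prod_ge0.
  have JE : J = J0 by apply/minn_idPl.
  apply: (far_le JK); first by rewrite JE.
  by rewrite JE ltW // truncnS_gt.
have := near_le JK; move: hfar.
set S1 := \sum_(J <= j < M - J) _; set S2 := \sum_(0 <= j < J) _ + _ => h1 h2.
rewrite (le_trans (nrmD _ _)) // (le_trans (lerD h2 h1)) //.
pose W := C * B * M%:R * nrm x.
have W0 : 0 <= W by rewrite /W; prod_ge0.
have -> : 300 * B * C * M%:R * (1 + 2 * (ln (b + J%:R) - ln b)) * nrm x =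
  W * (300 * (1 + 2 * (ln (b + J%:R) - ln b))) by rewrite /W; ring.
have -> : 99 * 328 * C * B * M%:R * nrm x = W * (99 * 328) by rewrite /W; ring.
have -> : 70 * 1000 * C * ln (C + 1) * B * nrm x * M%:R = W * (70 * 1000 * l).
  by rewrite /W /l; ring.
by rewrite -mulrDr; apply: ler_wpM2l => //; lra.
Qed.

End DyadicBlock.

Lemma dyadic_poly_le m N a B x : (0 < m)%N ->
  (forall k, ~~ (m <= k <= 4 * m)%N -> a k = 0) ->
  (forall z : R[i], nrm z = (outer m)^-1 -> nrm (\sum_(k < N) a k * z ^+ k) <= B) ->
  nrm (\sum_(k < N) a k *: iter k T x) <= 70 * 1000 * C * ln (C + 1) * B * nrm x.
Proof.
move=> m0 supp aB.
have o1 := @outer_gt1 R m m0.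
have B0 : 0 <= B.
  apply: le_trans (nrm_ge0 _) (aB ((outer m)^-1)%:C%C _).
  by rewrite nrm_real ger0_norm // invr_ge0 (le_trans ler01) ?ltW.
have C0 : 0 <= C by apply: le_trans C1.
have l0 : 0 <= ln (C + 1) by have := ln_C_ge; lra.
have K0 : 0 <= 70 * 1000 * C * ln (C + 1) * B by prod_ge0.
apply: (poly_bound_of_quad o1 K0) => M1; exists (2 * (10 * m * M1.+1))%N; last first.
  by move=> y; apply: quad_dyadic_le => //; rewrite leq_pmulr.
rewrite mulnA (leq_trans (leqnSn _)) // leq_pmull //.
by rewrite !muln_gt0.
Qed.

(** On the circle of radius 2 the polynomial is at most [3 * B] and the resolvent at most [C]. *)
Lemma affine_poly_le (a0 a1 : R[i]) B x : nrm a0 <= B -> nrm a1 <= B ->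
  nrm (a0 *: x + a1 *: T x) <= 70 * 1000 * C * ln (C + 1) * B * nrm x.
Proof.
move=> h0 h1; have B0 : 0 <= B := le_trans (nrm_ge0 _) h0.
have C0 : 0 <= C by apply: le_trans C1.
have l1 := ln_C_ge.
pose a k : R[i] := if k is 0 then a0 else a1.
have -> : a0 *: x + a1 *: T x = \sum_(k < 2) a k *: iter k T x.
  by rewrite big_ord_recl big_ord1.
apply: (@le_trans _ _ (6 * C * B * nrm x)); last first.
  have W0 : 0 <= C * B * nrm x by prod_ge0.
  have -> : 6 * C * B * nrm x = (C * B * nrm x) * 6 by ring.
  have -> : 70 * 1000 * C * ln (C + 1) * B * nrm x =
    (C * B * nrm x) * (70 * 1000 * ln (C + 1)) by ring.
  by apply: ler_wpM2l => //; lra.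
have l2 : 1 < 2 :> R by rewrite ltr1n.
have K0 : 0 <= 6 * C * B by prod_ge0.
apply: (poly_bound_of_quad l2 K0) => M1; exists M1 => // y.
apply: (@nrm_mean_le M1 (fun j => (\sum_(k < 2) a k * (2%:C%C * om M1 ^+ j) ^+ k) *:
    ((2%:C%C * om M1 ^+ j) *: Rs (2%:C%C * om M1 ^+ j) y))).
  by prod_ge0.
move=> j.
have zr : nrm (2%:C%C * om M1 ^+ j) = 2 :> R by rewrite nrm_node.
rewrite nrmZ nrmZ zr.
have p3 : nrm (\sum_(k < 2) a k * (2%:C%C * om M1 ^+ j) ^+ k) <= 3 * B.
  rewrite big_ord_recl big_ord1 /= expr0 mulr1 expr1.
  by rewrite (le_trans (nrmD _ _)) // nrmM zr; lra.
have Ry : nrm (Rs (2%:C%C * om M1 ^+ j) y) <= C * nrm y.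
  have := @bndR_away (2%:C%C * om M1 ^+ j) y 1; rewrite divr1; apply; rewrite ?zr //.
  by have := nrm_sub1_ge (2%:C%C * om M1 ^+ j); rewrite zr; lra.
apply: (@le_trans _ _ (3 * B * (2 * (C * nrm y)))).
  by apply: ler_pM; rewrite ?nrm_ge0 ?mulr_ge0 ?nrm_ge0 // ler_wpM2l.
by rewrite le_eqVlt; apply/orP; left; apply/eqP; ring.
Qed.

End Resolvent.

(** * A discrete Goursat theorem *)
Section Goursat.
Context {R : realType}.
Implicit Types (h : R[i] -> R[i]) (Z : R * R -> R[i]) (P Q V : R * R).

Definition midpt P Q : R * R := ((P.1 + Q.1) / 2, (P.2 + Q.2) / 2).

Definition trap h (a b : R[i]) : R[i] := (h a + h b) / 2 * (b - a).

(** Trapezoid sum of [h] along the image under [Z] of the segment from [P] to [Q],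
    bisected [k] times. A recursive bisection makes the sum exactly additive at the
    midpoint. *)
Fixpoint seg h Z k P Q : R[i] :=
  if k is k'.+1 then seg h Z k' P (midpt P Q) + seg h Z k' (midpt P Q) Q
  else trap h (Z P) (Z Q).

Definition circ h Z k s t a b : R[i] :=
  seg h Z k (s, t) (s + a, t) + seg h Z k (s + a, t) (s + a, t + b) +
  seg h Z k (s + a, t + b) (s, t + b) + seg h Z k (s, t + b) (s, t).

Lemma midptC P Q : midpt P Q = midpt Q P.
Proof. by rewrite /midpt addrC [P.2 + _]addrC. Qed.

Lemma seg_opp h Z k P Q : seg h Z k Q P = - seg h Z k P Q.
Proof.
elim: k P Q => [|k IH] P Q /=; first by rewrite /trap; ring.
by rewrite (midptC Q P) (IH P) (IH _ Q) opprD addrC.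
Qed.

(** The inner sides are run through twice, in opposite directions. *)
Lemma circ_split h Z k s t a b :
  circ h Z k.+1 s t a b =
  circ h Z k s t (a / 2) (b / 2) + circ h Z k (s + a / 2) t (a / 2) (b / 2) +
  circ h Z k s (t + b / 2) (a / 2) (b / 2) +
  circ h Z k (s + a / 2) (t + b / 2) (a / 2) (b / 2).
Proof.
rewrite /circ /= /midpt /=.
have -> : (s + (s + a)) / 2 = s + a / 2 by field.
have -> : (t + t) / 2 = t by field.
have -> : (s + a + (s + a)) / 2 = s + a by field.
have -> : (t + (t + b)) / 2 = t + b / 2 by field.
have -> : (s + a + s) / 2 = s + a / 2 by field.
have -> : (t + b + (t + b)) / 2 = t + b by field.
have -> : (s + s) / 2 = s by field.
have -> : (t + b + t) / 2 = t + b / 2 by field.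
have -> : s + a / 2 + a / 2 = s + a by field.
have -> : t + b / 2 + b / 2 = t + b by field.
rewrite (seg_opp h Z k (s + a / 2, t) (s + a / 2, t + b / 2)).
rewrite (seg_opp h Z k (s, t + b / 2) (s + a / 2, t + b / 2)).
rewrite (seg_opp h Z k (s + a / 2, t + b / 2) (s + a, t + b / 2)).
rewrite (seg_opp h Z k (s + a / 2, t + b / 2) (s + a / 2, t + b)).
ring.
Qed.

Lemma seg_sub (h1 h2 : R[i] -> R[i]) Z k P Q :
  seg (fun z => h1 z - h2 z) Z k P Q = seg h1 Z k P Q - seg h2 Z k P Q.
Proof.
elim: k P Q => [|k IH] P Q /=; first by rewrite /trap; ring.
by rewrite !IH; ring.
Qed.

(** The trapezoid rule is exact on affine functions, so they have no circulation. *)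
Lemma seg_affine (al be : R[i]) Z k P Q : seg (fun z => al + be * z) Z k P Q =
  (al * Z Q + be * Z Q ^+ 2 / 2) - (al * Z P + be * Z P ^+ 2 / 2).
Proof.
elim: k P Q => [|k IH] P Q /=; first by rewrite /trap; field.
by rewrite !IH; ring.
Qed.

Definition dist1 P Q : R := `|P.1 - Q.1| + `|P.2 - Q.2|.

Lemma dist1_mid P Q :
  dist1 P (midpt P Q) = dist1 P Q / 2 /\ dist1 (midpt P Q) Q = dist1 P Q / 2.
Proof.
have E (x y : R) : `|x - (x + y) / 2| = `|x - y| / 2.
  by rewrite (_ : _ - _ = (x - y) / 2) ?normrM 1?[`|_^-1|]ger0_norm //; field.
have E' (x y : R) : `|(x + y) / 2 - y| = `|x - y| / 2.
  by rewrite (_ : _ - _ = (x - y) / 2) ?normrM 1?[`|_^-1|]ger0_norm //; field.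
by rewrite /dist1 /midpt /= !E !E' -mulrDl.
Qed.

Lemma seg_le h Z (D : R * R -> Prop) (eta La : R) k P Q :
  (forall P Q, D P -> D Q -> D (midpt P Q)) ->
  (forall V, D V -> nrm (h (Z V)) <= eta) ->
  (forall P Q, D P -> D Q -> nrm (Z P - Z Q) <= La * dist1 P Q) ->
  D P -> D Q -> nrm (seg h Z k P Q) <= eta * (La * dist1 P Q).
Proof.
move=> Dm hD ZD; elim: k P Q => [|k IH] P Q DP DQ /=.
  rewrite /trap nrmM ler_pM ?nrm_ge0 //; last by rewrite nrm_distC ZD.
  rewrite nrmM nrmV nrm_nat ler_pdivrMr // (le_trans (nrmD _ _)) //.
  have := hD P DP; have := hD Q DQ; lra.
have DM := Dm _ _ DP DQ.
rewrite (le_trans (nrmD _ _)) // (le_trans (lerD (IH _ _ DP DM) (IH _ _ DM DQ))) //.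
have [-> ->] := dist1_mid P Q.
by rewrite le_eqVlt; apply/orP; left; apply/eqP; field.
Qed.

Definition in_rect s t a b V := s <= V.1 <= s + a /\ t <= V.2 <= t + b.

Lemma in_rect_mid s t a b P Q :
  in_rect s t a b P -> in_rect s t a b Q -> in_rect s t a b (midpt P Q).
Proof.
move=> [/andP[h1 h2] /andP[h3 h4]] [/andP[h5 h6] /andP[h7 h8]].
by split; apply/andP; split; rewrite /=; lra.
Qed.

(** Only the deviation of [h] from an affine function circulates. *)
Lemma circ_le h Z (al be : R[i]) (eta La s t a b : R) k :
  0 <= a -> 0 <= b ->
  (forall V, in_rect s t a b V -> nrm (h (Z V) - (al + be * Z V)) <= eta) ->
  (forall P Q, in_rect s t a b P -> in_rect s t a b Q ->
     nrm (Z P - Z Q) <= La * dist1 P Q) ->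
  nrm (circ h Z k s t a b) <= eta * (La * (2 * (a + b))).
Proof.
move=> a0 b0 hD ZD.
pose e z := h z - (al + be * z).
have -> : circ h Z k s t a b = circ e Z k s t a b.
  by rewrite /circ /e !(seg_sub h) !seg_affine; ring.
have r1 : in_rect s t a b (s, t) by rewrite /in_rect /=; lra.
have r2 : in_rect s t a b (s + a, t) by rewrite /in_rect /=; lra.
have r3 : in_rect s t a b (s + a, t + b) by rewrite /in_rect /=; lra.
have r4 : in_rect s t a b (s, t + b) by rewrite /in_rect /=; lra.
have S := @seg_le e Z (in_rect s t a b) eta La k _ _ (@in_rect_mid s t a b) hD ZD.
have := S _ _ r1 r2; have := S _ _ r2 r3; have := S _ _ r3 r4; have := S _ _ r4 r1.
rewrite /dist1 /= !subrr !normr0 !add0r !addr0.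
have -> : s - (s + a) = - a by ring.
have -> : t - (t + b) = - b by ring.
have -> : s + a - s = a by ring.
have -> : t + b - t = b by ring.
rewrite !normrN !ger0_norm // /circ.
move: (seg _ _ _ _ _) (seg _ _ _ _ _) (seg _ _ _ _ _) (seg _ _ _ _ _) => u1 u2 u3 u4.
move=> h1 h2 h3 h4.
have -> : eta * (La * (2 * (a + b))) =
  eta * (La * a) + eta * (La * b) + eta * (La * a) + eta * (La * b) by ring.
rewrite (le_trans (nrmD _ _)) // lerD // (le_trans (nrmD _ _)) // lerD //.
by rewrite (le_trans (nrmD _ _)) // lerD.
Qed.

Section Bisection.
Variables (h : R[i] -> R[i]) (Z : R * R -> R[i]) (s0 t0 a0 b0 La : R).
Hypothesis a00 : 0 <= a0.
Hypothesis b00 : 0 <= b0.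
Hypothesis La0 : 0 < La.
Hypothesis ZD : forall P Q, in_rect s0 t0 a0 b0 P -> in_rect s0 t0 a0 b0 Q ->
     nrm (Z P - Z Q) <= La * dist1 P Q.
Hypothesis hD : forall P, in_rect s0 t0 a0 b0 P -> exists be, forall e, 0 < e ->
  exists2 d, 0 < d & forall z, nrm (z - Z P) < d ->
    nrm (h z - h (Z P) - be * (z - Z P)) <= e * nrm (z - Z P).

(** Goursat by bisection: a rectangle on which the bound fails has a quarter on which it
    fails. The resulting nested rectangles shrink to a point, near which [h] is affine up
    to a small multiple of the distance, and there [circ_le] gives the bound. *)
Section Eta.
Variable eta : R.
Hypothesis eta0 : 0 < eta.

Let good s t a b := exists K, forall k, (K <= k)%N ->
  nrm (circ h Z k s t a b) <= eta * (a + b) ^+ 2.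

Let good_split s t a b : good s t (a / 2) (b / 2) ->
  good (s + a / 2) t (a / 2) (b / 2) -> good s (t + b / 2) (a / 2) (b / 2) ->
  good (s + a / 2) (t + b / 2) (a / 2) (b / 2) -> good s t a b.
Proof.
move=> [K1 h1] [K2 h2] [K3 h3] [K4 h4].
exists (maxn (maxn K1 K2) (maxn K3 K4)).+1 => -[//|k].
rewrite ltnS !geq_max => /andP[/andP[k1 k2] /andP[k3 k4]].
rewrite circ_split.
have -> : eta * (a + b) ^+ 2 = eta * (a / 2 + b / 2) ^+ 2 + eta * (a / 2 + b / 2) ^+ 2 +
  eta * (a / 2 + b / 2) ^+ 2 + eta * (a / 2 + b / 2) ^+ 2 by field.
rewrite (le_trans (nrmD _ _)) // lerD ?h4 // (le_trans (nrmD _ _)) // lerD ?h3 //.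
by rewrite (le_trans (nrmD _ _)) // lerD ?h1 ?h2.
Qed.

(** The lower left corner of a failing quarter, if there is one. *)
Let next (n : nat) (st : R * R) : R * R :=
  let a := a0 / 2 ^+ n.+1 in let b := b0 / 2 ^+ n.+1 in
  if ~~ `[< good st.1 st.2 a b >] then st
  else if ~~ `[< good (st.1 + a) st.2 a b >] then (st.1 + a, st.2)
  else if ~~ `[< good st.1 (st.2 + b) a b >] then (st.1, st.2 + b)
  else (st.1 + a, st.2 + b).

Let Fixpoint corner (n : nat) : R * R :=
  if n is n'.+1 then next n' (corner n') else (s0, t0).

Let bad_corner n : ~ good s0 t0 a0 b0 ->
  ~ good (corner n).1 (corner n).2 (a0 / 2 ^+ n) (b0 / 2 ^+ n).
Proof.
move=> bad; elim: n => [|n IH]; first by rewrite expr0 !divr1.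
rewrite [corner n.+1]/= /next; move: (corner n) IH => [s t] /= IH.
do 3 (case: asboolP => //= ?).
move=> g4; apply: IH; apply: good_split;
  rewrite -!mulrA -!invfM -!exprSr //.
Qed.

Let corner_bounds n i :
  [/\ (corner n).1 <= (corner (n + i)).1,
      (corner (n + i)).1 + a0 / 2 ^+ (n + i) <= (corner n).1 + a0 / 2 ^+ n,
      (corner n).2 <= (corner (n + i)).2 &
      (corner (n + i)).2 + b0 / 2 ^+ (n + i) <= (corner n).2 + b0 / 2 ^+ n].
Proof.
elim: i => [|i [h1 h2 h3 h4]]; first by rewrite addn0 !lexx.
rewrite addnS.
set q := (n + i)%N in h1 h2 h3 h4 *.
have aq : 0 <= a0 / 2 ^+ q.+1 by rewrite divr_ge0 ?exprn_ge0.
have bq : 0 <= b0 / 2 ^+ q.+1 by rewrite divr_ge0 ?exprn_ge0.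
have aE : a0 / 2 ^+ q = a0 / 2 ^+ q.+1 + a0 / 2 ^+ q.+1.
  by rewrite exprS; field; rewrite expf_neq0.
have bE : b0 / 2 ^+ q = b0 / 2 ^+ q.+1 + b0 / 2 ^+ q.+1.
  by rewrite exprS; field; rewrite expf_neq0.
rewrite aE in h2; rewrite bE in h4.
rewrite [corner q.+1]/= /next; move: (corner q) h1 h2 h3 h4 => [s t] /= h1 h2 h3 h4.
by do 3 (case: asboolP => _ /=; last by split; lra); split; lra.
Qed.

Let corner_le n i :
  (corner n).1 <= (corner i).1 + a0 / 2 ^+ i /\ (corner n).2 <= (corner i).2 + b0 / 2 ^+ i.
Proof.
have an q : 0 <= a0 / 2 ^+ q by rewrite divr_ge0 ?exprn_ge0.
have bn q : 0 <= b0 / 2 ^+ q by rewrite divr_ge0 ?exprn_ge0.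
have [ni|ni] := leqP n i.
  have := corner_bounds n (i - n); rewrite subnKC // => -[h1 _ h3 _].
  by have := an i; have := bn i; lra.
have := corner_bounds i (n - i); rewrite subnKC ?(ltnW ni) // => -[_ h2 _ h4].
by have := an n; have := bn n; lra.
Qed.

Let limit_corner : exists V, forall n,
  in_rect (corner n).1 (corner n).2 (a0 / 2 ^+ n) (b0 / 2 ^+ n) V.
Proof.
pose S1 := [set (corner n).1 | n in [set: nat]].
pose S2 := [set (corner n).2 | n in [set: nat]].
exists (sup S1, sup S2) => n.
have u1 i : ubound S1 ((corner i).1 + a0 / 2 ^+ i).
  by move=> _ [j _ <-]; have [] := corner_le j i.
have u2 i : ubound S2 ((corner i).2 + b0 / 2 ^+ i).
  by move=> _ [j _ <-]; have [] := corner_le j i.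
split; apply/andP; split => /=.
- by apply: ub_le_sup; [exists ((corner 0).1 + a0 / 2 ^+ 0); exact: u1 | exists n].
- by apply: ge_sup; [exists (corner 0).1; exists 0%N | exact: u1].
- by apply: ub_le_sup; [exists ((corner 0).2 + b0 / 2 ^+ 0); exact: u2 | exists n].
- by apply: ge_sup; [exists (corner 0).2; exists 0%N | exact: u2].
Qed.

Lemma rect_good : good s0 t0 a0 b0.
Proof.
have [//|bad] := pselect (good s0 t0 a0 b0).
have [V hV] := limit_corner.
have sub n P : in_rect (corner n).1 (corner n).2 (a0 / 2 ^+ n) (b0 / 2 ^+ n) P ->
    in_rect s0 t0 a0 b0 P.
  have := corner_bounds 0 n; rewrite add0n expr0 !divr1 /= => -[h1 h2 h3 h4].
  by move=> [/andP[h5 h6] /andP[h7 h8]]; split; apply/andP; split; lra.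
have [be hbe] := hD (sub _ _ (hV 0%N)).
have e0 : 0 < eta / (2 * La ^+ 2) by rewrite divr_gt0 // mulr_gt0 // exprn_gt0.
have [d d0 hd] := hbe _ e0.
have dn : exists n : nat, La * ((a0 + b0) / 2 ^+ n) < d.
  have ab0 : 0 <= La * (a0 + b0) by rewrite mulr_ge0 ?addr_ge0 // ltW.
  have := truncnS_gt (La * (a0 + b0) / d); set N := (Num.truncn _).+1 => hN.
  exists N; rewrite mulrA ltr_pdivrMr ?exprn_gt0 //.
  rewrite [d * _]mulrC -ltr_pdivrMr // (lt_trans hN) //.
  by rewrite -natrX ltr_nat ltn_expl.
case: dn => n hn; exfalso; apply: (@bad_corner n bad); exists 0%N => k _.
set s := (corner n).1 in hV *; set t := (corner n).2 in hV *.
set a := a0 / 2 ^+ n; set b := b0 / 2 ^+ n.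
have a1 : 0 <= a by rewrite divr_ge0 ?exprn_ge0.
have b1 : 0 <= b by rewrite divr_ge0 ?exprn_ge0.
have hab : (a0 + b0) / 2 ^+ n = a + b by rewrite mulrDl.
have hVn := hV n.
have close P : in_rect s t a b P -> nrm (Z P - Z V) <= La * (a + b).
  move=> rP; rewrite (le_trans (ZD (sub _ _ rP) (sub _ _ hVn))) // ler_pM2l //.
  move: rP hVn => [/andP[h5 h6] /andP[h7 h8]] [/andP[h1 h2] /andP[h3 h4]].
  rewrite -/s -/t -/a -/b in h1 h2 h3 h4.
  by rewrite /dist1 lerD // ler_norml; apply/andP; split; lra.
have -> : eta * (a + b) ^+ 2 =
   eta / (2 * La ^+ 2) * (La * (a + b)) * (La * (2 * (a + b))).
  by field; rewrite gt_eqF.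
apply: (@circ_le h Z (h (Z V) - be * Z V) be) => // [P rP|P Q rP rQ]; last first.
  exact: (ZD (sub _ _ rP) (sub _ _ rQ)).
have -> : h (Z P) - (h (Z V) - be * Z V + be * Z P) =
  h (Z P) - h (Z V) - be * (Z P - Z V) by ring.
have := close P rP; rewrite hab in hn => hP.
rewrite (le_trans (hd _ (le_lt_trans hP hn))) // ler_wpM2l // ltW //.
Qed.

End Eta.

Theorem goursat e : 0 < e -> exists K, forall k, (K <= k)%N ->
  nrm (circ h Z k s0 t0 a0 b0) <= e.
Proof.
move=> e0; pose c := (a0 + b0) ^+ 2 + 1.
have c0 : 0 < c by rewrite ltr_wpDl // sqr_ge0.
have [K hK] := rect_good (divr_gt0 e0 c0).
exists K => k kK; rewrite (le_trans (hK k kK)) //.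
rewrite mulrAC ler_pdivrMr // ler_wpM2l ?(ltW e0) // lerDl //.
Qed.

End Bisection.

End Goursat.

(** * Cauchy coefficients of a holomorphic function *)
Section CauchyCoefficients.
Context {R : realType}.
Implicit Types (f h : R[i] -> R[i]) (z w : R[i]).

Definition clim (V : normedZmodType R[i]) (u : nat -> V) (l : V) : Prop :=
  forall e : R, 0 < e -> exists K, forall k, (K <= k)%N -> nrm (u k - l) <= e.

(** Written without a quotient, so that [z] itself needs no exception. *)
Definition cderivable f z (d : R[i]) : Prop := forall e : R, 0 < e ->
  exists2 del, 0 < del & forall z', nrm (z' - z) < del ->
    nrm (f z' - f z - d * (z' - z)) <= e * nrm (z' - z).

Lemma seg_vertical h (Z : R * R -> R[i]) k s t b :
  seg h Z k (s, t) (s, t + b) = \sum_(j < 2 ^ k)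
    trap h (Z (s, t + b * (j%:R / (2 ^ k)%:R))) (Z (s, t + b * (j.+1%:R / (2 ^ k)%:R))).
Proof.
elim: k t b => [|k IH] t b.
  by rewrite big_ord1 /= mul0r mulr0 addr0 divr1 mulr1.
rewrite [LHS]/= /midpt /=.
have -> : (s + s) / 2 = s by field.
have -> : (t + (t + b)) / 2 = t + b / 2 by field.
have -> : (s, t + b) = (s, t + b / 2 + b / 2) by congr pair; field.
rewrite IH IH.
have k0 : (2 ^ k)%:R != 0 :> R by rewrite pnatr_eq0 expn_eq0.
have -> : (2 ^ k.+1 = 2 ^ k + 2 ^ k)%N by rewrite expnS mul2n addnn.
have E (x : nat) : b / 2 * (x%:R / (2 ^ k)%:R) = b * (x%:R / (2 ^ k + 2 ^ k)%:R).
  by rewrite natrD; field; rewrite k0 -mulr2n -mulr_natr mulf_neq0.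
have E' (x : nat) : b / 2 + b / 2 * (x%:R / (2 ^ k)%:R) =
    b * ((2 ^ k + x)%:R / (2 ^ k + 2 ^ k)%:R).
  by rewrite !natrD; field; rewrite k0 -mulr2n -mulr_natr mulf_neq0.
rewrite big_split_ord /=; congr (_ + _); apply: eq_bigr => j _ /=.
  by rewrite !E.
by rewrite -!addrA !E' addnS.
Qed.

Lemma seg_shift h (Z : R * R -> R[i]) k (P Q : R * R) (tau : R * R -> R * R) :
  (forall P Q, tau (midpt P Q) = midpt (tau P) (tau Q)) ->
  (forall P, Z (tau P) = Z P) ->
  seg h Z k (tau P) (tau Q) = seg h Z k P Q.
Proof.
move=> tm Zt; elim: k P Q => [|k IH] P Q /=; first by rewrite !Zt.
by rewrite -tm !IH.
Qed.

Lemma sum_cyclic (V : zmodType) (F : nat -> V) M : F M = F 0%N ->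
  \sum_(j < M) F j.+1 = \sum_(j < M) F j.
Proof.
move=> FM; apply: (@addrI _ (F 0%N)).
rewrite -(big_ord_recl M (fun j => F j)) (big_ord_recr M (fun j => F j)) /=.
by rewrite FM addrC.
Qed.

(** The nodes form a geometric progression, so summation by parts turns the trapezoid sum
    into a multiple of the Riemann sum. *)
Lemma trap_circle h (r : R[i]) M : (0 < M)%N ->
  \sum_(j < M) trap h (r * om M ^+ j) (r * om M ^+ j.+1) =
  (om M - (om M)^-1) / 2 * \sum_(j < M) h (r * om M ^+ j) * (r * om M ^+ j).
Proof.
move=> M0; pose F j := h (r * om M ^+ j) * (r * om M ^+ j).
have w0 := om_neq0 M : om M != 0 :> R[i].
rewrite (eq_bigr (fun j : 'I_M => (om M - 1) / 2 * F j + (1 - (om M)^-1) / 2 * F j.+1)).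
  rewrite big_split /= -!mulr_sumr sum_cyclic -?mulrDl; last first.
    by rewrite /F om_expM.
  by congr (_ * _); field.
move=> j _; rewrite /trap /F exprSr.
move: (om M) w0 => u u0; field; exact: u0.
Qed.

Section Cauchy.
Variables (f : R[i] -> R[i]) (r : R) (w : R[i]).
Hypothesis hf : forall z, nrm z < 1 -> exists d, cderivable f z d.
Hypothesis r01 : 0 < r < 1.
Hypothesis wr : nrm w < r.

Let r0 : 0 < r. Proof. by case/andP: r01. Qed.
Let r1 : r < 1. Proof. by case/andP: r01. Qed.
Let w1 : nrm w < 1. Proof. exact: lt_trans r1. Qed.

Let h z := (f z - f w) / (z - w).

Let h_diff z0 : nrm z0 < 1 -> z0 != w -> exists be, cderivable h z0 be.
Proof.
move=> z01 z0w; have [d hd] := hf z01.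
pose D0 := z0 - w; have D00 : D0 != 0 by rewrite subr_eq0.
have nD0 : 0 < nrm D0 by rewrite nrm_gt0.
pose be := (d * D0 - (f z0 - f w)) / D0 ^+ 2.
exists be => e e0.
have e1 : 0 < e * nrm D0 / 4 by rewrite divr_gt0 // mulr_gt0.
have [d1 d10 hd1] := hd _ e1.
have b1 : 0 < 4 * (nrm be + 1) by rewrite mulr_gt0 // ltr_wpDl // nrm_ge0.
pose d2 := e * nrm D0 / (4 * (nrm be + 1)).
have d20 : 0 < d2 by rewrite divr_gt0 // mulr_gt0.
exists (Num.min d1 (Num.min (nrm D0 / 2) d2)).
  by rewrite !lt_min d10 d20 divr_gt0.
move=> z; rewrite !lt_min => /andP[z1 /andP[z2 z3]].
have := hd1 z z1; set E := f z - f z0 - _; set De := z - z0 => hE.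
have hD : nrm D0 / 2 <= nrm (D0 + De).
  have := nrm_le_dist D0 (D0 + De); rewrite opprD addNKr nrmN.
  by rewrite -/De in z2; lra.
have D1 : D0 + De != 0 by rewrite -nrm_gt0 (lt_le_trans _ hD) // divr_gt0.
have -> : h z - h z0 - be * (z - z0) = (E - be * De ^+ 2) / (D0 + De).
  rewrite /h.
  have -> : z - w = D0 + De by rewrite /D0 /De; ring.
  have -> : f z - f w = (f z0 - f w) + d * De + E by rewrite /E /De; ring.
  rewrite -/D0 -/De /be; move: (f z0 - f w) E De D0 D00 D1 {hE hD b1 d2 d20 z3 z2 e1 hd1 nD0 be}.
  by move=> n0 E De D0 D00 D1; field; rewrite D00 D1.
rewrite nrmM nrmV ler_pdivrMr; last by rewrite nrm_gt0.
rewrite (le_trans (nrmB _ _)) // nrmM nrmX -/De.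
rewrite -/De in z3.
have n0 := nrm_ge0 De.
have h1 : nrm be * nrm De ^+ 2 <= e * nrm D0 / 4 * nrm De.
  rewrite expr2 mulrA ler_wpM2r //.
  have : (nrm be + 1) * nrm De <= e * nrm D0 / 4.
    move: z3; rewrite /d2 ltr_pdivlMr // => z3; lra.
  apply: le_trans; rewrite ler_wpM2r //; lra.
have h2 : e * nrm De * (nrm D0 / 2) <= e * nrm De * nrm (D0 + De).
  by rewrite ler_wpM2l // mulr_ge0 // ltW.
lra.
Qed.

(** Contracts the circle of radius [r] to the point [w]; the first coordinate is the
    contraction parameter and the second one the angle. *)
Let Z (P : R * R) : R[i] := w + P.1%:C%C * (r%:C%C * cis P.2 - w).

Let nrm_rcis t : nrm (r%:C%C * cis t) = r.
Proof. by rewrite nrmM nrm_cis mulr1 nrm_real gtr0_norm. Qed.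

Let Z_sub P Q : 0 <= Q.1 -> nrm (Z P - Z Q) <= 2 * `|P.1 - Q.1| + 8 * Q.1 * `|P.2 - Q.2|.
Proof.
move=> Q0.
have -> : Z P - Z Q = (P.1 - Q.1)%:C%C * (r%:C%C * cis P.2 - w) +
  Q.1%:C%C * r%:C%C * (cis P.2 - cis Q.2).
  by rewrite /Z rmorphB /=; ring.
rewrite (le_trans (nrmD _ _)) // lerD //.
  rewrite nrmM nrm_real mulrC ler_wpM2r // (le_trans (nrmB _ _)) // nrm_rcis.
  by have := r1; have := wr; lra.
rewrite !nrmM !nrm_real (ger0_norm Q0) (gtr0_norm r0) [8 * _]mulrC -!mulrA ler_wpM2l //.
apply: (@le_trans _ _ (1 * nrm (cis P.2 - cis Q.2))).
  by rewrite ler_wpM2r ?nrm_ge0 // ltW.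
by rewrite mul1r cis_lip.
Qed.

Let Z_lt1 P : 0 <= P.1 <= 1 -> nrm (Z P) < 1.
Proof.
move=> /andP[p0 p1].
have -> : Z P = (1 - P.1)%:C%C * w + P.1%:C%C * (r%:C%C * cis P.2).
  by rewrite /Z rmorphB /=; ring.
rewrite (le_lt_trans (nrmD _ _)) // !nrmM !nrm_real nrm_cis mulr1 (gtr0_norm r0).
rewrite !ger0_norm ?subr_ge0 //; have := nrm_ge0 w; have := r1; have := wr; nra.
Qed.

Let Z_neq P : 0 < P.1 -> Z P != w.
Proof.
move=> p0; rewrite -subr_eq0 /Z addrAC subrr add0r mulf_neq0 //.
  by rewrite -nrm_eq0 nrm_real gtr0_norm // gt_eqF.
rewrite -nrm_gt0 (lt_le_trans (_ : 0 < r - nrm w)) ?subr_gt0 //.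
have := nrm_le_dist (r%:C%C * cis P.2) w; rewrite nrm_rcis; lra.
Qed.

Let h_near : exists2 H, 0 < H & exists2 d, 0 < d &
  forall z, nrm (z - w) < d -> nrm (h z) <= H.
Proof.
have [d hd] := hf w1; have [e e0 he] := hd 1 ltr01.
exists (nrm d + 1); first by rewrite ltr_wpDl // nrm_ge0.
exists e => // z ze; rewrite /h nrmM nrmV.
have [->|zw] := eqVneq z w; first by rewrite !subrr !nrm0 mul0r addr_ge0 ?nrm_ge0.
rewrite ler_pdivrMr ?nrm_gt0 ?subr_eq0 //.
have := nrmD (f z - f w - d * (z - w)) (d * (z - w)); rewrite subrK nrmM.
have := he z ze; lra.
Qed.

Let zz M j : R[i] := r%:C%C * om M ^+ j.

(** Goursat on the parameters between [del] and 1: the two radial sides cancel by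
    periodicity, and the side at [del] runs through a circle around [w] of length of order
    [del], on which the difference quotient [h] is bounded. *)
Lemma cauchy_trap : clim (fun k => seg h Z k (1, 0) (1, 1)) 0.
Proof.
move=> e e0; have [H H0 [d d0 hH]] := h_near.
pose del := Num.min (1 / 2) (Num.min (d / 4) (e / (16 * H))).
have del0 : 0 < del by rewrite !lt_min !divr_gt0 // mulr_gt0.
have /andP[del1 /andP[del2 del3]] :
    (del <= 1 / 2) && ((del <= d / 4) && (del <= e / (16 * H))).
  by rewrite /del !ge_min !lexx /= !orbT.
have inr P : in_rect del 0 (1 - del) 1 P -> 0 < P.1 /\ P.1 <= 1.
  by move=> [/andP[h1 h2] _]; split; lra.
have [K hK] : exists K, forall k, (K <= k)%N ->
    nrm (circ h Z k del 0 (1 - del) 1) <= e / 2.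
  have d1 : 0 <= 1 - del by lra.
  apply: (@goursat _ h Z del 0 (1 - del) 1 8 d1 ler01 (ltr0n R 8)).
  - move=> P Q rP rQ; have [q0 q1] := inr Q rQ.
    rewrite (le_trans (Z_sub _ (ltW q0))) // /dist1.
    have := normr_ge0 (P.1 - Q.1); have := normr_ge0 (P.2 - Q.2); nra.
  - move=> P rP; have [p0 p1] := inr P rP; apply: h_diff; last exact: Z_neq.
    by apply: Z_lt1; rewrite p1 ltW.
  by rewrite divr_gt0.
exists K => k kK; rewrite subr0; have := hK k kK; rewrite /circ.
have -> : del + (1 - del) = 1 by ring.
rewrite !add0r.
have sides : seg h Z k (1, 1) (del, 1) = - seg h Z k (del, 0) (1, 0).
  rewrite -seg_opp.
  have := @seg_shift h Z k (1, 0) (del, 0) (fun P => (P.1, P.2 + 1)).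
  rewrite /= add0r; apply => [P Q|P] /=.
    by rewrite /midpt /=; congr pair; field.
  by rewrite /Z /= cisD cis1 mulr1.
rewrite sides.
have inner : nrm (seg h Z k (del, 1) (del, 0)) <= e / 2.
  pose D (P : R * R) := P.1 = del.
  have := @seg_le _ h Z D H (8 * del) k (del, 1) (del, 0).
  rewrite /dist1 /= subrr normr0 add0r subr0 normr1 mulr1 => S.
  apply: (le_trans (S _ _ _ _ _)) => //.
  - by move=> P Q; rewrite /D /midpt /= => -> ->; field.
  - move=> V DV; apply: hH; rewrite /Z addrAC subrr add0r nrmM nrm_real DV (gtr0_norm del0).
    have : nrm (r%:C%C * cis V.2 - w) <= 2.
      by rewrite (le_trans (nrmB _ _)) // nrm_rcis; have := r1; have := wr; lra.
    nra.
  - move=> P Q DP DQ; rewrite (le_trans (Z_sub _ _)) ?DQ ?(ltW del0) //.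
    by rewrite DP subrr normr0 mulr0 !add0r.
  move: del3; rewrite ler_pdivlMr ?mulr_gt0 //; lra.
move: inner; set v := seg h Z k (1, 0) (1, 1); set u := seg h Z k (del, 0) (1, 0).
set x := seg h Z k (del, 1) (del, 0) => hx hu.
have -> : v = (u + v + - u + x) - x by ring.
rewrite (le_trans (nrmB _ _)) //; lra.
Qed.

(** The circulation of [h] along the circle is the mean of [h(z) z] up to a factor of
    order 1. *)
Lemma cauchy_mean :
  clim (fun k => (2 ^ k)%:R^-1 * \sum_(j < 2 ^ k) h (zz (2 ^ k) j) * zz (2 ^ k) j) 0.
Proof.
move=> e e0; have [K hK] := cauchy_trap e0.
exists (maxn K 2) => k; rewrite geq_max => /andP[kK k2].
have := hK k kK; rewrite !subr0.
have := seg_vertical h Z k 1 0 1; rewrite add0r => ->.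
have M0 : (0 < 2 ^ k)%N by rewrite expn_gt0.
rewrite (eq_bigr (fun j : 'I_(2 ^ k) => trap h (zz (2 ^ k) j) (zz (2 ^ k) j.+1))); last first.
  have ZE t : Z (1, 0 + 1 * t) = r%:C%C * cis t.
    by rewrite /Z /= add0r mul1r rmorph1 mul1r addrC subrK.
  by move=> j _; rewrite !ZE /zz !omX.
rewrite trap_circle // !nrmM !nrmV !nrm_nat.
have MR : 0 < (2 ^ k)%:R :> R by rewrite ltr0n.
have h1 : 2 / (2 ^ k)%:R <= nrm (om (2 ^ k) - (om (2 ^ k))^-1 : R[i]) / 2.
  have -> : nrm (om (2 ^ k) - (om (2 ^ k))^-1 : R[i]) = nrm (om (2 ^ k) ^+ 2 - 1 : R[i]).
    have w0 := om_neq0 (2 ^ k) : om (2 ^ k) != 0 :> R[i].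
    have -> : om (2 ^ k) - (om (2 ^ k))^-1 = (om (2 ^ k) ^+ 2 - 1) / om (2 ^ k) :> R[i].
      by field.
    by rewrite nrmM nrmV nrm_om invr1 mulr1.
  have M4 : (4 <= 2 ^ k)%N by rewrite (@leq_pexp2l 2 2 k).
  have := @omX_sub1_ge R (2 ^ k) 2 (leq_trans (isT : 2 <= 4)%N M4).
  rewrite (_ : minn 2 (2 ^ k - 2) = 2%N); last by apply/minn_idPl; lia.
  by move=> ?; rewrite ler_pdivlMr // mulrAC.
move: (nrm (\sum_(j < _) _)) (nrm_ge0 (\sum_(j < 2 ^ k) h (zz (2 ^ k) j) * zz (2 ^ k) j)).
move=> S S0 hS.
have := ler_wpM2r S0 h1; rewrite mulrAC -mulrA => h2.
have -> : (2 ^ k)%:R^-1 * S = (2 * (S / (2 ^ k)%:R)) / 2 by field; rewrite gt_eqF.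
have := le_trans h2 hS; lra.
Qed.

(** Riemann sum of the Cauchy integral of the [l]-th Taylor coefficient. *)
Definition ccoef (M l : nat) : R[i] := M%:R^-1 * \sum_(j < M) f (zz M j) / zz M j ^+ l.

(** At the nodes [z ^+ M = r ^+ M], so [(1 - (w / r) ^+ M) z / (z - w)] is the finite
    geometric sum of the [(w / z) ^+ l]. Hence the polynomial differs from [f w] by a
    multiple of the mean in [cauchy_mean]. *)
Lemma cauchy_series : clim (fun k => \sum_(l < 2 ^ k) ccoef (2 ^ k) l * w ^+ l) (f w).
Proof.
move=> e e0; have [K hK] := cauchy_mean (divr_gt0 e0 (ltr0n R 2)).
exists K => k kK; have := hK k kK; rewrite subr0.
have M0 : (0 < 2 ^ k)%N by rewrite expn_gt0.
move: (2 ^ k)%N M0 => M M0 hM.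
have M0' : M%:R != 0 :> R[i] by rewrite pnatr_eq0 -lt0n.
have rC0 : r%:C%C != 0 :> R[i] by rewrite -nrm_eq0 nrm_real gtr0_norm // gt_eqF.
have z0 j : zz M j != 0 by rewrite mulf_neq0 // expf_neq0 // om_neq0.
have zn j : nrm (zz M j) = r by rewrite nrmM nrm_omX mulr1 nrm_real gtr0_norm.
have zw j : zz M j - w != 0.
  rewrite -nrm_gt0 (lt_le_trans (_ : 0 < r - nrm w)) ?subr_gt0 //.
  have := nrm_le_dist (zz M j) w; rewrite zn; lra.
have geo j : (1 - (w / r%:C%C) ^+ M) * (zz M j / (zz M j - w)) =
    \sum_(l < M) w ^+ l / zz M j ^+ l.
  rewrite [RHS](eq_bigr (fun l : 'I_M => (w / zz M j) ^+ l)); last first.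
    by move=> l _; rewrite expr_div_n.
  have zM : zz M j ^+ M = r%:C%C ^+ M.
    by rewrite exprMn exprAC om_expM // expr1n mulr1.
  have := subrX1 (w / zz M j) M; rewrite expr_div_n zM -expr_div_n => E.
  have -> : 1 - (w / r%:C%C) ^+ M = - ((w / zz M j - 1) * \sum_(i < M) (w / zz M j) ^+ i).
    by rewrite -E opprB.
  set S := \sum_(i < M) (w / zz M j) ^+ i; clearbody S.
  move: (zz M j) (z0 j) (zw j) => x x0 xw.
  by field; rewrite x0 xw.
have -> : \sum_(l < M) ccoef M l * w ^+ l - f w =
   (1 - (w / r%:C%C) ^+ M) * (M%:R^-1 * \sum_(j < M) h (zz M j) * zz M j).
  rewrite mulrCA mulr_sumr.
  rewrite [X in _ = _ * X](eq_bigr (fun j : 'I_M => \sum_(l < M)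
    (f (zz M j) * (w ^+ l / zz M j ^+ l) - f w * (w ^+ l / zz M j ^+ l)))); last first.
    move=> j _; rewrite sumrB -!mulr_sumr -geo /h; move: (1 - _) => q.
    by field; exact: zw.
  under [X in _ = _ * X]eq_bigr do rewrite sumrB.
  rewrite sumrB mulrBr; congr (_ - _).
    rewrite exchange_big /= mulr_sumr; apply: eq_bigr => l _.
    rewrite /ccoef mulrAC -!mulrA mulr_sumr; congr (_ * _); apply: eq_bigr => j _.
    by rewrite mulrCA.
  rewrite exchange_big /=.
  rewrite (eq_bigr (fun l : 'I_M => f w * (w ^+ l / r%:C%C ^+ l *
      \sum_(j < M) om M ^+ j ^+ 0 / om M ^+ j ^+ l))); last first.
    move=> l _; rewrite !mulr_sumr; apply: eq_bigr => j _.
    by rewrite /zz exprMn invfM expr0; ring.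
  under eq_bigr => l _ do rewrite om_orth //.
  rewrite (bigD1 (Ordinal M0)) //= big1 ?addr0 => [|l l0].
    by rewrite !expr0 divr1 mul1r mul1r mulrCA mulVf // mulr1.
  have -> : (0%N == l) = false by move: l0; rewrite -val_eqE /= eq_sym => /negbTE.
  by rewrite mul0r !mulr0.
rewrite nrmM.
have h2 : nrm (1 - (w / r%:C%C) ^+ M) <= 2.
  rewrite (le_trans (nrmB _ _)) // nrm1 nrmX (_ : 2 = 1 + 1) // lerD2l.
  rewrite exprn_ile1 ?nrm_ge0 // nrmM nrmV nrm_real (gtr0_norm r0) ler_pdivrMr // mul1r.
  exact: ltW.
have := nrm_ge0 (1 - (w / r%:C%C) ^+ M); move: hM; have := nrm_ge0 (M%:R^-1 * \sum_(j < M) h (zz M j) * zz M j).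
move: (nrm (M%:R^-1 * _)) (nrm (1 - _)) h2 => x y *; nra.
Qed.

End Cauchy.
End CauchyCoefficients.

(** * Power series *)
Section Limits.
Context {R : realType}.

Lemma cvg_of_cauchy (K : numFieldType) (V : completeNormedModType K) (u : nat -> V) :
  (forall e : K, 0 < e -> exists N, forall m n, (N <= m)%N -> (N <= n)%N -> `|u m - u n| < e) ->
  cvg (u @ \oo).
Proof.
move=> H; apply/cauchy_cvgP/cauchy_exP => e e0.
have [N hN] := H e e0; exists (u N); exists N => // n /= Nn.
by rewrite -ball_normE /=; exact: hN.
Qed.

Lemma clim_le (V : normedZmodType R[i]) (u : nat -> V) l (M : R) (K0 : nat) :
  clim u l -> (forall k, (K0 <= k)%N -> nrm (u k) <= M) -> nrm l <= M.
Proof.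
move=> ul uM; apply/ler_addgt0Pr => e e0; have [K hK] := ul e e0.
have := hK (maxn K K0) (leq_maxl _ _); have := uM (maxn K K0) (leq_maxr _ _).
have := nrm_le_dist l (u (maxn K K0)); rewrite nrm_distC; lra.
Qed.

Lemma climB (V : normedZmodType R[i]) (u v : nat -> V) l m :
  clim u l -> clim v m -> clim (fun k => u k - v k) (l - m).
Proof.
move=> ul vm e e0; have e2 : 0 < e / 2 by rewrite divr_gt0.
have [K1 h1] := ul _ e2; have [K2 h2] := vm _ e2.
exists (maxn K1 K2) => k; rewrite geq_max => /andP[k1 k2].
have -> : u k - v k - (l - m) = (u k - l) - (v k - m).
  by rewrite !opprD !opprK addrACA.
by rewrite (le_trans (nrmB _ _)) //; have := h1 k k1; have := h2 k k2; lra.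
Qed.

Lemma clim_cst (V : normedZmodType R[i]) (l : V) : clim (fun=> l) l.
Proof. by move=> e e0; exists 0%N => k _; rewrite subrr nrm0 ltW. Qed.

Lemma clim_uniq (V : normedZmodType R[i]) (u : nat -> V) l m : clim u l -> clim u m -> l = m.
Proof.
move=> ul um; apply/eqP; rewrite -subr_eq0 -nrm_eq0 eq_le nrm_ge0 andbT.
apply: (clim_le (climB ul um) (K0 := 0)) => k _; by rewrite subrr nrm0.
Qed.

Lemma clim_shift (V : normedZmodType R[i]) (u : nat -> V) l : clim u l -> clim (fun k => u k.+1) l.
Proof.
move=> ul e e0; have [K hK] := ul e e0; exists K => k kK.
by apply: hK; rewrite (leq_trans kK).
Qed.

Lemma climMl (u : nat -> R[i]) (l a : R[i]) : clim u l -> clim (fun k => a * u k) (a * l).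
Proof.
move=> ul e e0; have a1 : 0 < nrm a + 1 by rewrite ltr_wpDl // nrm_ge0.
have [K hK] := ul _ (divr_gt0 e0 a1); exists K => k kK.
rewrite -mulrBr nrmM; have := hK k kK; rewrite ler_pdivlMr //.
have := nrm_ge0 (u k - l); have := nrm_ge0 a; nra.
Qed.

Definition ccauchy (u : nat -> R[i]) : Prop := forall e : R, 0 < e ->
  exists K, forall j k, (K <= j)%N -> (K <= k)%N -> nrm (u j - u k) <= e.

Lemma clim_ccauchy u l : clim u l -> ccauchy u.
Proof.
move=> ul e e0; have [K hK] := ul _ (divr_gt0 e0 (ltr0n R 2)); exists K => j k Kj Kk.
have := hK j Kj; have := hK k Kk; have := nrmB (u j - l) (u k - l).
by rewrite opprB addrA subrK; lra.
Qed.

Lemma Re_le_nrm (z : R[i]) : `|complex.Re z| <= nrm z.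
Proof. by have := normc_ge_Re z; rewrite nrmE lecR. Qed.

Lemma Im_le_nrm (z : R[i]) : `|complex.Im z| <= nrm z.
Proof.
rewrite -ler_sqr ?nnegrE ?nrm_ge0 // real_normK ?num_real //.
by case: z => a b; rewrite nrm_sqr /= lerDr sqr_ge0.
Qed.

Lemma nrm_le_ReIm (z : R[i]) : nrm z <= `|complex.Re z| + `|complex.Im z|.
Proof.
rewrite -ler_sqr ?nnegrE ?nrm_ge0 ?addr_ge0 //.
case: z => a b; rewrite nrm_sqr /= sqrrD !real_normK ?num_real //.
by rewrite lerD2r lerDl mulrn_wge0 // mulr_ge0.
Qed.

Lemma ccauchy_clim u : ccauchy u -> exists l, clim u l.
Proof.
move=> cu.
have part (p : R[i] -> R) : (forall z w, p (z - w) = p z - p w) ->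
    (forall z, `|p z| <= nrm z) -> exists l, forall e, 0 < e ->
    exists K, forall k, (K <= k)%N -> `|p (u k) - l| <= e.
  move=> pB ple; have /cvg_ex [l hl] : cvg ((fun k => p (u k) : R^o) @ \oo).
    apply: cvg_of_cauchy => e e0; have [K hK] := cu _ (divr_gt0 e0 (ltr0n R 2)).
    exists K => m n Km Kn; rewrite -pB (le_lt_trans (ple _)) //.
    by rewrite (le_lt_trans (hK m n Km Kn)) // ltr_pdivrMr // ltr_pMr // ltr1n.
  exists l => e e0; move/cvgrPdist_le : hl => /(_ e e0) [K _ hK].
  by exists K => k Kk; rewrite distrC; apply: hK.
have [a ha] := part _ (raddfB (@complex.Re R : {additive _ -> _})) Re_le_nrm.
have [b hb] := part _ (raddfB (@complex.Im R : {additive _ -> _})) Im_le_nrm.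
exists (a +i* b)%C => e e0; have e2 := divr_gt0 e0 (ltr0n R 2).
have [K1 h1] := ha _ e2; have [K2 h2] := hb _ e2.
exists (maxn K1 K2) => k; rewrite geq_max => /andP[k1 k2].
rewrite (le_trans (nrm_le_ReIm _)) //.
have := h1 k k1; have := h2 k k2; case: (u k) => x y /=; lra.
Qed.

End Limits.

Section PowerSeries.
Context {R : realType}.
Implicit Types (c : nat -> R[i]) (w : R[i]).

Lemma geom_sum_le (q : R) n : 0 <= q < 1 -> \sum_(i < n) q ^+ i <= (1 - q)^-1.
Proof.
move=> /andP[q0 q1]; have q2 : 0 < 1 - q by rewrite subr_gt0.
have -> : \sum_(i < n) q ^+ i = (1 - q ^+ n) / (1 - q).
  apply: (mulIf (lt0r_neq0 q2)); rewrite divfK ?gt_eqF //.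
  by have := subrX1 q n; move: (\sum_(i < n) _) => S; lra.
by rewrite ger_pMl ?invr_gt0 // lerBlDr lerDl exprn_ge0.
Qed.

Lemma series_tail_le c w (rho A : R) L M : 0 < rho -> nrm w < rho ->
  (forall l, nrm (c l) * rho ^+ l <= A) -> (L <= M)%N ->
  nrm (\sum_(l < M) c l * w ^+ l - \sum_(l < L) c l * w ^+ l)
    <= A * (nrm w / rho) ^+ L / (1 - nrm w / rho).
Proof.
move=> rho0 wr cA /subnKC <-; rewrite big_split_ord /= addrAC subrr add0r.
set q := nrm w / rho.
have q01 : 0 <= q < 1 by rewrite divr_ge0 ?nrm_ge0 ?(ltW rho0) //= ltr_pdivrMr // mul1r.
have q0 : 0 <= q by case/andP: q01.
have A0 : 0 <= A by apply: le_trans (cA 0%N); rewrite mulr_ge0 ?nrm_ge0.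
rewrite (le_trans (nrm_sum _ _ _)) //.
apply: (@le_trans _ _ (\sum_(i < M - L) A * q ^+ L * q ^+ i)).
  apply: ler_sum => i _; rewrite -mulrA -exprD nrmM nrmX /q expr_div_n mulrA.
  rewrite ler_pdivlMr ?exprn_gt0 // mulrAC ler_wpM2r ?exprn_ge0 ?nrm_ge0 //.
rewrite -mulr_sumr ler_wpM2l ?mulr_ge0 ?exprn_ge0 // geom_sum_le //.
Qed.

(** The bounds on the coefficients, automatic for a convergent series, make its tails
    uniformly small on smaller discs. *)
Definition has_series f c (r : R) : Prop :=
  (forall rho, 0 < rho < r -> exists A, forall l, nrm (c l) * rho ^+ l <= A) /\
  forall w, nrm w < r -> clim (fun L => \sum_(l < L) c l * w ^+ l) (f w).

Lemma has_series_tail f c r w rho A L : has_series f c r -> 0 < rho < r ->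
  nrm w < rho -> (forall l, nrm (c l) * rho ^+ l <= A) ->
  nrm (f w - \sum_(l < L) c l * w ^+ l) <= A * (nrm w / rho) ^+ L / (1 - nrm w / rho).
Proof.
move=> [_ hs] /andP[rho0 rhor] wr cA.
have cl := climB (hs w (lt_trans wr rhor)) (clim_cst (\sum_(l < L) c l * w ^+ l)).
apply: (clim_le cl (K0 := L)) => M LM; exact: series_tail_le.
Qed.

Lemma series_lim c r :
  (forall rho, 0 < rho < r -> exists A, forall l, nrm (c l) * rho ^+ l <= A) ->
  exists g, has_series g c r.
Proof.
move=> bd.
have H w : exists l, nrm w < r -> clim (fun L => \sum_(l < L) c l * w ^+ l) l.
  have [wr|_] := ltP (nrm w) r; last by exists 0.
  pose rho := (nrm w + r) / 2.
  have wrho : nrm w < rho by rewrite /rho; lra.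
  have rho0 : 0 < rho by rewrite (le_lt_trans (nrm_ge0 w)).
  have [|A hA] := bd rho; first by rewrite rho0 /= /rho; lra.
  have A0 : 0 <= A by apply: le_trans (hA 0%N); rewrite mulr_ge0 ?nrm_ge0.
  set q := nrm w / rho.
  have q01 : 0 <= q < 1.
    by rewrite divr_ge0 ?nrm_ge0 ?(ltW rho0) //= ltr_pdivrMr // mul1r.
  have q1 : 0 < 1 - q by case/andP: q01; rewrite subr_gt0.
  suff /ccauchy_clim [l hl] : ccauchy (fun L => \sum_(l < L) c l * w ^+ l) by exists l.
  move=> e e0.
  have [K hK] : exists K, forall k, (K <= k)%N -> A * q ^+ k / (1 - q) <= e.
    have [K hK] := exists_expr_le q01 (divr_gt0 (mulr_gt0 e0 q1) (ltr_wpDl A0 ltr01)).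
    exists K => k kK; rewrite ler_pdivrMr //; have := hK k kK.
    rewrite ler_pdivlMr ?ltr_wpDl //; have : 0 <= q ^+ k by rewrite exprn_ge0 //; case/andP: q01.
    lra.
  exists K => j k; wlog jk : j k / (j <= k)%N => [S|] Kj Kk.
    have [/S|/ltnW/S] := leqP j k; first exact.
    by rewrite nrm_distC; apply.
  rewrite nrm_distC (le_trans (series_tail_le rho0 wrho hA jk)) //.
  exact: hK.
have [g hg] := choice H.
by exists g; split.
Qed.

Definition dcoef c l : R[i] := l.+1%:R * c l.+1.

Lemma expn_nat_le (s : R) l : 0 <= s < 1 -> l.+1%:R * s ^+ l <= (1 - s)^-1.
Proof.
move=> s01; have /andP[s0 s1] := s01.
rewrite (le_trans _ (geom_sum_le l.+1 s01)) //.
rewrite mulr_natl -[X in _ *+ X]card_ord -sumr_const; apply: ler_sum => i _.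
rewrite ler_wiXn2l // ?(ltW s1) //; exact: leq_ord.
Qed.

Lemma dcoef_bound c r :
  (forall rho, 0 < rho < r -> exists A, forall l, nrm (c l) * rho ^+ l <= A) ->
  (forall rho, 0 < rho < r -> exists A, forall l, nrm (dcoef c l) * rho ^+ l <= A).
Proof.
move=> bd rho /andP[rho0 rhor]; pose s := (rho + r) / 2.
have s0 : 0 < s by rewrite /s; lra.
have [|A hA] := bd s; first by rewrite s0 /= /s; lra.
have A0 : 0 <= A by apply: le_trans (hA 0%N); rewrite mulr_ge0 ?nrm_ge0.
have q01 : 0 <= rho / s < 1.
  by rewrite (divr_ge0 (ltW rho0) (ltW s0)) /= ltr_pdivrMr // mul1r /s; lra.
exists (A / s * (1 - rho / s)^-1) => l.
rewrite (le_trans _ (ler_wpM2l (divr_ge0 A0 (ltW s0)) (expn_nat_le l q01))) //.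
rewrite /dcoef nrmM nrm_nat.
have := hA l.+1; rewrite exprS => h.
have -> : A / s * (l.+1%:R * (rho / s) ^+ l) = A / (s * s ^+ l) * (l.+1%:R * rho ^+ l).
  rewrite expr_div_n; field; rewrite expf_neq0 ?gt_eqF //.
rewrite mulrAC mulrC ler_wpM2r ?mulr_ge0 ?exprn_ge0 ?(ltW rho0) //.
by rewrite ler_pdivlMr // mulr_gt0 // exprn_gt0.
Qed.

Lemma sum_sqr_geom (q : R) : 0 <= q < 1 -> exists S, forall L,
  \sum_(l < L) l%:R ^+ 2 * q ^+ l <= S.
Proof.
move=> /andP[q0 q1]; have p0 : 0 < 1 - q by rewrite subr_gt0.
exists (q * (1 + q) / (1 - q) ^+ 3) => L.
suff -> : \sum_(l < L) l%:R ^+ 2 * q ^+ l = q * (1 + q) / (1 - q) ^+ 3 -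
   q ^+ L * (L%:R ^+ 2 / (1 - q) + 2 * L%:R * q / (1 - q) ^+ 2 + q * (1 + q) / (1 - q) ^+ 3).
  rewrite lerBlDr lerDl mulr_ge0 ?exprn_ge0 //.
  have p1 n : 0 <= (1 - q) ^+ n by rewrite exprn_ge0 // ltW.
  apply: addr_ge0; first apply: addr_ge0; apply: divr_ge0; rewrite ?p1 ?(ltW p0) //.
  - by rewrite mulr_ge0 // mulr_ge0.
  - by rewrite mulr_ge0 // addr_ge0.
elim: L => [|L IH]; first by rewrite big_ord0 expr0; field; rewrite gt_eqF.
rewrite big_ord_recr /= IH -[L.+1%:R]natr1 [q ^+ L.+1]exprS.
by field; rewrite gt_eqF.
Qed.

(** The factor [s ^+ 2] avoids the exponent [l - 2]. *)
Lemma expr_taylor2 (w h : R[i]) (s : R) l : 0 < s -> nrm w <= s -> nrm (w + h) <= s ->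
  s ^+ 2 * nrm ((w + h) ^+ l - w ^+ l - l%:R * w ^+ l.-1 * h) <= l%:R ^+ 2 * s ^+ l * nrm h ^+ 2.
Proof.
move=> s0 ws whs; elim: l => [|l IH].
  by rewrite !expr0 subrr !mul0r subr0 nrm0 mulr0 expr0n /= !mul0r.
have E : (w + h) ^+ l.+1 - w ^+ l.+1 - l.+1%:R * w ^+ l * h =
   (w + h) * ((w + h) ^+ l - w ^+ l - l%:R * w ^+ l.-1 * h) + l%:R * w ^+ l.-1 * h ^+ 2.
  by case: l {IH} => [|l] /=; rewrite ?exprS -?natr1; ring.
rewrite E; set D := _ - _ - _ in IH *.
have h2 : s ^+ 2 * nrm (l%:R * w ^+ l.-1 * h ^+ 2) <= l%:R * s ^+ l.+1 * nrm h ^+ 2.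
  rewrite 2!nrmM 2!nrmX nrm_nat; case: l {IH E D} => [|l] /=.
    by rewrite !mul0r mulr0.
  have -> : s ^+ 2 * (l.+1%:R * nrm w ^+ l * nrm h ^+ 2) =
    l.+1%:R * (s ^+ 2 * nrm w ^+ l) * nrm h ^+ 2 by ring.
  rewrite ler_wpM2r ?sqr_ge0 // ler_wpM2l //.
  rewrite [s ^+ l.+2](_ : _ = s ^+ 2 * s ^+ l); last by rewrite -exprD.
  by rewrite ler_wpM2l ?sqr_ge0 // lerXn2r ?nnegrE ?nrm_ge0 // ltW.
have h1 : s ^+ 2 * nrm ((w + h) * D) <= l%:R ^+ 2 * s ^+ l.+1 * nrm h ^+ 2.
  rewrite nrmM mulrCA [s ^+ l.+1]exprS.
  have -> : l%:R ^+ 2 * (s * s ^+ l) * nrm h ^+ 2 = s * (l%:R ^+ 2 * s ^+ l * nrm h ^+ 2) by ring.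
  rewrite ler_pM ?nrm_ge0 // mulr_ge0 ?sqr_ge0 ?nrm_ge0 //.
rewrite (le_trans (ler_wpM2l (sqr_ge0 s) (nrmD _ _))) // mulrDr (le_trans (lerD h1 h2)) //.
rewrite -!mulrDl ler_wpM2r ?sqr_ge0 // ler_wpM2r ?exprn_ge0 ?(ltW s0) //.
rewrite -natr1; have := ler0n R l; nra.
Qed.

(** Each monomial is differentiable with a second order error, and by [sum_sqr_geom] the
    errors are summable. *)
Lemma has_series_derivable f g c r w : has_series f c r -> has_series g (dcoef c) r ->
  nrm w < r -> cderivable f w (g w).
Proof.
move=> hf hg wr; pose s := (nrm w + r) / 2; pose rho := (s + r) / 2.
have ws : nrm w < s by rewrite /s; lra.
have sr : s < r by rewrite /s; lra.
have s0 : 0 < s := le_lt_trans (nrm_ge0 w) ws.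
have rho0 : 0 < rho by rewrite /rho; lra.
have [|A hA] := hf.1 rho; first by rewrite rho0 /= /rho; lra.
have q01 : 0 <= s / rho < 1.
  by rewrite (divr_ge0 (ltW s0) (ltW rho0)) /= ltr_pdivrMr // mul1r /rho; lra.
have [S hS] := sum_sqr_geom q01.
have A0 : 0 <= A by apply: le_trans (hA 0%N); rewrite mulr_ge0 ?nrm_ge0.
have S0 : 0 <= S by have := hS 0%N; rewrite big_ord0.
pose K := A * S / s ^+ 2.
have K0 : 0 <= K := divr_ge0 (mulr_ge0 A0 S0) (sqr_ge0 s).
have quad_err h : nrm (w + h) <= s -> nrm (f (w + h) - f w - h * g w) <= K * nrm h ^+ 2.
  move=> whs.
  have cl := climB (climB (clim_shift (hf.2 (w + h) (le_lt_trans whs sr)))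
    (clim_shift (hf.2 w wr))) (climMl h (hg.2 w wr)).
  apply: (clim_le cl (K0 := 0)) => L _.
  have -> : h * \sum_(l < L) dcoef c l * w ^+ l =
      \sum_(l < L.+1) c l * (l%:R * w ^+ l.-1 * h).
    rewrite big_ord_recl /= !mul0r mulr0 add0r mulr_sumr; apply: eq_bigr => l _.
    by rewrite /dcoef /bump /= add1n; ring.
  rewrite -!sumrB (le_trans (nrm_sum _ _ _)) //.
  apply: (@le_trans _ _ (\sum_(l < L.+1) A / s ^+ 2 * nrm h ^+ 2 * (l%:R ^+ 2 * (s / rho) ^+ l))).
    apply: ler_sum => l _; rewrite -!mulrBr nrmM.
    have := expr_taylor2 l s0 (ltW ws) whs; move: (nrm (_ - _ - _)) => x hx.
    have xle : x <= l%:R ^+ 2 * s ^+ l * nrm h ^+ 2 / s ^+ 2.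
      by rewrite ler_pdivlMr ?exprn_gt0 // mulrC.
    rewrite (le_trans (ler_wpM2l (nrm_ge0 _) xle)) //.
    have cl' : nrm (c l) <= A / rho ^+ l by rewrite ler_pdivlMr ?exprn_gt0.
    have -> : A / s ^+ 2 * nrm h ^+ 2 * (l%:R ^+ 2 * (s / rho) ^+ l) =
      A / rho ^+ l * (l%:R ^+ 2 * s ^+ l * nrm h ^+ 2 / s ^+ 2).
      rewrite [(s / rho) ^+ l]expr_div_n.
      move: (s ^+ l) (rho ^+ l) (expf_neq0 l (lt0r_neq0 rho0)) => a b b0.
      by field; rewrite b0 gt_eqF.
    rewrite ler_wpM2r // divr_ge0 ?sqr_ge0 // mulr_ge0 ?sqr_ge0 //.
    by rewrite mulr_ge0 ?sqr_ge0 // exprn_ge0 // ltW.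
  rewrite -mulr_sumr.
  have -> : K * nrm h ^+ 2 = A / s ^+ 2 * nrm h ^+ 2 * S by rewrite /K; ring.
  by rewrite ler_wpM2l // mulr_ge0 ?sqr_ge0 // divr_ge0 ?sqr_ge0.
move=> e e0; have K1 : 0 < K + 1 by rewrite ltr_wpDl.
exists (Num.min (s - nrm w) (e / (K + 1))).
  by rewrite lt_min subr_gt0 ws divr_gt0.
move=> z; rewrite lt_min => /andP[z1 z2]; set h := z - w in z1 z2 *.
have zE : z = w + h by rewrite /h addrC subrK.
rewrite zE mulrC (le_trans (quad_err h _)) //.
  by have := nrmD w h; lra.
rewrite expr2 mulrA ler_wpM2r ?nrm_ge0 //.
move: z2; rewrite ltr_pdivlMr //; have := nrm_ge0 h; nra.
Qed.

Lemma cderivable_cderive f w d : cderivable f w d -> cderive f w = d.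
Proof.
move=> hd; rewrite /cderive /derive1; apply: (@cvg_lim R[i]^o).
  exact: norm_hausdorff.
apply/cvgrPdist_le => e e0.
have eE : e = (complex.Re e)%:C%C by rewrite RRe_real // gtr0_real.
have e0' : 0 < complex.Re e by rewrite -ltcR -eE.
have [del del0 hdel] := hd _ e0'.
have delC : 0 < del%:C%C :> R[i] by rewrite ltcR.
near=> h.
have h0 : h != 0 by near: h; exact: nbhs_dnbhs_neq.
have hlt : nrm h < del.
  rewrite -ltcR -nrmE; near: h; exact: dnbhs0_lt.
have := hdel (h + w); rewrite addrK => /(_ hlt) H.
rewrite nrmE eE lecR -(ler_pM2r (_ : 0 < nrm h)) ?nrm_gt0 //.
apply: le_trans H; rewrite -nrmM le_eqVlt; apply/orP; left; apply/eqP.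
rewrite -nrmN; congr nrm; rewrite /GRing.scale /=; field; exact: h0.
Unshelve. all: by end_near.
Qed.

Lemma has_series_cderive f c r : has_series f c r -> has_series (cderive f) (dcoef c) r.
Proof.
move=> hf; have bd := dcoef_bound hf.1; have [g hg] := series_lim bd.
split=> // w wr; rewrite (cderivable_cderive (has_series_derivable hf hg wr)).
exact: hg.2.
Qed.

Lemma has_series_taylor f c r : 0 < r -> has_series f c r -> forall k, taylor_coef f k = c k.
Proof.
move=> r0 hf k.
have at0 g d : has_series g d r -> g 0 = d 0%N.
  move=> hg; apply: (clim_uniq (clim_shift (hg.2 0 _))); first by rewrite nrm0.
  move=> e e0; exists 0%N => L _; rewrite big_ord_recl expr0 mulr1 big1 ?addr0.
    by rewrite subrr nrm0 ltW.
  by move=> l _; rewrite expr0n mulr0.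
suff [H E] : has_series (iter k cderive f) (iter k dcoef c) r /\
    forall l, iter k dcoef c l = ((l + k) ^_ k)%:R * c (l + k)%N.
  rewrite /taylor_coef (at0 _ _ H) E add0n ffactnn mulrAC divff ?mul1r //.
split; first by elim: k => [//|k IH]; apply: has_series_cderive.
elim: k => [|k IH] l; first by rewrite addn0 ffactn0 mul1r.
rewrite iterS /dcoef IH addSnnS mulrA -natrM; congr (_%:R * _).
by rewrite [RHS]ffactnSr -addSnnS addnK mulnC.
Qed.

End PowerSeries.

(** * Holomorphic functions are power series *)
Section Analytic.
Context {R : realType}.

Lemma climD (V : normedZmodType R[i]) (u v : nat -> V) l m :
  clim u l -> clim v m -> clim (fun k => u k + v k) (l + m).
Proof.
move=> ul vm; have := climB ul (climB (clim_cst 0) vm); rewrite sub0r opprK.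
by move=> H e /H[K hK]; exists K => k /hK; rewrite sub0r opprK.
Qed.

Lemma clim_sum (u : nat -> nat -> R[i]) (c a : nat -> R[i]) n :
  (forall l, (l < n)%N -> clim (u l) (c l)) ->
  clim (fun k => \sum_(l < n) u l k * a l) (\sum_(l < n) c l * a l).
Proof.
elim: n => [|n IH] h.
  by move=> e e0; exists 0%N => k _; rewrite !big_ord0 subrr nrm0 ltW.
have H := climD (IH (fun l ln => h l (ltnW ln))) (climMl (a n) (h n (leqnn _))).
move=> e /H[K hK]; exists K => k /hK.
by rewrite !big_ord_recr /= ![_ * a n]mulrC.
Qed.

Variables (f : R[i] -> R[i]) (B : R).
Hypothesis hf : forall z, nrm z < 1 -> exists d, cderivable f z d.
Hypothesis fB : forall z, nrm z < 1 -> nrm (f z) <= B.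

Section Radius.
Variable r : R.
Hypothesis r01 : 0 < r < 1.

Let r0 : 0 < r. Proof. by case/andP: r01. Qed.
Let r1 : r < 1. Proof. by case/andP: r01. Qed.
Let B0 : 0 <= B. Proof. by apply: le_trans (nrm_ge0 _) (fB (z := 0) _); rewrite nrm0. Qed.

Let u l k : R[i] := ccoef f r (2 ^ k) l.

Let u_le l k : nrm (u l k) * r ^+ l <= B.
Proof.
have M0 : 0 < (2 ^ k)%:R :> R by rewrite ltr0n expn_gt0.
have rl0 : 0 < r ^+ l by rewrite exprn_gt0.
have zn j : nrm (r%:C%C * om (2 ^ k) ^+ j) = r.
  by rewrite nrmM nrm_omX mulr1 nrm_real gtr0_norm.
rewrite -ler_pdivlMr // /u /ccoef nrmM nrmV nrm_nat mulrC ler_pdivrMr //.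
rewrite (le_trans (nrm_sum _ _ _)) //.
apply: (@le_trans _ _ (\sum_(j < 2 ^ k) B / r ^+ l)).
  apply: ler_sum => j _; rewrite nrmM nrmV nrmX zn ler_wpM2r ?invr_ge0 ?(ltW rl0) //.
  by apply: fB; rewrite zn.
by rewrite sumr_const card_ord mulr_natr.
Qed.

Let u_series w : nrm w < r -> clim (fun k => \sum_(l < 2 ^ k) u l k * w ^+ l) (f w).
Proof. by move=> wr; exact: cauchy_series. Qed.

Let u_tail w l k : nrm w < r -> (l <= k)%N ->
  nrm (\sum_(j < 2 ^ k) u j k * w ^+ j - \sum_(j < l) u j k * w ^+ j)
    <= B * (nrm w / r) ^+ l / (1 - nrm w / r).
Proof.
move=> wr lk; apply: (@series_tail_le _ (fun j => u j k)) => //.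
by rewrite (leq_trans lk) // ltnW // ltn_expl.
Qed.

(** Once the lower coefficients converge, the polynomial without its terms below [l],
    divided by [w ^+ l], converges for every [w] in the disc and differs from the [l]-th
    coefficient by [O(w)], uniformly in [k]; so this coefficient is a Cauchy sequence. *)
Let u_cvg l : exists c, clim (u l) c.
Proof.
elim/ltn_ind: l => l IH.
have {IH} [c hc] : exists c, forall j, (j < l)%N -> clim (u j) (c j).
  have H j : exists c, (j < l)%N -> clim (u j) c.
    by have [/IH[c hc]|_] := ltnP j l; [exists c | exists 0].
  by have [c hc] := choice H; exists c.
apply: ccauchy_clim => e e0.
have rp := r0; have Bp := B0.
have rl0 : 0 < r ^+ l by rewrite exprn_gt0.
have B1 : 0 < 8 * (B + 1) by rewrite mulr_gt0 // ltr_wpDl.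
pose q := Num.min (1 / 2) (e * r ^+ l / (8 * (B + 1))).
have q0 : 0 < q by rewrite lt_min !divr_gt0 // mulr_gt0.
have [q1 q2] : q <= 1 / 2 /\ q <= e * r ^+ l / (8 * (B + 1)).
  by rewrite /q !ge_min !lexx orbT.
pose w : R[i] := (q * r)%:C%C.
have nw : nrm w = q * r by rewrite nrm_real gtr0_norm // mulr_gt0.
have wr : nrm w < r by rewrite nw; nra.
have nwr : nrm w / r = q by rewrite nw mulfK // gt_eqF.
have ql0 : 0 < q ^+ l by rewrite exprn_gt0.
have wl0 : 0 < nrm w ^+ l by rewrite nw exprMn mulr_gt0.
have cD := climB (u_series wr) (@clim_sum u c (fun j => w ^+ j) l hc).
have [K hK] := clim_ccauchy cD (divr_gt0 (mulr_gt0 e0 wl0) (ltr0n R 2)).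
exists (maxn K l.+1) => j k; rewrite !geq_max => /andP[Kj lj] /andP[Kk lk].
have := hK j k Kj Kk.
have tj := u_tail wr lj; have tk := u_tail wr lk.
rewrite nwr !big_ord_recr /= in tj tk.
set Dj := \sum_(i < 2 ^ j) _ - _; set Dk := \sum_(i < 2 ^ k) _ - _ => hD.
rewrite opprD addrA -/Dj in tj; rewrite opprD addrA -/Dk in tk.
have tq : B * q ^+ l.+1 / (1 - q) <= 2 * B * q * q ^+ l.
  rewrite ler_pdivrMr; last by lra.
  have : 0 <= B * q * q ^+ l by rewrite !mulr_ge0 // ltW.
  rewrite exprS; nra.
have E : (u l j - u l k) * w ^+ l = (Dj - Dk) - ((Dj - u l j * w ^+ l) - (Dk - u l k * w ^+ l)).
  by ring.
have : nrm (u l j - u l k) * nrm w ^+ l <= e * nrm w ^+ l / 2 + 4 * B * q * q ^+ l.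
  rewrite -nrmX -nrmM E (le_trans (nrmB _ _)) //.
  have := nrmB (Dj - u l j * w ^+ l) (Dk - u l k * w ^+ l).
  rewrite nrmX; lra.
move=> H.
have F : 4 * B * q * q ^+ l <= e * nrm w ^+ l / 2.
  rewrite nw exprMn.
  have h1 : 8 * B * q <= e * r ^+ l.
    move: q2; rewrite ler_pdivlMr // => q2; nra.
  have -> : 4 * B * q * q ^+ l = (8 * B * q) * q ^+ l / 2 by field.
  have -> : e * (q ^+ l * r ^+ l) / 2 = e * r ^+ l * q ^+ l / 2 by ring.
  by rewrite ler_pM2r // ler_pM2r.
rewrite -(ler_pM2r wl0); lra.
Qed.

Lemma holomorphic_series : exists c, has_series f c r.
Proof.
have [c hc] := choice u_cvg.
have cB l : nrm (c l) * r ^+ l <= B.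
  rewrite -ler_pdivlMr ?exprn_gt0 //; apply: (clim_le (hc l) (K0 := 0)) => k _.
  by rewrite ler_pdivlMr ?exprn_gt0.
exists c; split => [rho /andP[rho0 rhor]|w wr].
  exists B => l; rewrite (le_trans _ (cB l)) // ler_wpM2l ?nrm_ge0 //.
  by rewrite lerXn2r ?nnegrE ?ltW.
move=> e e0; set q := nrm w / r.
have q01 : 0 <= q < 1 by rewrite divr_ge0 ?nrm_ge0 ?(ltW r0) //= ltr_pdivrMr // mul1r.
have q1 : 0 < 1 - q by case/andP: q01; rewrite subr_gt0.
have [K hK] := exists_expr_le q01 (divr_gt0 (mulr_gt0 e0 q1) (ltr_wpDl B0 ltr01)).
exists K => L KL; rewrite nrm_distC.
have cD := climB (u_series wr) (@clim_sum u c (fun j => w ^+ j) L (fun l _ => hc l)).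
apply: (clim_le cD (K0 := L)) => k Lk.
rewrite (le_trans (u_tail wr Lk)) // ler_pdivrMr // -/q.
have := hK L KL; rewrite ler_pdivlMr ?ltr_wpDl //.
have : 0 <= q ^+ L by rewrite exprn_ge0 //; case/andP: q01.
lra.
Qed.

End Radius.

(** On each smaller disc the coefficients of the series are the Taylor coefficients, hence
    do not depend on the disc. *)
Theorem holomorphic_taylor : has_series f (taylor_coef f) 1.
Proof.
have H r : 0 < r < 1 -> has_series f (taylor_coef f) r.
  move=> r01; have [c hc] := holomorphic_series r01.
  suff -> : taylor_coef f = c by [].
  by apply/funext => k; case/andP: r01 => r0 _; exact: (has_series_taylor r0 hc).
split=> [rho /andP[rho0 rho1]|w w1].
  by apply: (H ((rho + 1) / 2) _).1; rewrite ?rho0 /=; [apply/andP; split|]; lra.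
apply: (H ((nrm w + 1) / 2) _).2; last by lra.
by have := nrm_ge0 w; move=> ?; apply/andP; split; lra.
Qed.

End Analytic.

(** * From the integral norm to the dyadic norm *)
Section Polar.
Context {R : realType}.

Lemma polar (z : R[i]) (r : R) : 0 < r -> nrm z = r ->
  exists a, z = (r * cos a +i* (r * sin a))%C.
Proof.
move=> r0 zr; case: z zr => x y zr.
have E : x ^+ 2 + y ^+ 2 = r ^+ 2 by rewrite -nrm_sqr zr.
have xr : -1 <= x / r <= 1.
  rewrite -ler_norml -(@ler_sqr R) ?nnegrE // expr1n real_normK ?num_real //.
  rewrite expr_div_n ler_pdivrMr ?exprn_gt0 // mul1r -E lerDl sqr_ge0 //.
have sq : Num.sqrt (1 - (x / r) ^+ 2) = `|y| / r.
  have -> : 1 - (x / r) ^+ 2 = (`|y| / r) ^+ 2.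
    rewrite !expr_div_n real_normK ?num_real // (_ : y ^+ 2 = r ^+ 2 - x ^+ 2).
      by field; rewrite gt_eqF.
    by rewrite -E; ring.
  by rewrite sqrtr_sqr ger0_norm // divr_ge0 // ltW.
have cE : r * (x / r) = x by rewrite mulrCA divff ?mulr1 // gt_eqF.
have sE : r * (`|y| / r) = `|y| by rewrite mulrCA divff ?mulr1 // gt_eqF.
have [y0|y0] := leP 0 y.
  exists (acos (x / r)); rewrite acosK ?in_itv //= sin_acos // sq cE sE.
  by rewrite ger0_norm.
exists (- acos (x / r)); rewrite cosN sinN acosK ?in_itv //= sin_acos // sq cE.
by rewrite mulrN sE ltr0_norm // opprK.
Qed.

Lemma derivable_cderivable (f : R[i] -> R[i]) (z : R[i]) :
  derivable (f : R[i]^o -> R[i]^o) z 1 -> exists d, cderivable f z d.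
Proof.
move=> /cvg_ex [d hd]; exists d => e e0.
move/cvgrPdist_le: hd => /(_ e%:C%C); rewrite ltcR => /(_ e0) H.
have [del del0 hdel] : exists2 del : R[i], 0 < del & forall h, `|h| < del -> h != 0 ->
    `|d - h^-1 *: ((f \o shift z) (h *: 1) - f z)| <= e%:C%C.
  move: H; rewrite /dnbhs /within /= => /nbhs_normP [del del0 hdel].
  exists del => // h hlt h0; apply: hdel => //=.
  by rewrite /ball_ /= sub0r normrN.
have delE : del = (complex.Re del)%:C%C by rewrite RRe_real // gtr0_real.
exists (complex.Re del); first by rewrite -ltcR -delE.
move=> z' zz'; have [->|ne] := eqVneq z' z.
  by rewrite !subrr mulr0 subrr nrm0 mulr0.
have h0 : z' - z != 0 by rewrite subr_eq0.
have := hdel (z' - z); rewrite nrmE delE ltcR => /(_ zz' h0).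
rewrite /= /GRing.scale /= mulr1 subrK nrmE lecR => H1.
have -> : f z' - f z - d * (z' - z) = - ((d - (z' - z)^-1 * (f z' - f z)) * (z' - z)).
  by field; exact: h0.
by rewrite nrmN nrmM ler_wpM2r ?nrm_ge0.
Qed.

End Polar.

Section LowerSum.
Import HBNNSimple.
Context {R : realType}.
Local Notation mu := (@lebesgue_measure R).
Local Open Scope ereal_scope.

(** The integral of a nonnegative function is the supremum of the integrals of the simple
    functions below it, whether or not the function is measurable, and a step function is
    simple. *)
Lemma step_le_integral (A : nat -> set R) (c : nat -> R) N (D : set R)
  (g : R -> \bar R) : (forall i, measurable (A i)) -> (forall i, (0 <= c i)%R) ->
  (forall i j x, A i x -> A j x -> i = j) ->
  (forall i x, (i < N)%N -> A i x -> D x /\ (c i)%:E <= g x) ->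
  (forall x, D x -> 0 <= g x) ->
  \sum_(i < N) (c i)%:E * mu (A i) <= \int[mu]_(x in D) g x.
Proof.
move=> mA c0 dA cg g0.
pose T := g_sigma_algebraType (R.-ocitv.-measurable).
have mA' i : measurable (A i : set T) by exact: mA.
pose h i : {nnsfun T >-> R} := scale_nnsfun (indic_nnsfun R (mA' i)) (c0 i).
pose hs := fix hs k : {nnsfun T >-> R} :=
  if k is k'.+1 then add_nnsfun (hs k') (h k') else @nnsfun0 _ T R.
have hsE k x : hs k x = (\sum_(i < k) h i x)%R.
  elim: k => [|k IH]; first by rewrite big_ord0.
  by rewrite big_ord_recr /= -IH.
rewrite ge0_integralE //.
apply: ereal_sup_ubound; exists (hs N) => /=.
  move=> x; rewrite hsE.
  have [[i iN Ax]|nA] := pselect (exists2 i, (i < N)%N & A i x).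
    have [Dx cgx] := cg i x iN Ax.
    rewrite patchE mem_set // (bigD1 (Ordinal iN)) //= big1 ?addr0 => [|j ji].
      by rewrite /measurable_realfun.mindic indicE mem_set // mulr1.
    rewrite /measurable_realfun.mindic indicE memNset ?mulr0 // => Ajx.
    by move: ji; rewrite -val_eqE /= (dA _ _ _ Ajx Ax) eqxx.
  rewrite big1 => [|j _].
    by rewrite patchE; case: ifPn => // /set_mem /g0.
  by rewrite /= /measurable_realfun.mindic indicE memNset ?mulr0 // => Ajx; apply: nA; exists j.
elim: N {cg} => [|N IH]; first by rewrite big_ord0 sintegral0.
rewrite big_ord_recr -IH (eq_sintegral (hs N \+ h N)%R) // sintegralD; congr (_ + _).
rewrite (eq_sintegral (cst (c N) \* indic_nnsfun R (mA' N))%R) // sintegralrM.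
by congr (_ * _); exact: (sintegral_indic mu (A N)).
Qed.

End LowerSum.

Section Triangle.
Context {R : realType}.
Variable n : nat.
Local Notation m := (2 ^ n)%N.
Let tri k : R := triangle n.+1 k%:R.

Lemma triangleE k : tri k = if (m <= k <= 2 * m)%N then (k%:R - m%:R) / m%:R
  else if (2 * m <= k <= 4 * m)%N then ((4 * m)%:R - k%:R) / (2 * m)%:R else 0.
Proof.
rewrite /tri /triangle /=.
have E0 : (2 : R) ^+ n = m%:R by rewrite -natrX.
have E1 : (2 : R) ^+ n.+1 = (2 * m)%:R by rewrite -natrX expnS.
have E2 : (2 : R) ^+ n.+2 = (4 * m)%:R by rewrite -natrX !expnS mulnA.
by rewrite E0 E1 E2 !ler_nat.
Qed.

Let m0 : (0 < m)%N. Proof. by rewrite expn_gt0. Qed.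
Let mR : 0 < m%:R :> R. Proof. by rewrite ltr0n. Qed.

Lemma triangle_low k : (k <= m)%N -> tri k = 0.
Proof.
move=> km; rewrite triangleE.
have [mk|mk] := leqP m k; last first.
  by rewrite /= (leqNgt (2 * m)) (leq_trans mk) // leq_pmull.
have -> : k = m by apply/eqP; rewrite eqn_leq km.
by rewrite leq_pmull // subrr mul0r.
Qed.

Lemma triangle_high k : (4 * m <= k)%N -> tri k = 0.
Proof.
move=> mk; rewrite triangleE.
have -> : (k <= 2 * m)%N = false.
  by apply/negbTE; rewrite -ltnNge (leq_trans _ mk) // ltn_pmul2r.
rewrite andbF; case: ifP => // /andP[_ km].
by rewrite (_ : k = 4 * m)%N ?subrr ?mul0r //; apply/eqP; rewrite eqn_leq km.
Qed.

Lemma triangle_bounds k : 0 <= tri k <= 1.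
Proof.
rewrite triangleE; case: ifP => [/andP[h1 h2]|_].
  rewrite divr_ge0 ?subr_ge0 ?ler_nat //= ler_pdivrMr // mul1r lerBlDr -natrD ler_nat.
  by rewrite addnn -mul2n.
case: ifP => [/andP[h1 h2]|_]; last by rewrite lexx ler01.
rewrite divr_ge0 ?subr_ge0 ?ler_nat //= ler_pdivrMr ?ltr0n ?muln_gt0 // mul1r.
by rewrite lerBlDr -natrD ler_nat (leq_trans _ (leq_add (leqnn _) h1)) // -mulnDl.
Qed.

Lemma triangle_step k : `|tri k.+1 - tri k| <= m%:R^-1.
Proof.
have mi : 0 <= m%:R^-1 :> R by rewrite invr_ge0.
have S1 (x y : R) : y - x = 1 -> `|y / m%:R - x / m%:R| <= m%:R^-1.
  by move=> e; rewrite -mulrBl e mul1r ger0_norm.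
have S2 (x y : R) : x - y = 1 -> `|y / (2 * m)%:R - x / (2 * m)%:R| <= m%:R^-1.
  move=> e; rewrite distrC -mulrBl e mul1r ger0_norm ?invr_ge0 //.
  by rewrite lef_pV2 ?posrE ?ltr0n ?muln_gt0 // ler_nat leq_pmull.
have [k1|k1] := ltnP k m; first by rewrite !triangle_low ?(ltnW k1) // subrr normr0.
have [k4|k4] := leqP (4 * m) k; first by rewrite !triangle_high ?(leqW k4) // subrr normr0.
have [k2|k2] := ltnP k (2 * m).
  rewrite (triangleE k.+1) (triangleE k) (leqW k1) k1 k2 (ltnW k2) /=.
  by apply: S1; rewrite -natr1; ring.
have E j : (2 * m <= j)%N -> (j <= 4 * m)%N -> tri j = ((4 * m)%:R - j%:R) / (2 * m)%:R.
  move=> h1 h2; rewrite triangleE h1 h2 /=; case: ifP => // /andP[_ h3].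
  have -> : j = (2 * m)%N by apply/eqP; rewrite eqn_leq h1 h3.
  by rewrite !natrM; field; rewrite gt_eqF.
rewrite !E ?(leqW k2) ?(ltnW k4) //; apply: S2; rewrite -natr1; ring.
Qed.

(** Bounds for the multiplier that turns the coefficients of [z f'(z)] on a circle of
    radius [r] into those of [W_(n+1) * f] on the circle of radius [x * r]. It gains [1 /
    m] from the division by [k], and [x ^+ k] stays below 2 because [x] is at most [1 / r]
    and [k] at most [4 * m]. *)
Lemma integrating_multiplier (x r : R) (mul := fun k => tri k / k%:R * x ^+ k) :
  1 - (8 * m%:R)^-1 <= r -> r < 1 -> 0 <= x -> x * r <= 1 ->
  (forall k, 0 <= mul k <= 20 / m%:R) /\
  (forall k, `|mul k.+1 - mul k| <= 20 / m%:R / (4 * m)%:R).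
Proof.
move=> rm r1 x0 xr.
have m1 : 1 <= m%:R :> R by rewrite ler1n.
have mi0 : 0 < m%:R^-1 :> R by rewrite invr_gt0.
have mi1 : m%:R^-1 <= 1 :> R by rewrite invf_le1.
have rm' : 1 - m%:R^-1 / 8 <= r by rewrite (_ : m%:R^-1 / 8 = (8 * m%:R)^-1) // invfM mulrC.
have r0 : 0 < r by lra.
have xX k : (k <= 4 * m)%N -> x ^+ k <= 2.
  move=> km; have r12 : 2^-1 <= r ^+ k.
    have bern j : 1 - j%:R * (m%:R^-1 / 8) <= r ^+ j.
      elim: j => [|j IH]; first by rewrite mul0r subr0 expr0.
      have rj : r ^+ j.+1 >= (1 - m%:R^-1 / 8) * r ^+ j.
        by rewrite exprS ler_wpM2r // exprn_ge0 // ltW.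
      rewrite (le_trans _ rj) // -natr1.
      have : r ^+ j <= 1 by rewrite exprn_ile1 // ltW.
      nra.
    apply: le_trans (bern k).
    have : k%:R <= (4 * m)%:R :> R by rewrite ler_nat.
    rewrite natrM => h.
    have : k%:R * m%:R^-1 <= 4 :> R by rewrite ler_pdivrMr.
    lra.
  have : x ^+ k * r ^+ k <= 1 by rewrite -exprMn exprn_ile1 // mulr_ge0 // ltW.
  have : 0 <= x ^+ k by rewrite exprn_ge0.
  nra.
have base k : 0 <= mul k <= 2 / m%:R.
  have xk0 : 0 <= x ^+ k by rewrite exprn_ge0.
  have [kl|kl] := leqP k m.
    by rewrite /mul triangle_low // !mul0r lexx divr_ge0.
  have [kh|kh] := leqP (4 * m) k.
    by rewrite /mul triangle_high // !mul0r lexx divr_ge0.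
  have /andP[t0 t1] := triangle_bounds k.
  have k0 : 0 < k%:R :> R by rewrite ltr0n (leq_trans m0) // ltnW.
  have tk0 : 0 <= tri k / k%:R by rewrite divr_ge0 // ltW.
  have tk1 : tri k / k%:R <= m%:R^-1.
    rewrite ler_pdivrMr // (le_trans t1) // mulrC ler_pdivlMr // mul1r ler_nat ltnW //.
  have := xX k (ltnW kh); rewrite /mul => x2.
  by rewrite mulr_ge0 //=; nra.
split=> k.
  have /andP[-> h] := base k; rewrite (le_trans h) // ler_wpM2r ?(ltW mi0) //.
  by rewrite ler_nat.
have -> : 20 / m%:R / (4 * m)%:R = 5 * m%:R^-1 ^+ 2 :> R.
  by rewrite natrM; field; rewrite gt_eqF.
have sq0 : 0 <= 5 * m%:R^-1 ^+ 2 :> R by rewrite mulr_ge0 // sqr_ge0.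
have [kl|kl] := ltnP k m.
  by rewrite /mul !triangle_low ?(ltnW kl) // !mul0r subrr normr0.
have [kh|kh] := leqP (4 * m) k.
  by rewrite /mul !triangle_high ?(leqW kh) // !mul0r subrr normr0.
have k0 : 0 < k%:R :> R by rewrite ltr0n (leq_trans m0).
have k10 : 0 < k.+1%:R :> R by rewrite ltr0n.
have km : k%:R^-1 <= m%:R^-1 :> R by rewrite lef_pV2 ?posrE // ler_nat.
have ki0 : 0 < k%:R^-1 :> R by rewrite invr_gt0.
have k1m : k.+1%:R^-1 <= m%:R^-1 :> R by rewrite lef_pV2 ?posrE // ler_nat leqW.
have k1i0 : 0 < k.+1%:R^-1 :> R by rewrite invr_gt0.
have /andP[t0 t1] := triangle_bounds k.
have dt : `|tri k.+1 / k.+1%:R - tri k / k%:R| <= 2 * m%:R^-1 ^+ 2.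
  have -> : tri k.+1 / k.+1%:R - tri k / k%:R =
     (tri k.+1 - tri k) * k.+1%:R^-1 - tri k * (k%:R^-1 * k.+1%:R^-1).
    by rewrite -natr1; field; rewrite !gt_eqF // ltr_wpDr.
  have h1 : `|(tri k.+1 - tri k) * k.+1%:R^-1| <= m%:R^-1 ^+ 2.
    by rewrite normrM expr2 [`|_^-1|]gtr0_norm // ler_pM ?triangle_step // ltW.
  have h2 : `|tri k * (k%:R^-1 * k.+1%:R^-1)| <= m%:R^-1 ^+ 2.
    rewrite ger0_norm; last by rewrite !mulr_ge0 // ltW.
    have : k%:R^-1 * k.+1%:R^-1 <= m%:R^-1 ^+ 2 :> R by rewrite expr2 ler_pM // ltW.
    have : 0 <= k%:R^-1 * k.+1%:R^-1 :> R by rewrite mulr_ge0 // ltW.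
    by move=> p0 ple; apply: le_trans ple; exact: ler_piMl.
  by rewrite (le_trans (ler_normB _ _)) //; lra.
have dx : tri k / k%:R * (x ^+ k * `|x - 1|) <= m%:R^-1 ^+ 2.
  have tk0 : 0 <= tri k / k%:R by rewrite divr_ge0 // ltW.
  have tk1 : tri k / k%:R <= m%:R^-1.
    by rewrite (le_trans _ km) // ler_piMl // ltW.
  have xk0 : 0 <= x ^+ k by rewrite exprn_ge0.
  have xk1 : x ^+ k * `|x - 1| <= m%:R^-1.
    have [x1|x1] := leP 1 x.
      rewrite ger0_norm ?subr_ge0 //.
      have := xX k (ltnW kh).
      have : x - 1 <= m%:R^-1 / 2.
        have : x * (1 - m%:R^-1 / 8) <= 1 by rewrite (le_trans _ xr) // ler_wpM2l.
        have : x <= 2 by have := xX 1%N; rewrite expr1; apply; rewrite muln_gt0.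
        nra.
      nra.
    rewrite ltr0_norm ?subr_lt0 // opprB (le_trans _ km) //.
    have := subrX1 x k.
    have : k%:R * x ^+ k <= \sum_(i < k) x ^+ i.
      rewrite mulr_natl -[X in _ *+ X](card_ord k) -sumr_const; apply: ler_sum => i _.
      by apply: ler_wiXn2l => //; [exact: ltW | exact: ltnW].
    move=> hS E; rewrite -[X in _ <= X]div1r ler_pdivlMr //.
    move: (\sum_(i < k) x ^+ i) hS E => S hS E.
    have h1x : 0 <= 1 - x by lra.
    have := ler_wpM2r h1x hS; lra.
  rewrite expr2 ler_pM // mulr_ge0 //.
have -> : mul k.+1 - mul k = (tri k.+1 / k.+1%:R - tri k / k%:R) * x ^+ k.+1 +
   tri k / k%:R * (x ^+ k * (x - 1)) by rewrite /mul exprS; ring.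
rewrite (le_trans (ler_normD _ _)) //.
have h1 : `|(tri k.+1 / k.+1%:R - tri k / k%:R) * x ^+ k.+1| <= 4 * m%:R^-1 ^+ 2.
  rewrite normrM [`|x ^+ _|]ger0_norm ?exprn_ge0 //.
  have := xX k.+1 kh; have : 0 <= x ^+ k.+1 by rewrite exprn_ge0.
  have := normr_ge0 (tri k.+1 / k.+1%:R - tri k / k%:R); nra.
have h2 : `|tri k / k%:R * (x ^+ k * (x - 1))| <= m%:R^-1 ^+ 2.
  rewrite normrM ger0_norm ?divr_ge0 ?(ltW k0) // normrM [`|x ^+ k|]ger0_norm ?exprn_ge0 //.
lra.
Qed.

End Triangle.

(** * The dyadic norm of a Besov function *)
Section DyadicNorm.
Context {R : realType}.
Implicit Types (f g : R[i] -> R[i]) (p : {poly R[i]}).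

Lemma sup_discP g (M : R) :
  (sup_disc g <= M%:E)%E <-> forall z, nrm z < 1 -> nrm (g z) <= M.
Proof.
split => [h z z1|h].
  rewrite -lee_fin; apply: le_trans h; apply: ereal_sup_ubound; exists z => //.
  by rewrite /unit_disc /= nrmE ltcR.
apply: ge_ereal_sup => _ [z /= z1 <-]; rewrite lee_fin; apply: h.
by move: z1; rewrite /unit_disc /= nrmE ltcR.
Qed.

Lemma sup_disc_ge0 g : (0 <= sup_disc g)%E.
Proof.
apply: (@le_trans _ _ (nrm (g 0))%:E); first by rewrite lee_fin nrm_ge0.
by apply: ereal_sup_ubound; exists 0 => //; rewrite /unit_disc /= normr0.
Qed.

Lemma sup_disc_fin_num g : (sup_disc g < +oo)%E -> sup_disc g \is a fin_num.
Proof. by move=> h; rewrite ge0_fin_numE // sup_disc_ge0. Qed.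

Lemma sup_disc_poly p : (sup_disc (fun z => p.[z]) < +oo)%E.
Proof.
apply: (@le_lt_trans _ _ (\sum_(k < size p) nrm p`_k)%:E); last by rewrite ltry.
apply/sup_discP => z z1; rewrite horner_coef (le_trans (nrm_sum _ _ _)) //.
apply: ler_sum => k _; rewrite nrmM nrmX ler_piMr ?nrm_ge0 //.
by rewrite exprn_ile1 ?nrm_ge0 // ltW.
Qed.

Lemma coef_hadamard p f k : (hadamard p f)`_k = p`_k * taylor_coef f k.
Proof.
by rewrite coef_poly; case: ltnP => // h; rewrite nth_default // mul0r.
Qed.

Lemma size_hadamard p f : (size (hadamard p f) <= size p)%N.
Proof. exact: size_poly. Qed.

Lemma coef_W n k : (W n.+1 : {poly R[i]})`_k = (triangle n.+1 k%:R)%:C%C.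
Proof.
rewrite coef_poly; case: ltnP => // h.
by rewrite triangle_high ?rmorph0 // (leq_trans _ h) // !expnS mulnA leqnSn.
Qed.

Lemma size_W n : (size (W n.+1 : {poly R[i]}) <= (4 * 2 ^ n).+1)%N.
Proof. by rewrite (leq_trans (size_poly _ _)) // !expnS mulnA. Qed.

Section Block.
Variables (f : R[i] -> R[i]) (n : nat) (r B : R).
Hypothesis fS : has_series f (taylor_coef f) 1.
Local Notation m := (2 ^ n)%N.
Hypothesis rm : 1 - (8 * m%:R)^-1 <= r.
Hypothesis r1 : r < 1.
Hypothesis fB : forall z, nrm z = r -> nrm (cderive f z) <= B.

Let mR : 0 < m%:R :> R. Proof. by rewrite ltr0n expn_gt0. Qed.

Let r0 : 0 < r.
Proof.
apply: lt_le_trans rm; rewrite subr_gt0 invf_lt1 ?mulr_gt0 //.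
by rewrite -natrM ltr1n (leq_trans (isT : 1 < 8)%N) // leq_pmulr // expn_gt0.
Qed.

(** The multiplier theorem speaks of polynomials, so [z f'(z)] enters through its partial
    sums. *)
Let partial_le e : 0 < e -> exists L, forall N, (L <= N)%N -> forall z, nrm z = r ->
  nrm (\sum_(k < N.+1) k%:R * taylor_coef f k * z ^+ k) <= B + e.
Proof.
move=> e0; pose rho := (r + 1) / 2.
have rp := r0; have rp1 := r1.
have rrho : r < rho by rewrite /rho; lra.
have rho0 : 0 < rho by rewrite /rho; lra.
have rho1 : 0 < rho < 1 by rewrite rho0 /= /rho; lra.
have dS := has_series_cderive fS.
have [A hA] := dS.1 rho rho1.
have A0 : 0 <= A by apply: le_trans (hA 0%N); rewrite mulr_ge0 ?nrm_ge0.
have q01 : 0 <= r / rho < 1.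
  by rewrite (divr_ge0 (ltW rp) (ltW rho0)) /= ltr_pdivrMr // mul1r.
have q1 : 0 < 1 - r / rho by case/andP: q01; rewrite subr_gt0.
have [L hL] := exists_expr_le q01 (divr_gt0 (mulr_gt0 e0 q1) (ltr_wpDl A0 ltr01)).
exists L => N LN z zr.
have -> : \sum_(k < N.+1) k%:R * taylor_coef f k * z ^+ k =
    z * \sum_(k < N) dcoef (taylor_coef f) k * z ^+ k.
  rewrite big_ord_recl !mul0r add0r mulr_sumr; apply: eq_bigr => k _.
  by rewrite lift0 /dcoef exprS; ring.
have zrho : nrm z < rho by rewrite zr.
have tail := has_series_tail N dS rho1 zrho hA; rewrite zr in tail.
have {tail} tail : A * (r / rho) ^+ N / (1 - r / rho) <= e.
  rewrite ler_pdivrMr //; have := hL N LN; rewrite ler_pdivlMr ?ltr_wpDl //.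
  have : 0 <= (r / rho) ^+ N by rewrite exprn_ge0 //; case/andP: q01.
  lra.
have tail' := le_trans (has_series_tail N dS rho1 zrho hA) (_ : _ <= e).
rewrite zr in tail'; have {tail'} h := tail' tail.
rewrite nrmM zr; set S := \sum_(k < N) _ in h *.
have hB := fB zr; have hS := nrm_le_dist S (cderive f z); rewrite nrm_distC in hS.
have S0 := nrm_ge0 S; nra.
Qed.

(** [W_(n+1) * f] arises from [z f'(z)] by a multiplier of size [1 / m]. *)
Lemma block_le zt : nrm zt < 1 ->
  nrm (hadamard (W n.+1) f).[zt] <= 60 / m%:R * B.
Proof.
move=> zt1; pose sg := nrm zt; pose x := sg / r.
have sg0 : 0 <= sg := nrm_ge0 zt.
have x0 : 0 <= x := divr_ge0 sg0 (ltW r0).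
have xr : x * r <= 1 by rewrite /x divfK ?gt_eqF // ltW.
have [z zr zE] : exists2 z : R[i], nrm z = r & x%:C%C * z = zt.
  have [zt0|zt0] := eqVneq zt 0.
    exists r%:C%C; first by rewrite nrm_real gtr0_norm.
    by rewrite /x /sg zt0 nrm0 mul0r rmorph0 mul0r.
  have sgp : 0 < sg by rewrite nrm_gt0.
  exists (zt * (r / sg)%:C%C).
    by rewrite nrmM nrm_real ger0_norm ?divr_ge0 ?(ltW r0) // mulrC divfK // gt_eqF.
  rewrite mulrCA -rmorphM (_ : x * (r / sg) = 1) ?rmorph1 ?mulr1 //.
  by rewrite /x; field; rewrite !gt_eqF.
pose mul k : R := triangle n.+1 k%:R / k%:R * x ^+ k.
have [mulV mulD] := integrating_multiplier rm r1 x0 xr.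
rewrite -/(mul _) in mulV mulD.
have V0 : 0 < 20 / m%:R :> R by rewrite divr_gt0.
suff H e : 0 < e -> nrm (hadamard (W n.+1) f).[zt] <= 3 * (20 / m%:R) * (B + e).
  apply/ler_addgt0Pr => e e0.
  have := H (e * m%:R / 60) (divr_gt0 (mulr_gt0 e0 mR) (ltr0n R 60)).
  have -> : 3 * (20 / m%:R) * (B + e * m%:R / 60) = 60 / m%:R * B + e.
    by field; rewrite gt_eqF.
  by [].
move=> e0; have [L hL] := partial_le e0.
pose N := maxn L (4 * m).
have -> : (hadamard (W n.+1) f).[zt] = \sum_(k < N.+1)
   (mul k)%:C%C * (k%:R * taylor_coef f k) * z ^+ k.
  rewrite (@horner_coef_wide _ N.+1); last first.
    rewrite (leq_trans (size_hadamard _ _)) // (leq_trans (size_W n)) // ltnS.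
    exact: leq_maxr.
  apply: eq_bigr => k _; rewrite coef_hadamard coef_W -zE exprMn /mul.
  have [->|k0] := posnP k.
    have T0 : triangle n.+1 0%N%:R = 0 :> R by exact: triangle_low.
    by rewrite T0 !mul0r ?mulr0 ?mul0r.
  have kC : k%:R != 0 :> R[i] by rewrite pnatr_eq0 -lt0n.
  have kE : (k%:R^-1)%:C%C = k%:R^-1 :> R[i].
    by rewrite fmorphV; congr (_^-1); exact: (rmorph_nat (real_complex R)).
  have xE : (x ^+ k)%:C%C = x%:C%C ^+ k :> R[i] by rewrite rmorphXn.
  have -> : (triangle n.+1 k%:R / k%:R * x ^+ k)%:C%C =
      (triangle n.+1 k%:R)%:C%C / k%:R * x%:C%C ^+ k :> R[i].
    by rewrite (rmorphM (real_complex R)) /= (rmorphM (real_complex R)) /= kE xE.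
  move: (x%:C%C ^+ k) (z ^+ k) => u v.
  by field; exact: kC.
apply: (@multiplier_circle R (4 * m) N.+1 (fun k => (mul k)%:C%C)
  (fun k => k%:R * taylor_coef f k) (20 / m%:R) (B + e) r) => //.
- by rewrite muln_gt0 expn_gt0.
- by rewrite /mul triangle_low // !mul0r.
- by move=> k km; rewrite /mul triangle_high // !mul0r.
- by move=> k; rewrite nrm_real; have /andP[h1 h2] := mulV k; rewrite ger0_norm.
- by move=> k; rewrite -rmorphB nrm_real; exact: mulD.
- by move=> y yr; apply: hL => //; exact: leq_maxl.
Qed.

End Block.

Lemma max_circle_ge (g : R[i] -> R[i]) (r : R) z : 0 < r -> nrm z = r ->
  ((nrm (g z))%:E <= max_circle g r)%E.
Proof.
move=> r0 zr; have [a ->] := polar r0 zr.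
by apply: ereal_sup_ubound; exists a.
Qed.

Lemma max_circle_ge0 (g : R[i] -> R[i]) r : (0 <= max_circle g r)%E.
Proof.
apply: (@le_trans _ _ (nrm (g (r * cos 0 +i* (r * sin 0))%C))%:E).
  by rewrite lee_fin nrm_ge0.
by apply: ereal_sup_ubound; exists 0.
Qed.

Variable f : R[i] -> R[i].
Hypothesis bf : besov f.

Let I0 := (\int[@lebesgue_measure R]_(r in `[0%R, 1%R[) max_circle (cderive f) r)%E.

Let I0_ge0 : (0 <= I0)%E.
Proof. by apply: integral_ge0 => r _; exact: max_circle_ge0. Qed.

Let sup_fin : (sup_disc f < +oo)%E.
Proof. by case: bf => _; apply: le_lt_trans; rewrite leeDl. Qed.

Let I0_fin : (I0 < +oo)%E.
Proof. by case: bf => _; apply: le_lt_trans; rewrite leeDr // sup_disc_ge0. Qed.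

Lemma besov_taylor : has_series f (taylor_coef f) 1.
Proof.
apply: (@holomorphic_taylor _ f (fine (sup_disc f))).
  move=> z z1; apply: derivable_cderivable; apply: bf.1.
  by rewrite /unit_disc /= nrmE ltcR.
apply/sup_discP; rewrite fineK //; exact: sup_disc_fin_num.
Qed.

Let w n : R := fine (sup_disc (fun z => (hadamard (W n) f).[z])).

Let w_ge0 n : 0 <= w n. Proof. by apply: fine_ge0; exact: sup_disc_ge0. Qed.

(** The radii at which [block_le] bounds the block [n.+1]; they fill an interval of length
    [1 / (16 * 2 ^ n)], which compensates the factor [2 ^ n] in [annulus_le]. *)
Let annulus n : set R := `[(1 - (8 * (2 ^ n)%:R)^-1)%R, (1 - (16 * (2 ^ n)%:R)^-1)%R[%classic.

Let annulus_le n r : annulus n r ->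
  0 < r /\ (((2 ^ n)%:R / 60 * w n.+1)%:E <= max_circle (cderive f) r)%E.
Proof.
rewrite /annulus /= in_itv /= => /andP[rl rh].
have mR : 0 < (2 ^ n)%:R :> R by rewrite ltr0n expn_gt0.
have m1 : 1 <= (2 ^ n)%:R :> R by rewrite ler1n expn_gt0.
have r1 : r < 1 by rewrite (lt_trans rh) // gtrBl invr_gt0 mulr_gt0.
have r0 : 0 < r.
  apply: lt_le_trans rl; rewrite subr_gt0 invf_lt1 ?mulr_gt0 //; lra.
split=> //; have := max_circle_ge0 (cderive f) r.
case E : (max_circle (cderive f) r) => [M| |] // _; last by rewrite leey.
have hM z : nrm z = r -> nrm (cderive f z) <= M.
  by move=> zr; rewrite -lee_fin -E; exact: max_circle_ge.
have : (sup_disc (fun z => (hadamard (W n.+1) f).[z]) <= (60 / (2 ^ n)%:R * M)%:E)%E.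
  by apply/sup_discP => z z1; apply: (block_le besov_taylor rl r1 hM).
rewrite -[X in (X <= _)%E]fineK ?sup_disc_fin_num ?sup_disc_poly // !lee_fin -/(w n.+1).
move=> h; have := ler_wpM2l (ltW (divr_gt0 mR (ltr0n R 60))) h.
by rewrite mulrA (_ : (2 ^ n)%:R / 60 * (60 / (2 ^ n)%:R) = 1) ?mul1r //; field; rewrite gt_eqF.
Qed.

Let annulus_disj i j x : annulus i x -> annulus j x -> i = j.
Proof.
wlog ij : i j / (i < j)%N.
  move=> H hi hj; have [ij|ij|//] := ltngtP i j; first exact: H.
  by apply/esym/H.
rewrite /annulus /= !in_itv /= => /andP[_ h1] /andP[h2 _]; exfalso.
have : (16 * (2 ^ i)%:R)^-1 >= (8 * (2 ^ j)%:R)^-1 :> R.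
  rewrite lef_pV2 ?posrE ?mulr_gt0 ?ltr0n ?expn_gt0 //.
  have : (2 ^ i.+1)%:R <= (2 ^ j)%:R :> R by rewrite ler_nat leq_exp2l.
  rewrite expnS natrM; lra.
lra.
Qed.

Let sum_w_le N : ((\sum_(n < N) w n.+1 / 960)%:E <= I0)%E.
Proof.
have := @step_le_integral R annulus (fun n => (2 ^ n)%:R / 60 * w n.+1) N
  `[0%R, 1%R[%classic (max_circle (cderive f)).
have mR n : 0 < (2 ^ n)%:R :> R by rewrite ltr0n expn_gt0.
move=> H; apply: le_trans (H _ _ _ _ _) => {H}.
- rewrite -sumEFin le_eqVlt; apply/orP; left; apply/eqP; apply: eq_bigr => n _.
  have m0 := mR n; rewrite lebesgue_measure_itv /= lte_fin.
  have -> : 1 - (8 * (2 ^ n)%:R)^-1 < 1 - (16 * (2 ^ n)%:R)^-1 :> R.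
    by rewrite ltrD2l ltrN2 ltf_pV2 ?posrE ?mulr_gt0 // ltr_pM2r // ltr_nat.
  rewrite -EFinB -EFinM; congr (_%:E); field; by rewrite gt_eqF.
- by move=> n; exact: measurable_itv.
- by move=> n; rewrite mulr_ge0 // divr_ge0.
- exact: annulus_disj.
- move=> i x _ hx; have [x0 hle] := annulus_le hx; split=> //.
  move: hx; rewrite /annulus /= !in_itv /= => /andP[_ h]; rewrite ltW //=.
  by rewrite (lt_trans h) // gtrBl invr_gt0 mulr_gt0.
- by move=> x _; exact: max_circle_ge0.
Qed.

(** The blocks are bounded by the integrals of the maximum of [|f'|] over disjoint
    intervals of radii. *)
Theorem besov_star_norm : (star_norm f < +oo)%E.
Proof.
have I0fin : I0 \is a fin_num by rewrite ge0_fin_numE.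
apply: (@le_lt_trans _ _ (w 0 + 960 * fine I0)%:E); last by rewrite ltry.
apply: lime_le; first by apply: is_cvg_nneseries => n _ _; exact: sup_disc_ge0.
apply: nearW => N.
have E n : sup_disc (fun z => (hadamard (W n) f).[z]) = (w n)%:E.
  by rewrite fineK // sup_disc_fin_num // sup_disc_poly.
under eq_bigr do rewrite E.
rewrite sumEFin lee_fin.
have : \sum_(n < N) w n.+1 <= 960 * fine I0.
  have := sum_w_le N; rewrite -[X in (_ <= X)%E]fineK // lee_fin -mulr_suml.
  by rewrite (ler_pdivrMr _ _ (ltr0n R 960)) [_ * 960]mulrC; apply.
move=> h; rewrite big_mkord; apply: (@le_trans _ _ (w 0 + \sum_(n < N) w n.+1)); last by rewrite lerD2l.
case: N {h} => [|N].
  by rewrite !big_ord0 addr0.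
by rewrite big_ord_recl lerD2l big_ord_recr /= lerDl.
Qed.

End DyadicNorm.

(** * Convergence of the calculus *)
Section OperatorSeries.
Context {R : realType} {X : completeNormedModType R[i]}.
Variables (P : nat -> X -> X) (K : R) (w : nat -> R).
Hypothesis linP : forall n, linear (P n).
Hypothesis K0 : 0 <= K.
Hypothesis w0 : forall n, 0 <= w n.
Hypothesis bndP : forall n x, nrm (P n x) <= K * w n * nrm x.
Hypothesis sum_fin : (\sum_(0 <= n <oo) (w n)%:E < +oo)%E.

Let S N x := \sum_(0 <= n < N) P n x.
Let L x := lim (S N x @[N --> \oo]).
Let sg N := \sum_(0 <= n < N) w n.
Let s := fine (\sum_(0 <= n <oo) (w n)%:E)%E.

Let s_fin : (\sum_(0 <= n <oo) (w n)%:E)%E = s%:E.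
Proof.
rewrite fineK // ge0_fin_numE //; apply: nneseries_ge0 => n _ _.
by rewrite lee_fin.
Qed.

Let sg_mono M N : (N <= M)%N -> sg N <= sg M.
Proof.
move=> NM; rewrite /sg [leRHS](big_cat_nat (n := N)) //= lerDl.
by apply: sumr_ge0.
Qed.

Let sg_cvg : (sg N)%:E @[N --> \oo] --> s%:E.
Proof.
rewrite -s_fin; have h : cvg ((\sum_(0 <= n < N) (w n)%:E)%E @[N --> \oo]).
  by apply: is_cvg_nneseries => n _ _; rewrite lee_fin.
by under eq_fun => N do rewrite -sumEFin.
Qed.

Let sg_le N : sg N <= s.
Proof.
rewrite -lee_fin; apply: (cvge_ge _ sg_cvg).
by exists N => // M /= NM; rewrite lee_fin sg_mono.
Qed.

Let tail_small e : 0 < e -> exists N0, forall N, (N0 <= N)%N -> s - sg N < e.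
Proof.
move=> e0; have /fine_cvgP[_ /cvgrPdist_lt /(_ e e0) [N0 _ hN]] := sg_cvg.
exists N0 => N N0N; have := hN N N0N; rewrite /= ger0_norm // subr_ge0.
exact: sg_le.
Qed.

Let S_dist x M N : (N <= M)%N -> nrm (S M x - S N x) <= K * (s - sg N) * nrm x.
Proof.
move=> NM; have -> : S M x - S N x = \sum_(N <= n < M) P n x.
  by rewrite /S [X in X - _](big_cat_nat (n := N)) //= [X in X - _]addrC addrK.
apply: le_trans (nrm_sum _ _ _) _.
apply: (@le_trans _ _ (K * (sg M - sg N) * nrm x)).
  have -> : sg M - sg N = \sum_(N <= n < M) w n.
    by rewrite /sg [X in X - _](big_cat_nat (n := N)) //= [X in X - _]addrC addrK.
  by rewrite mulr_sumr mulr_suml; apply: ler_sum => n _.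
by rewrite ler_wpM2r ?nrm_ge0 // ler_wpM2l // lerD2r sg_le.
Qed.

Let S_cvg x : S N x @[N --> \oo] --> L x.
Proof.
apply: cvg_of_cauchy => e e0.
have eE : e = (complex.Re e)%:C%C by rewrite RRe_real // gtr0_real.
have e0' : 0 < complex.Re e by rewrite -ltcR -eE.
have kx0 : 0 < K * nrm x + 1 by rewrite ltr_wpDl // mulr_ge0 ?nrm_ge0.
have d0 : 0 < complex.Re e / (K * nrm x + 1) by rewrite divr_gt0.
have [N0 hN] := tail_small d0; exists N0.
have H m n : (N0 <= n)%N -> (n <= m)%N -> `|S m x - S n x| < e.
  move=> N0n nm; rewrite nrmE eE ltcR; apply: le_lt_trans (S_dist x nm) _.
  have := hN n N0n; rewrite ltr_pdivlMr //; have := sg_le n; have := nrm_ge0 x.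
  set y := nrm x; set d := s - sg n; move=> y0 h1 h2.
  have d0' : 0 <= d by rewrite subr_ge0.
  have -> : K * d * y = d * (K * y + 1) - d by ring.
  lra.
move=> m n N0m N0n; have [nm|nm] := leqP n m; first exact: H.
by rewrite distrC; apply: H => //; exact: ltnW.
Qed.

Let L_dist x N : nrm (S N x - L x) <= K * (s - sg N) * nrm x.
Proof.
apply/ler_addgt0Pr => e e0; have e0' : 0 < e%:C%C by rewrite ltcR.
have /cvgrPdist_lt /(_ _ e0') [N0 _ hN] := @S_cvg x.
have := hN _ (leq_maxl N0 N); rewrite /= nrmE ltcR => h.
have -> : S N x - L x = (S (maxn N0 N) x - L x) - (S (maxn N0 N) x - S N x).
  by rewrite opprB [RHS]addrC addrA subrK.
apply: le_trans (nrmB _ _) _; rewrite addrC lerD //.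
  by apply: S_dist; exact: leq_maxr.
by rewrite nrm_distC ltW.
Qed.

Let linS N : linear (S N).
Proof.
move=> a x y; rewrite /S scaler_sumr -big_split /=; apply: eq_bigr => n _.
exact: linP.
Qed.

Let linL : linear L.
Proof.
move=> a x y.
have h : S N (a *: x + y) @[N --> \oo] --> a *: L x + L y.
  under eq_fun do rewrite linS.
  by apply: cvgD; [apply: cvgZr; exact: S_cvg | exact: S_cvg].
by apply: (cvg_lim _ h).
Qed.

(** All partial sums are compared with the numerical series, so the rate of convergence is
    uniform on the unit ball. *)
Lemma operator_series :
  [/\ bounded_op L, opnorm (fun x => S N x - L x) @[N --> \oo] --> 0%E
    & (opnorm L <= K%:E * (\sum_(0 <= n <oo) (w n)%:E))%E].
Proof.
have bL : (opnorm L <= (K * s)%:E)%E.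
  have s0 : 0 <= s by apply: le_trans (sg_le 0%N); rewrite /sg big_geq.
  apply/opnormP => //; first exact: mulr_ge0.
  move=> x; have := L_dist x 0; rewrite /S /sg !big_geq // sub0r nrmN subr0.
  by [].
have linD N : linear (fun x => S N x - L x).
  move=> a x y; rewrite linS linL scalerBr; set u := a *: _; set v := a *: _.
  by rewrite opprD addrACA.
split.
- by split=> //; apply: le_lt_trans bL _; rewrite ltry.
- apply: (@squeeze_cvge _ _ _ _ (fun=> 0%E) _ (fun N => (K * (s - sg N))%:E)).
  + apply: nearW => N; apply/andP; split; first exact: opnorm_ge0 (linD N).
    have h0 : 0 <= K * (s - sg N) by rewrite mulr_ge0 // subr_ge0.
    by apply/(opnormP (linD N) h0).2 => x; exact: L_dist.
  + exact: cvg_cst.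
  + have -> : 0%E = (K * (s - s))%:E by rewrite subrr mulr0.
    apply: cvg_EFin; first exact: nearW.
    apply: cvgMr; apply: cvgB; first exact: cvg_cst.
    by have /fine_cvgP[] := sg_cvg.
- by rewrite s_fin -EFinM.
Qed.

End OperatorSeries.

(** For the linear coefficient use [p.[r] - p.[- r] = 2 * r * p`_1] with [r < 1] close
    enough to 1. *)
Lemma affine_coef_le {R : realType} (p : {poly R[i]}) (B : R) : (size p <= 2)%N ->
  (forall z, nrm z < 1 -> nrm p.[z] <= B) -> nrm p`_0 <= B /\ nrm p`_1 <= B.
Proof.
move=> sp hB; split.
  by rewrite -horner_coef0; apply: hB; rewrite nrm0.
have pE z : p.[z] = p`_0 + p`_1 * z.
  by rewrite (horner_coef_wide z sp) big_ord_recl big_ord1 expr0 mulr1.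
rewrite leNgt; apply/negP => h; set c := nrm p`_1 in h.
have B0 : 0 <= B by apply: le_trans (hB 0 _); rewrite ?nrm0 ?nrm_ge0.
have c0 : 0 < c by lra.
(* If [c] exceeded [B], this radius would be admissible and [2 * r * c] exceed [2 * B]. *)
pose r := (B + c) / (2 * c).
have r0 : 0 <= r by rewrite divr_ge0 //; lra.
have r1 : r < 1 by rewrite /r ltr_pdivrMr; lra.
have h1 : nrm p.[r%:C%C] <= B by apply: hB; rewrite nrm_real ger0_norm.
have h2 : nrm p.[- r%:C%C] <= B by apply: hB; rewrite nrmN nrm_real ger0_norm.
have := nrmB p.[r%:C%C] p.[- r%:C%C].
have -> : p.[r%:C%C] - p.[- r%:C%C] = p`_1 * (r + r)%:C%C by rewrite !pE rmorphD /=; ring.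
rewrite nrmM nrm_real ger0_norm ?addr_ge0 // -/c.
have -> : c * (r + r) = B + c by rewrite /r; field; rewrite gt_eqF.
lra.
Qed.

Section RittOperator.
Context {R : realType} {X : completeNormedModType R[i]}.
Variable T : X -> X.
Hypothesis X0 : exists x : X, x != 0.
Hypothesis ritt : tadmor_ritt T.

Local Notation C := (fine (ritt_const T)).
Let t := fine (opnorm T).

Let linT : linear T. Proof. by case: ritt => -[]. Qed.

Let t0 : 0 <= t. Proof. by apply: fine_ge0; exact: opnorm_ge0. Qed.

Let bndT x : nrm (T x) <= t * nrm x.
Proof.
have [[_ tfin] _ _] := ritt.
move: x; apply/opnormP => //; rewrite fineK //.
by rewrite ge0_fin_numE // opnorm_ge0.
Qed.

Let resT z : 1 < nrm z -> is_resolvent T z (resolvent z T).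
Proof.
move=> z1; apply: (@xgetPex _ (fun=> 0) [set S | is_resolvent T z S]).
have [_ sp _] := ritt; apply: contrapT => h.
by have := sp z h; rewrite /= nrmE -[1]/(1%:C%C) lecR leNgt z1.
Qed.

Let linR z : 1 < nrm z -> linear (resolvent z T).
Proof. by move=> /resT[[]]. Qed.

Let RsK z x : 1 < nrm z -> resolvent z T (z *: x - T x) = x.
Proof. by move=> /resT[_ h _]. Qed.

Let RsKr z x : 1 < nrm z -> z *: resolvent z T x - T (resolvent z T x) = x.
Proof. by move=> /resT[_ _ h]. Qed.

Let linR1 z : 1 < nrm z -> linear (fun x => (z - 1) *: resolvent z T x).
Proof.
move=> z1 a x y; rewrite (linR z1) scalerDr !scalerA; congr (_ *: _ + _).
exact: mulrC.
Qed.

Let ritt_le z : 1 < nrm z ->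
  (opnorm (fun x => (z - 1) *: resolvent z T x) <= ritt_const T)%E.
Proof.
move=> z1; apply: ereal_sup_ubound; exists z => //=.
by rewrite nrmE -[1]/(1%:C%C) ltcR.
Qed.

Let ritt_ge0 : (0 <= ritt_const T)%E.
Proof.
have h : 1 < nrm (2%:R : R[i]) by rewrite nrm_nat ltr1n.
by apply: le_trans (ritt_le h); apply: opnorm_ge0; exact: linR1.
Qed.

Let CE : ritt_const T = C%:E.
Proof. by rewrite fineK // ge0_fin_numE //; case: ritt. Qed.

Let C0 : 0 <= C. Proof. exact: fine_ge0. Qed.

Let bndR z x : 1 < nrm z -> nrm (z - 1) * nrm (resolvent z T x) <= C * nrm x.
Proof.
move=> z1; rewrite -nrmZ; move: x.
apply/(@opnormP _ _ (fun x => (z - 1) *: resolvent z T x)); [exact: linR1|exact: C0|].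
by rewrite -CE; exact: ritt_le.
Qed.

(** In [x = (z - 1) R(z) x + (1 - T) R(z) x] the first term is at most [C] times as long
    as [x], and the second one vanishes as [z] tends to infinity. *)
Lemma ritt_const_ge1 : 1 <= C.
Proof.
have [x x0] := X0; have n0 : 0 < nrm x by rewrite nrm_gt0.
apply/ler_addgt0Pr => e e0; have hC := C0; have ht := t0.
have k0 : 0 < (1 + t) * C + 1 by rewrite ltr_wpDl // mulr_ge0 // addr_ge0.
pose d := ((1 + t) * C + 1) / e.
have d0 : 0 < d by rewrite divr_gt0.
pose z : R[i] := (1 + d)%:C%C.
have z1 : 1 < nrm z by rewrite nrm_real gtr0_norm; lra.
have zd : nrm (z - 1) = d.
  by rewrite /z rmorphD /= rmorph1 addrC addrA addNr add0r nrm_real gtr0_norm.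
have h1 := bndR x z1; rewrite zd in h1.
set u := resolvent z T x in h1.
have xE : x = (z - 1) *: u + (u - T u).
  by rewrite scalerBl scale1r addrA subrK; apply/esym/RsKr.
have h2 : nrm x <= C * nrm x + (1 + t) * nrm u.
  rewrite {1}xE (le_trans (nrmD _ _)) // lerD // ?nrmZ ?zd //.
  by rewrite (le_trans (nrmB _ _)) // mulrDl mul1r lerD2l bndT.
rewrite -(ler_pM2r n0) mul1r mulrDl (le_trans h2) // lerD2l.
have h3 : d * ((1 + t) * nrm u) <= (1 + t) * C * nrm x.
  by rewrite mulrCA -mulrA ler_wpM2l // addr_ge0.
rewrite -(ler_pM2l d0) (le_trans h3) //.
rewrite mulrA /d divfK ?gt_eqF // ler_wpM2r ?nrm_ge0 //; lra.
Qed.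

Let poly_op_wide (p : {poly R[i]}) N x : (size p <= N)%N ->
  poly_op p T x = \sum_(k < N) p`_k *: iter k T x.
Proof.
move=> pN; rewrite /poly_op (big_ord_widen _ (fun k => p`_k *: iter k T x) pN).
rewrite big_mkcond /=; apply: eq_bigr => k _; case: ltnP => // h.
by rewrite nth_default // scale0r.
Qed.

Lemma poly_op_linear (p : {poly R[i]}) : linear (poly_op p T).
Proof.
move=> a x y; rewrite /poly_op scaler_sumr -big_split /=; apply: eq_bigr => k _.
by rewrite (linear_iter k linT) scalerDr !scalerA mulrC.
Qed.

Lemma dyadic_block_le f n x :
  nrm (poly_op (hadamard (W n) f) T x) <= 70 * 1000 * C * ln (C + 1) *
    fine (sup_disc (fun z => (hadamard (W n) f).[z])) * nrm x.
Proof.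
set p := hadamard (W n) f; set B := fine (sup_disc _).
have C1 := ritt_const_ge1.
have pB z : nrm z < 1 -> nrm p.[z] <= B.
  by move: z; apply/sup_discP; rewrite fineK // sup_disc_fin_num // sup_disc_poly.
case: n @p @B pB => [|n] p B pB.
  have sp : (size p <= 2)%N.
    apply: leq_trans (size_hadamard _ _) _.
    by rewrite /W (leq_trans (size_polyD _ _)) // size_poly1 size_polyX.
  have [h0 h1] := affine_coef_le sp pB.
  rewrite (poly_op_wide x sp) big_ord_recl big_ord1 /=.
  exact: (affine_poly_le linT bndT linR RsK RsKr C1 bndR).
apply: (@dyadic_poly_le R X T (fun z => resolvent z T) C t linT bndT linR RsK RsKr C1 bndR
   (2 ^ n) (size p) (fun k => p`_k)); first by rewrite expn_gt0.
  move=> k; rewrite negb_and -!ltnNge coef_hadamard coef_W => /orP[h|h].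
    by rewrite triangle_low ?rmorph0 ?mul0r // ltnW.
  by rewrite triangle_high ?rmorph0 ?mul0r // ltnW.
move=> z zE; rewrite -horner_coef; apply: pB; rewrite zE.
by rewrite invf_lt1 ?(lt_trans ltr01) //; apply: outer_gt1; rewrite expn_gt0.
Qed.

Lemma besov_calculus (f : R[i] -> R[i]) : besov f ->
  [/\ bounded_op (besov_calc f T),
      opnorm (fun x => besov_partial f T N x - besov_calc f T x)
        @[N --> \oo] --> 0%E
    & (opnorm (besov_calc f T) <= (70 * 1000 * C * ln (C + 1))%:E * star_norm f)%E].
Proof.
move=> bf; have C1 := ritt_const_ge1.
pose w n := fine (sup_disc (fun z => (hadamard (W n) f).[z])).
have wE n : (w n)%:E = sup_disc (fun z => (hadamard (W n) f).[z]).
  by rewrite fineK // sup_disc_fin_num // sup_disc_poly.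
have sE : (\sum_(0 <= n <oo) (w n)%:E)%E = star_norm f by apply: eq_eseriesr => n _; exact: wE.
rewrite -sE; apply: (@operator_series R X (fun n => poly_op (hadamard (W n) f) T)).
- by move=> n; exact: poly_op_linear.
- have lnC : 0 <= ln (C + 1) by apply: ln_ge0; lra.
  apply: mulr_ge0 lnC; apply: mulr_ge0 (le_trans ler01 C1).
  by apply: mulr_ge0; exact: ler0n.
- by move=> n; apply: fine_ge0; exact: sup_disc_ge0.
- by move=> n x; exact: dyadic_block_le.
- by rewrite sE; exact: besov_star_norm.
Qed.

End RittOperator.

Theorem theorem6p1 (R : realType) :
  exists kappa : R, 0 < kappa /\
    forall (X : completeNormedModType R[i]) (T : X -> X) (f : R[i] -> R[i]),
      (exists x : X, x != 0) -> tadmor_ritt T -> besov f ->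
      [/\ bounded_op (besov_calc f T),
          opnorm (fun x => besov_partial f T N x - besov_calc f T x)
            @[N --> \oo] --> 0%E
        & (opnorm (besov_calc f T) <=
           (kappa * fine (ritt_const T) * ln (fine (ritt_const T) + 1))%:E
           * star_norm f)%E].
Proof.
exists (70 * 1000); split; first by apply: mulr_gt0; exact: ltr0n.
by move=> X T f X0 ritt bf; exact: besov_calculus.
Qed.
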